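(* There is an algorithm that, given a series-parallel graph $G$ with terminals $s$ and $t$, non-negative edge weights, a set $M$ of vulnerable edges and an integer $k\geq 0$, returns an optimal solution of the Fault-Tolerant Path problem on this instance (or reports infeasibility), and runs in time $O(nk)$, where $n$ is the number of vertices of $G$.
   Context: A graph is series-parallel with terminals $s,t$ if it can be built from single edges (each with its two endpoints as terminals) by the series composition (disjoint union of two series-parallel graphs with terminals $s,t$ and $s',t'$, identifying $t$ with $s'$) and the parallel composition (disjoint union, identifying $s$ with $s'$ and $t$ with $t'$). Fault-Tolerant Path: find a minimum-weight edge set $S$ such that $S\setminus F$ contains an $s$-$t$ path for every $F\subseteq M$ with $|F|\leq k$.
   Formalization: The graph G is assumed simple (with n = 2 and unboundedly many parallel edges no algorithm can even read the input in time O(nk)), and the time bound O(nk) is stated as O(n·max(k,1)), since for k = 0 the literal bound would be zero. *)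

(* Defs.v *)
From HB Require Import structures.
From mathcomp Require Import all_boot all_order all_algebra.

Set Implicit Arguments.
Unset Strict Implicit.
Unset Printing Implicit Defensive.

Import Order.TTheory GRing.Theory Num.Theory.

(* Undirected two-terminal graphs on vertices 0..nv-1 and edges 0..ne-1; the
   order of the pair [ends e] carries no meaning.  Parallel edges and loops are
   excluded only by [simple_graph]. *)
Record tgraph := TGraph {
  nv : nat;
  ne : nat;
  ends : 'I_ne -> 'I_nv * 'I_nv;
  src : 'I_nv;
  snk : 'I_nv }.

Definition joins (G : tgraph) (e : 'I_(ne G)) (u v : 'I_(nv G)) : bool :=
  (ends e == (u, v)) || (ends e == (v, u)).

Definition simple_graph (G : tgraph) : Prop :=
  (forall (e : 'I_(ne G)) v, ~~ joins e v v) /\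
  (forall (e f : 'I_(ne G)) u v, joins e u v -> joins f u v -> e = f).

(* [glues same fV fE]: G is, up to isomorphism, the disjoint union of G1 and G2
   in which x in G1 is identified with y in G2 exactly when [same x y]; fV is
   the projection from the disjoint union of the vertex sets. *)
Definition glues (G1 G2 G : tgraph) (same : 'I_(nv G1) -> 'I_(nv G2) -> bool)
    (fV : 'I_(nv G1) + 'I_(nv G2) -> 'I_(nv G))
    (fE : 'I_(ne G1) + 'I_(ne G2) -> 'I_(ne G)) : Prop :=
  [/\ (forall v, exists u, fV u = v),
      injective (fun x => fV (inl x)),
      injective (fun y => fV (inr y)) &
      (forall x y, fV (inl x) = fV (inr y) <-> same x y)] /\
  [/\ bijective fE,
      (forall e, joins (fE (inl e)) (fV (inl (ends e).1)) (fV (inl (ends e).2))) &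
      (forall e, joins (fE (inr e)) (fV (inr (ends e).1)) (fV (inr (ends e).2)))].

Definition single_edge (G : tgraph) : Prop :=
  [/\ nv G = 2, ne G = 1, src G != snk G &
      forall e : 'I_(ne G), joins e (src G) (snk G)].

Definition series_comp (G1 G2 G : tgraph) : Prop :=
  exists fV fE,
    [/\ @glues G1 G2 G (fun x y => (x == snk G1) && (y == src G2)) fV fE,
        src G = fV (inl (src G1)) & snk G = fV (inr (snk G2))].

Definition parallel_comp (G1 G2 G : tgraph) : Prop :=
  exists fV fE,
    [/\ @glues G1 G2 G (fun x y => (x == src G1) && (y == src G2) ||
                                   (x == snk G1) && (y == snk G2)) fV fE,
        src G = fV (inl (src G1)) & snk G = fV (inl (snk G1))].

Inductive series_parallel : tgraph -> Prop :=
| SP_edge G : single_edge G -> series_parallel G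
| SP_series G1 G2 G : series_parallel G1 -> series_parallel G2 ->
    series_comp G1 G2 G -> series_parallel G
| SP_parallel G1 G2 G : series_parallel G1 -> series_parallel G2 ->
    parallel_comp G1 G2 G -> series_parallel G.

Definition has_st_path (G : tgraph) (A : {set 'I_(ne G)}) : bool :=
  connect (fun u v => [exists e in A, joins e u v]) (src G) (snk G).

Definition ftp_feasible (G : tgraph) (M : {set 'I_(ne G)}) (k : nat)
    (S : {set 'I_(ne G)}) : Prop :=
  forall F : {set 'I_(ne G)}, F \subset M -> #|F| <= k -> has_st_path (S :\: F).

Definition ftp_optimal (R : realDomainType) (G : tgraph) (w : 'I_(ne G) -> R)
    (M : {set 'I_(ne G)}) (k : nat) (S : {set 'I_(ne G)}) : Prop :=
  ftp_feasible M k S /\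
  forall S' : {set 'I_(ne G)}, ftp_feasible M k S' ->
    (\sum_(e in S) w e <= \sum_(e in S') w e)%R.

(* Model of computation: a uniform-cost RAM with structured control flow, whose
   cells hold either a natural number or a weight.  Naturals support constants,
   addition, truncated subtraction, comparison and use as addresses; there is no
   multiplication.  Weights can only be copied, added and compared.  Variables
   and arrays are named by numerals occurring in the program text, so a program
   uses a fixed finite number of them; only array indices are computed.
   Programs do not depend on the ordered domain of the weights. *)
Inductive iexp :=
| INum of nat
| IVar of nat
| IGet of nat & iexp
| IAdd of iexp & iexp
| ISub of iexp & iexp.

Inductive wexp :=
| WZero
| WVar of nat
| WGet of nat & iexp
| WAdd of wexp & wexp.

Inductive test :=
| TEq of iexp & iexp
| TLe of iexp & iexp
| TWLe of wexp & wexp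
| TNot of test
| TAnd of test & test.

Inductive cmd :=
| CSkip
| CISet of nat & iexp
| CIPut of nat & iexp & iexp
| CWSet of nat & wexp
| CWPut of nat & iexp & wexp
| CSeq of cmd & cmd
| CIf of test & cmd & cmd
| CWhile of test & cmd.

Record state (R : Type) := State {
  ivar : nat -> nat;
  iarr : nat -> nat -> nat;
  wvar : nat -> R;
  warr : nat -> nat -> R }.

Definition upd (T : Type) (f : nat -> T) (x : nat) (v : T) : nat -> T :=
  fun y => if y == x then v else f y.

Section Semantics.

Variable R : realDomainType.
Implicit Types (st : state R).

Fixpoint ieval st (e : iexp) : nat :=
  match e with
  | INum c => c
  | IVar x => ivar st x
  | IGet a i => iarr st a (ieval st i)
  | IAdd e1 e2 => ieval st e1 + ieval st e2
  | ISub e1 e2 => ieval st e1 - ieval st e2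
  end.

Fixpoint weval st (e : wexp) : R :=
  match e with
  | WZero => 0%R
  | WVar x => wvar st x
  | WGet a i => warr st a (ieval st i)
  | WAdd e1 e2 => (weval st e1 + weval st e2)%R
  end.

Fixpoint teval st (b : test) : bool :=
  match b with
  | TEq e1 e2 => ieval st e1 == ieval st e2
  | TLe e1 e2 => ieval st e1 <= ieval st e2
  | TWLe e1 e2 => (weval st e1 <= weval st e2)%R
  | TNot b1 => ~~ teval st b1
  | TAnd b1 b2 => teval st b1 && teval st b2
  end.

End Semantics.

(* Each operation occurring in an expression costs one time unit. *)
Fixpoint icost (e : iexp) : nat :=
  match e with
  | INum _ | IVar _ => 1
  | IGet _ i => (icost i).+1
  | IAdd e1 e2 | ISub e1 e2 => (icost e1 + icost e2).+1
  end.

Fixpoint wcost (e : wexp) : nat :=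
  match e with
  | WZero | WVar _ => 1
  | WGet _ i => (icost i).+1
  | WAdd e1 e2 => (wcost e1 + wcost e2).+1
  end.

Fixpoint tcost (b : test) : nat :=
  match b with
  | TEq e1 e2 | TLe e1 e2 => (icost e1 + icost e2).+1
  | TWLe e1 e2 => (wcost e1 + wcost e2).+1
  | TNot b1 => (tcost b1).+1
  | TAnd b1 b2 => (tcost b1 + tcost b2).+1
  end.

Definition set_ivar (R : Type) (st : state R) x v :=
  State (upd (ivar st) x v) (iarr st) (wvar st) (warr st).
Definition set_iarr (R : Type) (st : state R) a i v :=
  State (ivar st) (upd (iarr st) a (upd (iarr st a) i v)) (wvar st) (warr st).
Definition set_wvar (R : Type) (st : state R) x v :=
  State (ivar st) (iarr st) (upd (wvar st) x v) (warr st).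
Definition set_warr (R : Type) (st : state R) a i v :=
  State (ivar st) (iarr st) (wvar st) (upd (warr st) a (upd (warr st a) i v)).

(* [exec c st T st']: started in st, c halts in st' after exactly T time units. *)
Inductive exec (R : realDomainType) : cmd -> state R -> nat -> state R -> Prop :=
| E_Skip st : exec CSkip st 1 st
| E_ISet st x e : exec (CISet x e) st (icost e).+1 (set_ivar st x (ieval st e))
| E_IPut st a i e : exec (CIPut a i e) st (icost i + icost e).+1
    (set_iarr st a (ieval st i) (ieval st e))
| E_WSet st x e : exec (CWSet x e) st (wcost e).+1 (set_wvar st x (weval st e))
| E_WPut st a i e : exec (CWPut a i e) st (icost i + wcost e).+1
    (set_warr st a (ieval st i) (weval st e))
| E_Seq c1 c2 st T1 st1 T2 st2 :
    exec c1 st T1 st1 -> exec c2 st1 T2 st2 -> exec (CSeq c1 c2) st (T1 + T2) st2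
| E_IfTrue b c1 c2 st T st' : teval st b ->
    exec c1 st T st' -> exec (CIf b c1 c2) st (tcost b + T).+1 st'
| E_IfFalse b c1 c2 st T st' : ~~ teval st b ->
    exec c2 st T st' -> exec (CIf b c1 c2) st (tcost b + T).+1 st'
| E_WhileTrue b c st T1 st1 T2 st2 : teval st b ->
    exec c st T1 st1 -> exec (CWhile b c) st1 T2 st2 ->
    exec (CWhile b c) st (tcost b + T1 + T2).+1 st2
| E_WhileFalse b c st : ~~ teval st b -> exec (CWhile b c) st (tcost b).+1 st.

Definition load (T : Type) (m : nat) (z : T) (f : 'I_m -> T) (i : nat) : T :=
  if insub i is Some e then f e else z.

(* Input format: variables 0..4 hold the numbers of vertices and edges, the two
   terminals and k; integer arrays 0 and 1 hold the endpoints of the edges, and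
   array 2 the characteristic vector of M; weight array 0 holds the weights.
   Every other cell is 0. *)
Definition ftp_input (R : realDomainType) (G : tgraph) (w : 'I_(ne G) -> R)
    (M : {set 'I_(ne G)}) (k : nat) : state R :=
  State
    (fun x => nth 0 [:: nv G; ne G; val (src G); val (snk G); k] x)
    (fun a => match a with
      | 0 => load 0 (fun e : 'I_(ne G) => val (ends e).1)
      | 1 => load 0 (fun e : 'I_(ne G) => val (ends e).2)
      | 2 => load 0 (fun e : 'I_(ne G) => nat_of_bool (e \in M))
      | _ => fun _ => 0
      end)
    (fun _ => 0%R)
    (fun a => match a with
      | 0 => load 0%R w
      | _ => fun _ => 0%R
      end).

(* Output format: variable 0 is 1 if a solution is returned and 0 if the instance
   is reported infeasible; integer array 0 holds the characteristic vector of
   the returned edge set. *)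
Definition output_set (R : realDomainType) (G : tgraph) (st : state R) :
    {set 'I_(ne G)} :=
  [set e : 'I_(ne G) | iarr st 0 e == 1].

Definition ftp_correct_output (R : realDomainType) (G : tgraph)
    (w : 'I_(ne G) -> R) (M : {set 'I_(ne G)}) (k : nat) (st : state R) : Prop :=
  (ivar st 0 = 1 /\ ftp_optimal w M k (output_set G st)) \/
  (ivar st 0 = 0 /\ forall S : {set 'I_(ne G)}, ~ ftp_feasible M k S).

(* Main.v *)
Require Import Defs.
From HB Require Import structures.
From mathcomp Require Import all_boot all_order all_algebra zify.

Set Implicit Arguments.
Unset Strict Implicit.
Unset Printing Implicit Defensive.

Import Order.TTheory GRing.Theory Num.Theory.

(* Repeatedly eliminating a non-terminal vertex with exactly two distinct neighbours x, y
   (replacing it by an edge xy, merged with an existing one) reduces a series-parallel graph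
   to a single edge between the terminals, in whatever order the vertices are eliminated.
   Each elimination is a series composition, possibly followed by a parallel one, of
   decomposition trees attached to the edges.  Because memory is initially zero, a RAM can
   keep the adjacency matrix without initializing it; storing for each vertex the degree,
   the sum and the sum of squares of its neighbours lets it recover the two neighbours of
   a degree-two vertex in constant time, so that the whole decomposition takes time O(n).

   On a tree, let the demand j mean "survive any j - 1 faults".  A series node passes its
   demand to both children, a parallel node splits it, so the optimal weights satisfy a
   (min, +) recursion.  A tree with q leaves only has 2q essentially different demands, hence
   its table has at most min(k + 1, 2q) entries, and the convolutions at all the parallel
   nodes cost O(mk) in total; m is O(n) since the graph is simple. *)


(** * Vertex elimination in graphs *)

(** The degree-two vertex met by the program need not be the next one of a given reduction.
    Eliminations commute, and one can spoil another only in a triangle on two degree-two vertices;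
    there the second vertex would be left with one neighbour, which cannot happen to a vertex still
    to be eliminated. If x > y are the neighbours of v, then
    [2 (x^2 + y^2) - (x + y)^2 = (x - y)^2], so tables of squares, square roots and halves recover
    both; the tables are built by additions, as the machine has no multiplication. Demands already
    saturate at q + 1, but the cap 2q is additive over children, so the table size of a parent is
    the truncated sum of those of its children. Every decomposition node has a larger number than
    its children: tables are filled in ascending order and the solution is traced in descending
    order, without recursion. All phases except the tables of inner nodes cost O(n). Those tables
    are paid by a potential carried by the edges of the current network, so the amortized bound is
    an invariant of the reduction itself. *)

Section Elimination.
Variable T : eqType.
Implicit Types (adj fin : rel T) (u v x y z : T) (l : seq T).

Definition eliminate adj v : rel T := fun a b =>
  [&& a != v, b != v & adj a b || [&& adj v a, adj v b & a != b]].

Definition two_nbrs adj v :=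
  exists x y, x != y /\ forall z, adj v z = (z == x) || (z == y).

Inductive reduces : rel T -> seq T -> rel T -> Prop :=
| reduces_nil adj fin : adj =2 fin -> reduces adj [::] fin
| reduces_cons adj v l fin : two_nbrs adj v -> reduces (eliminate adj v) l fin ->
    reduces adj (v :: l) fin.

Definition sgraph adj := symmetric adj /\ irreflexive adj.

Definition pair_rel (s t : T) : rel T := fun a b =>
  (a == s) && (b == t) || (a == t) && (b == s).

Lemma eq_two_nbrs adj adj' v : adj =2 adj' -> two_nbrs adj v -> two_nbrs adj' v.
Proof. by move=> e [x [y [nxy H]]]; exists x, y; split=> // z; rewrite -e. Qed.

Lemma eq_eliminate adj adj' v : adj =2 adj' -> eliminate adj v =2 eliminate adj' v.
Proof. by move=> e a b; rewrite /eliminate !e. Qed.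

Lemma eq_reduces adj adj' l fin : adj =2 adj' -> reduces adj l fin -> reduces adj' l fin.
Proof.
move=> e r; elim: r adj' e => {adj l fin} [adj fin e0|adj v l fin t _ IH] adj' e.
  by apply: reduces_nil => a b; rewrite -e e0.
apply: reduces_cons; first exact: eq_two_nbrs e t.
exact/IH/eq_eliminate.
Qed.

Lemma sgraph_eliminate adj v : sgraph adj -> sgraph (eliminate adj v).
Proof.
move=> [sy ir]; split=> [a b|a]; last by rewrite /eliminate ir eqxx !andbF.
rewrite /eliminate sy (eq_sym a b); case: (a != v); case: (b != v) => //=.
by case: (adj v a); case: (adj v b).
Qed.

(** In either order, distinct [a] and [b] end up adjacent exactly when a path joins them whose inner
    vertices lie in [{u, v}], a condition symmetric in [u] and [v]. *)
Lemma eliminateC adj u v : symmetric adj ->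
  eliminate (eliminate adj u) v =2 eliminate (eliminate adj v) u.
Proof.
move=> sy a b; have [<-//|nuv] := eqVneq u v.
rewrite /eliminate (eq_sym v u) (sy v u) nuv (eq_sym v a) (eq_sym v b) (eq_sym u a) (eq_sym u b).
case: (a != v); case: (a != u); case: (b != v); case: (b != u) => //=; rewrite ?andbF //.
case: (a != b); rewrite ?andbF //.
by case: (adj a b) => //; case: (adj u a); case: (adj u b); case: (adj v a);
  case: (adj v b); case: (adj u v).
Qed.

(** The elimination of [v] can give [u] new neighbours only through [v], and at most one: [v] has
    two neighbours, and [u] is one of them. Going back, the gained neighbour is traded for [v]
    itself. *)
Lemma reduces_nbrs adj l fin u : sgraph adj -> reduces adj l fin -> u \in l ->
  exists a b, [/\ a != b, adj u a & adj u b].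
Proof.
move=> + r; elim: r => {adj l fin} // adj v l fin [x [y [nxy H]]] _ IH sg.
have [-> _|nuv] := eqVneq u v.
  by exists x, y; rewrite !H !eqxx orbT; split.
rewrite inE (negPf nuv) /= => ul; have [sy ir] := sg.
have [a [b [nab]]] := IH (sgraph_eliminate v sg) ul.
rewrite /eliminate nuv /= => /andP[nav A] /andP[nbv B].
case uv: (adj v u) A B; last first.
  by rewrite /= !orbF => A B; exists a, b.
have uv' : adj u v by rewrite sy.
case/boolP: (adj u a) => [ua _ _|_ /= /andP[va ua]]; first by exists v, a; rewrite eq_sym.
case/boolP: (adj u b) => [ub _|_ /= /andP[vb ub]]; first by exists v, b; rewrite eq_sym.
move: uv va vb; rewrite !H.
by case/orP=> /eqP E1; case/orP=> /eqP E2; case/orP=> /eqP E3; move: nab ua ub;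
  rewrite E1 E2 E3 ?eqxx.
Qed.

Lemma reduces_uniq adj l fin : sgraph adj -> reduces adj l fin -> uniq l.
Proof.
move=> + r; elim: r => {adj l fin} // adj v l fin _ r IH sg /=.
rewrite IH ?andbT; last exact: sgraph_eliminate.
apply/negP => vl; have [a [b []]] := reduces_nbrs (sgraph_eliminate v sg) r vl.
by rewrite /eliminate eqxx.
Qed.

(** An edge at [u] survives the elimination of [v] or is redirected to the other neighbour of [v].
    So [u] is never isolated before its own elimination, and if it is not eliminated it must be a
    terminal of the final edge. *)
Lemma reduces_mem adj l s t u a : sgraph adj -> reduces adj l (pair_rel s t) ->
  adj u a -> [|| u == s, u == t | u \in l].
Proof.
move=> sg r; move E : (pair_rel s t) r => fin r.
elim: r sg u a E => {adj l fin} [adj fin e|adj v l fin [x [y [nxy H]]] _ IH] sg u a E.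
  rewrite e -E /pair_rel => /orP[] /andP[/eqP -> _]; by rewrite eqxx ?orbT.
move=> ua; rewrite inE; have [//|nuv] := eqVneq u v; first by rewrite !orbT.
have [sy ir] := sg.
have [av|nav] := eqVneq a v; last first.
  by apply: (IH (sgraph_eliminate v sg) u a E); rewrite /eliminate nuv nav ua.
have vu : adj v u by rewrite sy -av.
have [w nwu vw] : exists2 w, w != u & adj v w.
  move: (vu); rewrite H => /orP[] /eqP ->; [exists y|exists x]; rewrite ?H ?eqxx ?orbT //.
  by rewrite eq_sym.
apply: (IH (sgraph_eliminate v sg) u w E).
rewrite /eliminate nuv vu vw (eq_sym u) nwu orbT andbT /=.
by apply: contraTneq vw => ->; rewrite ir.
Qed.

Lemma two_nbrsE adj u v : irreflexive adj -> two_nbrs adj v -> adj v u ->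
  exists w, [/\ w != u, w != v & forall z, adj v z = (z == u) || (z == w)].
Proof.
move=> ir [x [y [nxy H]]]; have := H v; rewrite ir => /esym/norP[nx ny].
rewrite H => /orP[] /eqP ->; [exists y|exists x].
  by split=> //; rewrite eq_sym.
by split=> //; [rewrite eq_sym|move=> z; rewrite H orbC].
Qed.

(** The two surviving neighbours [a], [b] exclude the triangle in which [u] and [v] share their
    other neighbour. Adjacent [u], [v] then lie on a path [w' - u - v - w], and eliminating either
    leaves the other with neighbours [w] and [w']; nonadjacent ones do not affect each other's
    neighbourhood. *)
Lemma two_nbrs_eliminate adj u v a b : sgraph adj -> u != v -> two_nbrs adj u ->
  two_nbrs adj v -> a != b -> eliminate adj v u a -> eliminate adj v u b ->
  two_nbrs (eliminate adj v) u /\ two_nbrs (eliminate adj u) v.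
Proof.
move=> [sy ir] nuv tu tv nab ea eb.
case/boolP: (adj v u) => uv; last first.
  have vu : ~~ adj u v by rewrite sy.
  have [x [y [nxy H]]] := tu; have [x' [y' [nxy' H']]] := tv.
  split; [exists x, y|exists x', y']; split=> // z; rewrite -?H -?H' /eliminate.
    by rewrite nuv (negPf uv) orbF /=; case: eqP => [->|//]; rewrite (negPf vu).
  by rewrite (eq_sym v) nuv (negPf vu) orbF /=; case: eqP => [->|//]; rewrite (negPf uv).
have vu : adj u v by rewrite sy.
have [w [nwu nwv H]] := two_nbrsE ir tv uv.
have [w' [nwv' nwu' H']] := two_nbrsE ir tu vu.
have E z : eliminate adj v u z = (z == w) || (z == w').
  rewrite /eliminate nuv H H' H eqxx /=.
  have [->|] := eqVneq z v; first by rewrite (eq_sym v w) (eq_sym v w') (negPf nwv) (negPf nwv').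
  have [->|nzu] := eqVneq z u; first by rewrite (eq_sym u w) (eq_sym u w') (negPf nwu) (negPf nwu') ?eqxx ?andbF.
  by rewrite /= andbT orbC.
have E' z : eliminate adj u v z = (z == w) || (z == w').
  rewrite /eliminate (eq_sym v u) nuv H H' H' eqxx /=.
  have [->|nzu] := eqVneq z u; first by rewrite (eq_sym u w) (eq_sym u w') (negPf nwu) (negPf nwu').
  have [->|nzv] := eqVneq z v; first by rewrite (eq_sym v w) (eq_sym v w') (negPf nwv) (negPf nwv') ?eqxx ?andbF.
  by rewrite /= andbT.
have nww : w != w'.
  apply: contraNneq nab => ww; move: ea eb; rewrite !E -ww !orbb => /eqP -> /eqP ->.
  by [].
by split; exists w, w'.
Qed.

(* Local confluence: eliminating a vertex of degree two never destroys reducibility. *)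
Lemma reduces_any adj l fin u : sgraph adj -> reduces adj l fin -> u \in l ->
  two_nbrs adj u -> exists2 l', perm_eq l (u :: l') & reduces (eliminate adj u) l' fin.
Proof.
move=> + r; elim: r => {adj l fin} // adj v l fin tv r IH sg.
have [-> _ _|nuv] := eqVneq u v; first by exists l.
rewrite inE (negPf nuv) /= => ul tu.
(* Since [u] is eliminated after [v], it still has two neighbours once [v] is gone; this is what
   rules out the triangle. *)
have [a [b [nab A B]]] := reduces_nbrs (sgraph_eliminate v sg) r ul.
have [tu' tv'] := two_nbrs_eliminate sg nuv tu tv nab A B.
have [l' pl rl] := IH (sgraph_eliminate v sg) ul tu'.
have [sy _] := sg.
exists (v :: l').
  rewrite -[u :: v :: l']/([:: u] ++ [:: v] ++ l') perm_sym perm_catCA /= perm_cons.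
  by rewrite perm_sym.
exact: reduces_cons tv' (eq_reduces (eliminateC v u sy) rl).
Qed.
End Elimination.

(** * Series-parallel graphs are reducible by eliminations *)

Section Embedding.
Variables (V : finType) (T : eqType) (f : V -> T).
Hypothesis f_inj : injective f.

Definition img_rel (adj : rel V) : rel T := fun a b =>
  [exists x, [exists y, [&& f x == a, f y == b & adj x y]]].

Lemma img_relP (adj : rel V) a b :
  reflect (exists x y, [/\ f x = a, f y = b & adj x y]) (img_rel adj a b).
Proof.
apply: (iffP existsP) => [[x /existsP[y /and3P[/eqP <- /eqP <- xy]]]|[x [y [<- <- xy]]]].
  by exists x, y.
by exists x; apply/existsP; exists y; rewrite !eqxx.
Qed.

Lemma img_rel_notin (adj : rel V) a z : (forall x, f x != a) ->
  img_rel adj a z = false /\ img_rel adj z a = false.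
Proof.
move=> na; split; apply/img_relP => -[x [y []]]; first by move=> /eqP; rewrite (negPf (na x)).
by move=> _ /eqP; rewrite (negPf (na y)).
Qed.

(* Eliminations inside a subgraph whose eliminated vertices see nothing else can be
   carried out in the whole graph. *)
Lemma reduces_embed (adj : rel V) l fin (rest : rel T) l2 fin2 :
  reduces adj l fin ->
  (forall v z, v \in l -> rest (f v) z = false) ->
  (forall v z, v \in l -> rest z (f v) = false) ->
  reduces (fun a b => rest a b || img_rel fin a b) l2 fin2 ->
  reduces (fun a b => rest a b || img_rel adj a b) (map f l ++ l2) fin2.
Proof.
move=> r; elim: r => {adj l fin} [adj fin e|adj v l fin tv _ IH] R1 R2 r2 /=.
  apply: eq_reduces r2 => a b; congr (_ || _).
  by apply/img_relP/img_relP => -[x [y [<- <-]]]; rewrite ?e -?e => xy; exists x, y; rewrite ?e -?e.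
have [x [y [nxy H]]] := tv.
have Nv z : rest (f v) z || img_rel adj (f v) z = (z == f x) || (z == f y).
  rewrite R1 ?mem_head //=; apply/img_relP/orP.
    by move=> [x' [y' [/f_inj -> <-]]]; rewrite H => /orP[] /eqP ->; rewrite eqxx; auto.
  by case=> /eqP ->; exists v; [exists x|exists y]; rewrite H eqxx ?orbT.
apply: reduces_cons.
  by exists (f x), (f y); rewrite (inj_eq f_inj).
apply: (@eq_reduces _ (fun a b => rest a b || img_rel (eliminate adj v) a b)); last first.
  apply: IH => // [v' z vl|v' z vl].
    by rewrite R1 // inE vl orbT.
  by rewrite R2 // inE vl orbT.
move=> a b; rewrite /eliminate !Nv.
have [->|nav] /= := eqVneq a (f v).
  rewrite R1 ?mem_head //=; apply/img_relP => -[x' [y' [/f_inj -> _]]].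
  by rewrite eqxx.
have [->|nbv] /= := eqVneq b (f v).
  rewrite R2 ?mem_head //=; apply/img_relP => -[x' [y' [_ /f_inj ->]]].
  by rewrite eqxx andbF.
rewrite -orbA; congr (_ || _).
apply/img_relP/orP.
  move=> [x' [y' [xa yb]]] /and3P[_ _ /orP[xy|/and3P[]]].
    by left; apply/img_relP; exists x', y'.
  rewrite !H => h1 h2 n; right; apply/and3P; split.
  - by move: h1 => /orP[] /eqP E; rewrite -xa E eqxx ?orbT.
  - by move: h2 => /orP[] /eqP E; rewrite -yb E eqxx ?orbT.
  - by rewrite -xa -yb (inj_eq f_inj).
case=> [/img_relP[x' [y' [xa yb xy]]]|/and3P[h1 h2 nab]].
  exists x', y'; rewrite xy; split=> //; rewrite andbT.
  by rewrite -!(inj_eq f_inj) xa yb nav.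
have [x' xa vx] : exists2 x', f x' = a & adj v x'.
  by case/orP: h1 => /eqP ->; [exists x|exists y]; rewrite ?H ?eqxx ?orbT.
have [y' yb vy] : exists2 x', f x' = b & adj v x'.
  by case/orP: h2 => /eqP ->; [exists x|exists y]; rewrite ?H ?eqxx ?orbT.
exists x', y'; split=> //.
by rewrite vx vy -!(inj_eq f_inj) xa yb nav nbv nab orbT.
Qed.

End Embedding.

Definition gadj (G : tgraph) : rel 'I_(nv G) := fun u v =>
  [exists e : 'I_(ne G), joins e u v].

Lemma joinsC (G : tgraph) (e : 'I_(ne G)) u v : joins e u v = joins e v u.
Proof. by rewrite /joins orbC. Qed.

Lemma joins_ends (G : tgraph) (e : 'I_(ne G)) : joins e (ends e).1 (ends e).2.
Proof. by rewrite /joins -surjective_pairing eqxx. Qed.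

Lemma joins_inj (G : tgraph) (e : 'I_(ne G)) a b c d : joins e a b -> joins e c d ->
  (a = c /\ b = d) \/ (a = d /\ b = c).
Proof.
by rewrite /joins => /orP[] /eqP -> /orP[] /eqP [-> ->]; auto.
Qed.

Lemma glues_gadj G1 G2 G same fV fE : @glues G1 G2 G same fV fE ->
  gadj (G := G) =2 (fun a b => img_rel (fun x => fV (inl x)) (gadj (G := G1)) a b ||
                     img_rel (fun y => fV (inr y)) (gadj (G := G2)) a b).
Proof.
move=> [_ [[g fgK gfK] J1 J2]] a b; apply/existsP/orP.
  case=> e; rewrite -(gfK e); case: (g e) => e' J.
    left; apply/img_relP; case: (joins_inj (J1 e') J) => -[<- <-].
      by exists (ends e').1, (ends e').2; split=> //; apply/existsP; exists e'; apply: joins_ends.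
    exists (ends e').2, (ends e').1; split=> //; apply/existsP; exists e'.
    by rewrite joinsC joins_ends.
  right; apply/img_relP; case: (joins_inj (J2 e') J) => -[<- <-].
    by exists (ends e').1, (ends e').2; split=> //; apply/existsP; exists e'; apply: joins_ends.
  exists (ends e').2, (ends e').1; split=> //; apply/existsP; exists e'.
  by rewrite joinsC joins_ends.
case=> /img_relP[x [y [<- <-]]] /existsP[e J].
  exists (fE (inl e)); have := J1 e.
  by case: (joins_inj (joins_ends e) J) => -[<- <-] //; rewrite joinsC.
exists (fE (inr e)); have := J2 e.
by case: (joins_inj (joins_ends e) J) => -[<- <-] //; rewrite joinsC.
Qed.

Lemma img_pair_rel (V : finType) (T : eqType) (f : V -> T) s t :
  img_rel f (pair_rel s t) =2 pair_rel (f s) (f t).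
Proof.
move=> a b; apply/img_relP/orP.
  by move=> [x [y [<- <-]]] /orP[] /andP[/eqP-> /eqP->]; rewrite !eqxx; auto.
by case=> /andP[/eqP-> /eqP->]; [exists s, t|exists t, s]; rewrite /pair_rel !eqxx ?orbT.
Qed.

(** Adjacency as a relation forgets multiplicities, so at a parallel composition the two reduced
    halves coincide and nothing more is to be eliminated. A series composition leaves a path of two
    edges, whose middle vertex is eliminated last. *)
Lemma sp_reduces G : series_parallel G -> src G != snk G /\
  exists2 l, (forall v, (v \in l) = (v != src G) && (v != snk G)) &
    reduces (gadj (G := G)) l (pair_rel (src G) (snk G)).
Proof.
elim=> {G} [G [nv2 ne1 nst J]|G1 G2 G _ [n1 [l1 L1 r1]] _ [n2 [l2 L2 r2]] [fV [fE [gl sE tE]]]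
  |G1 G2 G _ [n1 [l1 L1 r1]] _ [n2 [l2 L2 r2]] [fV [fE [gl sE tE]]]].
- split=> //; exists [::].
    have st v : v \in [:: src G; snk G].
      have /eqP E : [set src G; snk G] == setT.
        by rewrite eqEcard subsetT cards2 nst cardsT card_ord nv2.
      by have := in_setT v; rewrite -E !inE.
    by move=> v; have := st v; rewrite !inE in_nil; case: eqP => //=; case: eqP.
  apply: reduces_nil => a b; apply/existsP/orP => [[e je]|H].
    by case: (joins_inj (J e) je) => -[<- <-]; rewrite !eqxx; auto.
  have lt : 0 < ne G by rewrite ne1.
  by exists (Ordinal lt); move: H => [] /andP[/eqP-> /eqP->]; [|rewrite joinsC]; apply: J.
- have [[sur i1 i2 same] _] := gl.
  pose f1 x := fV (inl x); pose f2 y := fV (inr y).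
  rewrite -/(f1 (src G1)) in sE; rewrite -/(f2 (snk G2)) in tE.
  have e12 x y : (f1 x == f2 y) = (x == snk G1) && (y == src G2).
    by apply/eqP/idP => /same.
  have m12 : f1 (snk G1) = f2 (src G2) by apply/same; rewrite !eqxx.
  split; first by rewrite sE tE e12 (negPf n1).
  exists (map f1 l1 ++ (map f2 l2 ++ [:: f1 (snk G1)])).
    move=> v; have [[x|y] <-] := sur v; rewrite -?/(f1 x) -?/(f2 y) !mem_cat !inE sE tE.
      rewrite mem_map // L1 (negPf (_ : f1 x \notin map f2 l2)); last first.
        apply/mapP => -[y yl /eqP]; rewrite e12 => /andP[_ /eqP E].
        by move: yl; rewrite E L2 eqxx.
      rewrite e12 (eq_sym (snk G2)) (negPf n2) andbF !(inj_eq i1) /= andbT.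
      by case: eqP => [->|] /=; [rewrite (negPf n1)|case: eqP].
    rewrite mem_map // L2 (negPf (_ : f2 y \notin map f1 l1)); last first.
      apply/mapP => -[x xl /eqP]; rewrite eq_sym e12 => /andP[/eqP E _].
      by move: xl; rewrite E L1 eqxx andbF.
    rewrite !(eq_sym (f2 y)) !e12 (negPf n1) eqxx !(eq_sym _ (f2 y)) (inj_eq i2) /=.
    by case: eqP => [->|] /=; [rewrite n2|rewrite orbF].
  (* [reduces_embed] acts on the second disjunct, so the half to be reduced is moved there first. *)
  apply: (@eq_reduces _ (fun a b => img_rel f2 (gadj (G := G2)) a b || img_rel f1 (gadj (G := G1)) a b)).
    by move=> a b; rewrite (glues_gadj gl) orbC.
  have v1 v : v \in l1 -> forall y, f2 y != f1 v.
    by rewrite L1 => /andP[_ nv] y; rewrite eq_sym e12 (negPf nv).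
  have v2 v : v \in l2 -> (f2 v != f1 (src G1)) && (f2 v != f1 (snk G1)).
    by rewrite L2 => /andP[nv _]; rewrite !(eq_sym (f2 v)) !e12 (negPf nv) !andbF.
  apply: (reduces_embed _ r1) => //.
  + by move=> v z vl; case: (img_rel_notin (gadj (G := G2)) z (v1 v vl)).
  + by move=> v z vl; case: (img_rel_notin (gadj (G := G2)) z (v1 v vl)).
  apply: (@eq_reduces _ (fun a b => pair_rel (f1 (src G1)) (f1 (snk G1)) a b || img_rel f2 (gadj (G := G2)) a b)).
    by move=> a b; rewrite img_pair_rel orbC.
  apply: (reduces_embed _ r2) => //.
  + by move=> v z /v2/andP[/negPf h1 /negPf h2]; rewrite /pair_rel h1 h2.
  + by move=> v z /v2/andP[/negPf h1 /negPf h2]; rewrite /pair_rel h1 h2 !andbF.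
  have nst : f1 (src G1) != f2 (snk G2) by rewrite e12 (negPf n1).
  have ns : f1 (src G1) != f2 (src G2) by rewrite e12 (negPf n1).
  have nt : f2 (snk G2) != f2 (src G2) by rewrite (inj_eq i2) eq_sym.
  have ns' : f2 (src G2) != f1 (src G1) by rewrite eq_sym.
  have nt' : f2 (src G2) != f2 (snk G2) by rewrite eq_sym.
  have nst' : f2 (snk G2) != f1 (src G1) by rewrite eq_sym.
  pose ne := (negPf ns, negPf nt, negPf nst, negPf ns', negPf nt', negPf nst').
  have N z : pair_rel (f1 (src G1)) (f2 (src G2)) (f2 (src G2)) z ||
       img_rel f2 (pair_rel (src G2) (snk G2)) (f2 (src G2)) z =
       (z == f1 (src G1)) || (z == f2 (snk G2)).
    by rewrite img_pair_rel /pair_rel eqxx !ne /= orbF.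
  rewrite m12; apply: reduces_cons; first by exists (f1 (src G1)), (f2 (snk G2)).
  apply: reduces_nil => a b; rewrite /eliminate !N img_pair_rel /pair_rel sE tE.
  have [->|na] /= := eqVneq a (f2 (src G2)); first by rewrite !ne.
  have [->|nb] /= := eqVneq b (f2 (src G2)); first by rewrite !ne !andbF.
  rewrite !andbF /=.
  have [->|nas] /= := eqVneq a (f1 (src G1)).
    rewrite ne /= orbF; have [->|nbt] /= := eqVneq b (f2 (snk G2)); first by rewrite nst orbT.
    by rewrite orbF eq_sym; case: eqP.
  have [->|//] /= := eqVneq a (f2 (snk G2)).
  by rewrite (eq_sym (f2 (snk G2))); have [->|nbs] /= := eqVneq b (f1 (src G1)); rewrite ?ne ?andbN.
- have [[sur i1 i2 same] _] := gl.
  pose f1 x := fV (inl x); pose f2 y := fV (inr y).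
  rewrite -/(f1 (src G1)) in sE; rewrite -/(f1 (snk G1)) in tE.
  have e12 x y : (f1 x == f2 y) =
      (x == src G1) && (y == src G2) || (x == snk G1) && (y == snk G2).
    by apply/eqP/idP => /same.
  have ms : f1 (src G1) = f2 (src G2) by apply/same; rewrite !eqxx.
  have mt : f1 (snk G1) = f2 (snk G2) by apply/same; rewrite !eqxx orbT.
  split; first by rewrite sE tE (inj_eq i1).
  exists (map f1 l1 ++ (map f2 l2 ++ [::])).
    move=> v; have [[x|y] <-] := sur v; rewrite -?/(f1 x) -?/(f2 y) !mem_cat in_nil sE tE orbF.
      rewrite mem_map // L1 (negPf (_ : f1 x \notin map f2 l2)) ?orbF ?(inj_eq i1) //.
      apply/mapP => -[y yl /eqP]; rewrite e12 => /orP[] /andP[_ /eqP E];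
      by move: yl; rewrite E L2 eqxx ?andbF.
    rewrite mem_map // L2 (negPf (_ : f2 y \notin map f1 l1)) ?ms ?mt ?(inj_eq i2) //.
    apply/mapP => -[x xl /eqP]; rewrite eq_sym e12 => /orP[] /andP[/eqP E _];
    by move: xl; rewrite E L1 eqxx ?andbF.
  apply: (@eq_reduces _ (fun a b => img_rel f2 (gadj (G := G2)) a b || img_rel f1 (gadj (G := G1)) a b)).
    by move=> a b; rewrite (glues_gadj gl) orbC.
  have v1 v : v \in l1 -> forall y, f2 y != f1 v.
    by rewrite L1 => /andP[/negPf nv /negPf nv'] y; rewrite eq_sym e12 nv nv'.
  have v2 v : v \in l2 -> (f2 v != f1 (src G1)) && (f2 v != f1 (snk G1)).
    by rewrite L2 => /andP[/negPf nv /negPf nv']; rewrite !(eq_sym (f2 v)) !e12 nv nv' !andbF.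
  apply: (reduces_embed _ r1) => //.
  + by move=> v z vl; case: (img_rel_notin (gadj (G := G2)) z (v1 v vl)).
  + by move=> v z vl; case: (img_rel_notin (gadj (G := G2)) z (v1 v vl)).
  apply: (@eq_reduces _ (fun a b => pair_rel (f1 (src G1)) (f1 (snk G1)) a b || img_rel f2 (gadj (G := G2)) a b)).
    by move=> a b; rewrite img_pair_rel orbC.
  apply: (reduces_embed _ r2) => //.
  + by move=> v z /v2/andP[/negPf h1 /negPf h2]; rewrite /pair_rel h1 h2.
  + by move=> v z /v2/andP[/negPf h1 /negPf h2]; rewrite /pair_rel h1 h2 !andbF.
  by apply: reduces_nil => a b; rewrite img_pair_rel sE tE -ms -mt orbb.
Qed.

Lemma sgraph_gadj G : simple_graph G -> sgraph (gadj (G := G)).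
Proof.
move=> [nl _]; split=> [a b|a]; first by apply: eq_existsb => e; rewrite joinsC.
by apply/existsP => -[e]; rewrite (negPf (nl e a)).
Qed.

(** Eliminating [v] loses only the four ordered pairs between [v] and its two neighbours. *)
Lemma reduces_card (V : finType) (adj fin : rel V) l : sgraph adj -> reduces adj l fin ->
  #|[set p : V * V | adj p.1 p.2]| <= 4 * size l + #|[set p : V * V | fin p.1 p.2]|.
Proof.
move=> + r; elim: r => {adj l fin} [adj fin e|adj v l fin [x [y [nxy H]]] _ IH] sg.
  by apply/subset_leq_card/subsetP => p; rewrite !inE e.
have [sy _] := sg.
apply: leq_trans (_ : #|[set (v, x)] :|: [set (v, y)] :|: [set (x, v)] :|: [set (y, v)] :|:
  [set p : V * V | eliminate adj v p.1 p.2]| <= _).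
  apply/subset_leq_card/subsetP => -[a b]; rewrite !inE /= !xpair_eqE /eliminate => ab.
  have [av|nav] /= := eqVneq a v; first by move: ab; rewrite av H => /orP[] ->; rewrite ?orbT.
  have [bv|nbv] /= := eqVneq b v; last by rewrite ab !orbT.
  by move: ab; rewrite bv sy H => /orP[] /eqP ->; rewrite eqxx ?orbT.
apply: leq_trans (leq_card_setU _ _).1 _.
have le4 : #|[set (v, x)] :|: [set (v, y)] :|: [set (x, v)] :|: [set (y, v)]| <= 4.
  by rewrite !cardsU !cards1; lia.
apply: leq_trans (leq_add le4 (IH (sgraph_eliminate v sg))) _; rewrite /=; lia.
Qed.

(** Simplicity makes [ends] injective, so there are at most as many edges as ordered adjacent pairs.
    Four are lost per elimination, a vertex is eliminated at most once, and two pairs remain at the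
    end. *)
Lemma sp_edges G : simple_graph G -> series_parallel G -> ne G <= 4 * nv G + 2.
Proof.
move=> sG /sp_reduces[nst [l lE r]].
have sg := sgraph_gadj sG.
have Ul := reduces_uniq sg r.
have sl : size l <= nv G.
  by rewrite -(card_uniqP Ul) -[X in _ <= X]card_ord max_card.
have := reduces_card sg r.
have -> : [set p : 'I_(nv G) * 'I_(nv G) | pair_rel (src G) (snk G) p.1 p.2] =
   [set (src G, snk G); (snk G, src G)].
  by apply/setP => -[a b]; rewrite !inE /= !xpair_eqE.
have inj : injective (@ends G).
  move=> e f E; have [_ h] := sG; apply: (h e f (ends e).1 (ends e).2); first exact: joins_ends.
  by rewrite E joins_ends.
have : #|[set @ends G e | e in setT]| <= #|[set p : 'I_(nv G) * 'I_(nv G) | gadj p.1 p.2]|.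
  apply/subset_leq_card/subsetP => p /imsetP[e _ ->]; rewrite inE; apply/existsP; exists e.
  exact: joins_ends.
rewrite card_imset // cardsT card_ord cards2.
by move: sl; case: (_ != _) => /=; lia.
Qed.

(** * Decomposition trees and fault tolerance *)

Inductive tree (E : Type) := Leaf of E | Ser of tree E & tree E | Par of tree E & tree E.

Fixpoint leaves E (t : tree E) : seq E :=
  match t with
  | Leaf e => [:: e]
  | Ser a b | Par a b => leaves a ++ leaves b
  end.

Fixpoint leafcount E (t : tree E) : nat :=
  match t with
  | Leaf e => 1
  | Ser a b | Par a b => leafcount a + leafcount b
  end.

Definition is_node E (t : tree E) : bool := if t is Leaf _ then false else true.

Definition is_par E (t : tree E) : bool := if t is Par _ _ then true else false.

Lemma size_leaves E (t : tree E) : size (leaves t) = leafcount t.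
Proof. by elim: t => //= a Ha b Hb; rewrite size_cat Ha Hb. Qed.

Lemma leafcount_gt0 E (t : tree E) : 0 < leafcount t.
Proof. by elim: t => //= a Ha b Hb; rewrite addn_gt0 Ha. Qed.

Section Satisfaction.
Variables (E : finType) (M : {set E}).
Implicit Types (t a b : tree E) (A S F : {set E}).

Fixpoint conn t A : bool :=
  match t with
  | Leaf e => e \in A
  | Ser a b => conn a A && conn b A
  | Par a b => conn a A || conn b A
  end.

Definition lset t : {set E} := [set e in leaves t].

Lemma lset_Ser a b : lset (Ser a b) = lset a :|: lset b.
Proof. by apply/setP => e; rewrite !inE mem_cat. Qed.

Lemma lset_Par a b : lset (Par a b) = lset a :|: lset b.
Proof. by apply/setP => e; rewrite !inE mem_cat. Qed.

Lemma conn_mono t A (B : {set E}) : A :&: lset t \subset B -> conn t A -> conn t B.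
Proof.
elim: t => [e|a Ha b Hb|a Ha b Hb] /= /subsetP sAB.
- by move=> eA; apply: sAB; rewrite !inE eA eqxx.
- case/andP=> /Ha -> /=; last first.
    by apply/subsetP => e; rewrite !inE => /andP[eA el]; apply: sAB; rewrite !inE eA mem_cat el.
  apply: Hb; apply/subsetP => e; rewrite !inE => /andP[eA el]; apply: sAB.
  by rewrite !inE eA mem_cat el orbT.
- case/orP=> [/Ha ->|/Hb ->]; rewrite ?orbT //; apply/subsetP => e; rewrite !inE;
  by move=> /andP[eA el]; apply: sAB; rewrite !inE eA mem_cat el ?orbT.
Qed.

(* [sat t S j]: the edges of S keep t connected under fewer than j faults. *)
Definition sat t S j := forall F, F \subset M -> #|F| < j -> conn t (S :\: F).

Lemma sat_leq t S i j : i <= j -> sat t S j -> sat t S i.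
Proof. by move=> ij H F FM Fi; apply: H => //; apply: leq_trans ij. Qed.

Lemma sat_sub t S S' j : S \subset S' -> sat t S j -> sat t S' j.
Proof.
move=> sS H F FM Fj; apply: conn_mono (H F FM Fj).
by apply: subset_trans (subsetIl _ _) _; apply: setSD.
Qed.

Lemma sat_Ser a b S j : sat (Ser a b) S j <-> sat a S j /\ sat b S j.
Proof.
split=> [H|[Ha Hb] F FM Fj]; last by rewrite /= Ha ?Hb.
by split=> F FM Fj; have /andP[] := H F FM Fj.
Qed.

Lemma sat_ParC a b S j : sat (Par a b) S j -> sat (Par b a) S j.
Proof. by move=> H F FM Fj; rewrite /= orbC; apply: (H F). Qed.

(** A fault set splits over the disjoint leaf sets; fewer than [i + j] faults leave fewer than [i]
    in [a] or fewer than [j] in [b]. *)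
Lemma sat_ParI a b S i j : [disjoint lset a & lset b] -> sat a S i -> sat b S j ->
  sat (Par a b) S (i + j).
Proof.
move=> dis Ha Hb F FM Fij /=.
have FMa : F :&: lset a \subset M by apply: subset_trans FM; apply: subsetIl.
have FMb : F :&: lset b \subset M by apply: subset_trans FM; apply: subsetIl.
have Eab : #|F :&: lset a| + #|F :&: lset b| <= #|F|.
  have /eqP <- : #|(F :&: lset a) :|: (F :&: lset b)| == #|F :&: lset a| + #|F :&: lset b|.
    rewrite (leq_card_setU _ _).2.
    by apply: disjointWl (subsetIr _ _) _; apply: disjointWr (subsetIr _ _) _.
  by rewrite -setIUr subset_leq_card ?subsetIl.
case: (ltnP #|F :&: lset a| i) => [lti|gei].
  apply/orP; left; apply: conn_mono (Ha _ FMa lti); apply/subsetP => e.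
  by rewrite !inE => /andP[/andP[+ ->] el]; rewrite el !andbT.
have ltj : #|F :&: lset b| < j by lia.
apply/orP; right; apply: conn_mono (Hb _ FMb ltj); apply/subsetP => e.
by rewrite !inE => /andP[/andP[+ ->] el]; rewrite el !andbT.
Qed.

Lemma satP t S j :
  reflect (sat t S j) [forall F : {set E}, (F \subset M) ==> (#|F| < j) ==> conn t (S :\: F)].
Proof.
apply: (iffP forallP) => [H F FM Fj|H F]; last by apply/implyP => ?; apply/implyP; apply: H.
by have /implyP/(_ FM)/implyP := H F; apply.
Qed.

(** Take the largest [i <= j] that [a] tolerates. If [i < j], some [F1] of at most [i] faults
    disconnects [a]; with fewer than [j - i] further faults the total stays below [j], so [b] has to
    be connected. *)
Lemma sat_ParE a b S j : sat (Par a b) S j ->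
  exists2 i, i <= j & sat a S i /\ sat b S (j - i).
Proof.
move=> H.
have ex : exists i, (i <= j) && [forall F : {set E}, (F \subset M) ==> (#|F| < i) ==> conn a (S :\: F)].
  by exists 0; apply/satP.
have ub i : (i <= j) && [forall F : {set E}, (F \subset M) ==> (#|F| < i) ==> conn a (S :\: F)] -> i <= j.
  by case/andP.
case: (ex_maxnP ex ub) => i /andP[ij /satP Hi] mx; exists i => //; split=> //.
move=> F FM Fj.
have /forallPn[F1] : ~~ [forall F : {set E}, (F \subset M) ==> (#|F| < i.+1) ==> conn a (S :\: F)].
  by apply/negP => H1; have := mx i.+1; rewrite H1 ltnn andbT => /(_ ltac:(lia)).
rewrite !negb_imply => /and3P[F1M F1i nc].
have := H (F1 :|: F); rewrite subUset F1M FM => /(_ isT).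
have le : #|F1 :|: F| < j.
  by apply: leq_ltn_trans (leq_card_setU _ _).1 _; lia.
move=> /(_ le) /= /orP[ca|cb].
  case/negP: nc; apply: conn_mono ca; apply: subset_trans (subsetIl _ _) _.
  by apply: setDS; apply: subsetUl.
apply: conn_mono cb; apply: subset_trans (subsetIl _ _) _.
by apply: setDS; apply: subsetUr.
Qed.

Lemma card_lset t : #|lset t| <= leafcount t.
Proof. by rewrite -size_leaves cardsE card_size. Qed.

(** Only faults on leaves of [t] matter, and there are at most [leafcount t] of them. *)
Lemma sat_saturated t S i j : leafcount t < i -> sat t S i -> sat t S j.
Proof.
move=> li H F FM _.
have FMt : F :&: lset t \subset M by apply: subset_trans FM; apply: subsetIl.
apply: conn_mono (H _ FMt _).
  by apply/subsetP => e; rewrite !inE => /andP[/andP[+ ->] el]; rewrite el !andbT.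
by apply: leq_ltn_trans li; apply: leq_trans (card_lset t); rewrite subset_leq_card ?subsetIr.
Qed.

End Satisfaction.

(** * The dynamic program on trees *)

(** [cbad] is a number, zero meaning feasible, so that infeasibility of two children combines by
    addition. [cda] and [cdb] are the demands passed to the children, kept for the
    reconstruction. *)
Record cell (R : Type) := Cell { cbad : nat; cval : R; cda : nat; cdb : nat }.

Section DynamicProgram.
Variables (R : realDomainType) (E : finType) (w : E -> R) (M : {set E}) (K : nat).
Implicit Types (t a b : tree E) (A S F : {set E}).

(* From demand [2 * leafcount t >= leafcount t + 1] on, all demands are equivalent. *)
Definition cap t := minn K (2 * leafcount t).

Definition conv_step (cq : nat) (fp fq : nat -> cell R) (j : nat) (c : cell R) (x : nat) :=
  let y := minn (j - x) cq in
  let v := (cval (fp x) + cval (fq y))%R in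
  if (cbad (fp x) + cbad (fq y) == 0) && ~~ ((cbad c == 0) && (cval c <= v)%R)
  then Cell 0 v x y else c.

(** The starting candidate saturates the first child and asks nothing of the second; it covers all
    splits with a first share of at least [cp], and the loop covers the smaller shares. Hence there
    are at most [cp] rounds. *)
Definition conv (cp cq : nat) (fp fq : nat -> cell R) (j : nat) : cell R :=
  foldl (conv_step cq fp fq j) (Cell (cbad (fp cp)) (cval (fp cp)) cp 0)
    (iota 0 (minn cp j.+1)).

(** At a parallel node the child with the smaller table comes first, as [conv] loops over the first
    child. *)
Definition kids t : tree E * tree E :=
  match t with
  | Leaf _ => (t, t)
  | Ser a b => (a, b)
  | Par a b => if cap a <= cap b then (a, b) else (b, a)
  end.

Definition cell0 : cell R := Cell 0 0%R 0 0.

(** Demand 0 is met by the empty set. Demand 1 allows no fault, so even a vulnerable leaf meets it;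
    a higher demand requires an edge outside [M]. *)
Fixpoint dp t (j : nat) : cell R :=
  if j == 0 then cell0 else
  match t with
  | Leaf e => Cell (if j == 1 then 0 else e \in M) (w e) 0 0
  | Ser a b =>
      let x := minn j (cap a) in let y := minn j (cap b) in
      Cell (cbad (dp a x) + cbad (dp b y)) (cval (dp a x) + cval (dp b y))%R x y
  | Par a b =>
      if cap a <= cap b then conv (cap a) (cap b) (dp a) (dp b) j
      else conv (cap b) (cap a) (dp b) (dp a) j
  end.

Fixpoint solset t (j : nat) : {set E} :=
  match t with
  | Leaf e => if j == 0 then set0 else [set e]
  | Ser a b => solset a (cda (dp t j)) :|: solset b (cdb (dp t j))
  | Par a b =>
      if cap a <= cap b then solset a (cda (dp t j)) :|: solset b (cdb (dp t j))
      else solset b (cda (dp t j)) :|: solset a (cdb (dp t j))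
  end.

Lemma dp0 t : dp t 0 = cell0.
Proof. by case: t. Qed.

Lemma solset0 t : solset t 0 = set0.
Proof. by elim: t => //= a Ha b Hb; rewrite Ha Hb setU0 ?if_same. Qed.

Definition wt A : R := (\sum_(e in A) w e)%R.

(** [S] ranges over edge sets of the whole graph and is charged only for its leaves in [t], so the
    bounds of two disjoint children add up against one and the same [S]. *)
Definition isopt t (j : nat) (bad : nat) (v : R) A :=
  if bad == 0 then
    [/\ A \subset lset t, sat M t A j, v = wt A &
        forall S, sat M t S j -> (v <= wt (S :&: lset t))%R]
  else forall S, ~ sat M t S j.

Hypothesis w_ge0 : forall e, (0 <= w e)%R.
Hypothesis K_gt0 : 0 < K.

Lemma wt_ge0 A : (0 <= wt A)%R.
Proof. exact: sumr_ge0. Qed.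

Lemma wt_sub A S : A \subset S -> (wt A <= wt S)%R.
Proof.
move=> AS; rewrite /wt [X in (_ <= X)%R](big_setID A) /= (setIidPr AS).
by rewrite lerDl; apply: sumr_ge0.
Qed.

Lemma wtU A S : [disjoint A & S] -> wt (A :|: S) = (wt A + wt S)%R.
Proof. by move=> d; rewrite /wt -bigU //=; apply: eq_bigl => e; rewrite !inE. Qed.

Lemma cap_gt0 t : 0 < cap t.
Proof. by rewrite /cap; have := leafcount_gt0 t; lia. Qed.

Lemma sat_cap t S j : j <= K -> sat M t S (cap t) -> sat M t S j.
Proof.
move=> jK; rewrite /cap; case: (leqP K (2 * leafcount t)) => h.
  by apply: sat_leq.
by apply: sat_saturated; have := leafcount_gt0 t; lia.
Qed.

Lemma sat_minn t S j : j <= K -> sat M t S (minn j (cap t)) <-> sat M t S j.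
Proof.
move=> jK; split; last by apply: sat_leq; apply: geq_minl.
by case: leqP => // _; apply: sat_cap.
Qed.

Lemma isopt_iff t i j bad v A : (forall S, sat M t S i <-> sat M t S j) ->
  isopt t i bad v A -> isopt t j bad v A.
Proof.
move=> e; rewrite /isopt; case: eqP => [_ [h1 h2 h3 h4]|_ h S /e]; last exact: h.
by split=> //; [apply/e|move=> S /e; apply: h4].
Qed.

Lemma isopt_ParC a b j bad v A : isopt (Par a b) j bad v A -> isopt (Par b a) j bad v A.
Proof.
have L : lset (Par b a) = lset (Par a b) by rewrite !lset_Par setUC.
rewrite /isopt L; case: eqP => [_ [h1 h2 h3 h4]|_ h S /sat_ParC]; last exact: h.
by split=> //; [apply: sat_ParC|move=> S /sat_ParC; apply: h4].
Qed.

Lemma isopt0 t : isopt t 0 0 0%R set0.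
Proof.
split=> //; first exact: sub0set.
  by rewrite /wt big_set0.
by move=> S _; apply: wt_ge0.
Qed.

Lemma isopt_Leaf e j : 0 < j -> isopt (Leaf e) j (if j == 1 then 0 else e \in M) (w e) [set e].
Proof.
move=> j0.
have lb S : sat M (Leaf e) S j -> (w e <= wt (S :&: lset (Leaf e)))%R.
  move=> /(_ set0 (sub0set _)); rewrite cards0 setD0 => /(_ j0) /= eS.
  rewrite /wt (_ : _ :&: _ = [set e]) ?big_set1 //.
  by apply/setP => f; rewrite !inE; case: eqP => [->|]; rewrite ?eS ?andbF.
have we : w e = wt [set e] by rewrite /wt big_set1.
have sub : [set e] \subset lset (Leaf e) by rewrite sub1set !inE.
have ok : (j == 1) || (e \notin M) -> isopt (Leaf e) j 0 (w e) [set e].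
  move=> h; split=> // F FM Fj; rewrite /= !inE eqxx andbT.
  case/orP: h => [/eqP j1|eM]; last by apply: contraNN eM => /(subsetP FM).
  by move: Fj; rewrite j1 ltnS leqn0 cards_eq0 => /eqP ->; rewrite inE.
case: eqP => [j1|j1] /=; first by apply: ok; rewrite j1.
case eM: (e \in M) => /=; last by apply: ok; rewrite eM orbT.
move=> S /(_ [set e]); rewrite sub1set eM cards1 => /(_ isT ltac:(lia)) /=.
by rewrite !inE eqxx.
Qed.

Lemma wtI_U S (A B : {set E}) : [disjoint A & B] ->
  wt (S :&: (A :|: B)) = (wt (S :&: A) + wt (S :&: B))%R.
Proof.
move=> d; rewrite setIUr wtU //.
by apply: disjointWl (subsetIr _ _) _; apply: disjointWr (subsetIr _ _) _.
Qed.

Lemma isopt_Ser a b j z1 z2 v1 v2 A1 A2 : [disjoint lset a & lset b] ->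
  isopt a j z1 v1 A1 -> isopt b j z2 v2 A2 ->
  isopt (Ser a b) j (z1 + z2) (v1 + v2)%R (A1 :|: A2).
Proof.
move=> d; rewrite /isopt addn_eq0.
case: (z1 == 0) => [[h1 h2 h3 h4]|h1 _ S /sat_Ser[]]; last by move/h1.
case: (z2 == 0) => [[k1 k2 k3 k4]|k1 S /sat_Ser[_]]; last by move/k1.
split.
- by rewrite lset_Ser setUSS.
- by apply/sat_Ser; split; [apply: sat_sub h2; apply: subsetUl|apply: sat_sub k2; apply: subsetUr].
- by rewrite h3 k3 wtU //; apply: disjointWl h1 _; apply: disjointWr k1 _.
- by move=> S /sat_Ser[s1 s2]; rewrite lset_Ser wtI_U // lerD ?h4 ?k4.
Qed.

(** * Optimality of the (min, +) convolution at a parallel node *)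

Section Convolution.
Variables (p q : tree E) (fp fq : nat -> cell R) (gp gq : nat -> {set E}) (j : nat).
Hypothesis dpq : [disjoint lset p & lset q].
Hypothesis optp : forall i, i <= cap p -> isopt p i (cbad (fp i)) (cval (fp i)) (gp i).
Hypothesis optq : forall i, i <= cap q -> isopt q i (cbad (fq i)) (cval (fq i)) (gq i).
Hypothesis jK : j <= K.
Hypothesis fq0 : fq 0 = cell0.

Let cand_sound (x y : nat) := forall S1 S2, sat M p S1 x -> sat M q S2 y ->
  sat M (Par p q) (S1 :|: S2) j.

(** Loop invariant: a feasible [c] is sound for demand [j] and optimal among the splits listed in
    [l]; an infeasible one certifies that no set meets any listed split. *)
Definition conv_inv (l : seq (nat * nat)) (c : cell R) :=
  (cda c <= cap p) && (cdb c <= cap q) /\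
  if cbad c == 0 then
   [/\ sat M (Par p q) (gp (cda c) :|: gq (cdb c)) j,
       gp (cda c) :|: gq (cdb c) \subset lset (Par p q),
       cval c = wt (gp (cda c) :|: gq (cdb c)) &
       forall x y S, (x, y) \in l -> sat M p S x -> sat M q S y ->
         (cval c <= wt (S :&: lset (Par p q)))%R]
  else forall x y S, (x, y) \in l -> sat M p S x -> sat M q S y -> False.

Lemma conv_cand x y : x <= cap p -> y <= cap q -> cand_sound x y ->
  conv_inv [:: (x, y)]
    (Cell (cbad (fp x) + cbad (fq y)) (cval (fp x) + cval (fq y))%R x y).
Proof.
move=> xp yq snd; split=> /=; first by rewrite xp.
move: (optp xp) (optq yq); rewrite /isopt addn_eq0.
case: (_ == 0) => [[h1 h2 h3 h4]|h1 _ x' y' S] /=; last first.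
  by rewrite inE => /eqP[-> ->] /h1.
case: (_ == 0) => [[k1 k2 k3 k4]|k1 x' y' S] /=; last first.
  by rewrite inE => /eqP[-> ->] _ /k1.
split.
- exact: snd.
- by rewrite lset_Par setUSS.
- by rewrite h3 k3 wtU //; apply: disjointWl h1 _; apply: disjointWr k1 _.
- move=> x' y' S; rewrite inE => /eqP[-> ->] s1 s2.
  by rewrite lset_Par wtI_U // lerD ?h4 ?k4.
Qed.

Lemma conv_inv_step l c x : conv_inv l c -> x < minn (cap p) j.+1 ->
  conv_inv (rcons l (x, minn (j - x) (cap q))) (conv_step (cap q) fp fq j c x).
Proof.
move=> Ic xlt; set y := minn _ _.
(* By saturation, meeting the truncated demand [y] amounts to meeting [j - x]. *)
have snd : cand_sound x y.
  move=> S1 S2 s1 s2; rewrite (_ : j = x + (j - x)); last by lia.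
  apply: sat_ParI => //; first by apply: sat_sub s1; apply: subsetUl.
  apply: sat_sub (subsetUr _ _) _.
  by apply: (iffLR (sat_minn q S2 (leq_trans (leq_subr x j) jK))).
have := conv_cand (_ : x <= cap p) (_ : y <= cap q) snd.
move=> /(_ ltac:(lia) (geq_minr _ _)).
case: Ic => cc Ic [/= xy Jc]; rewrite /conv_step -/y.
move: Jc; case: (_ + _ == 0) => /= Jc; last first.
  split=> //; move: Ic; case: (cbad c == 0).
    move=> [h1 h2 h3 h4]; split=> // x' y' S; rewrite mem_rcons inE => /orP[/eqP xye|]; last exact: h4.
    by move=> s1 s2; case: (Jc x' y' S) => //; rewrite inE xye.
  by move=> h x' y' S; rewrite mem_rcons inE => /orP[xye|]; [apply: Jc; rewrite inE|apply: h].
case: Jc => k1 k2 k3 k4.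
move: Ic; case: (cbad c == 0) / eqP => [c0|c0].
  move=> [h1 h2 h3 h4]; case: leP => [le|lt] /=; split=> //=; rewrite ?c0 //=.
    split=> // x' y' S; rewrite mem_rcons inE => /orP[/eqP xye|]; last exact: h4.
    by move=> s1 s2; apply: le_trans le _; apply: (k4 x' y') => //; rewrite inE xye.
  split=> // x' y' S; rewrite mem_rcons inE => /orP[xye|xl].
    by apply: k4; rewrite inE.
  by move=> s1 s2; apply: le_trans (ltW lt) _; apply: h4 s1 s2.
move=> h; split=> //=; split=> // x' y' S; rewrite mem_rcons inE => /orP[xye|xl].
  by apply: k4; rewrite inE.
by move=> s1 s2; case: (h x' y' S).
Qed.

Lemma conv_opt : let c := conv (cap p) (cap q) fp fq j in
  [/\ cda c <= cap p, cdb c <= cap q &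
      isopt (Par p q) j (cbad c) (cval c) (gp (cda c) :|: gq (cdb c))].
Proof.
have snd : cand_sound (cap p) 0.
  move=> S1 S2 s1 _; rewrite -[j]addn0; apply: sat_ParI => //.
  by apply: sat_sub (subsetUl _ _) _; apply: sat_cap.
have I0 := conv_cand (leqnn _) (leq0n _) snd.
(* Since [fq 0] is the zero cell, the candidate [(cap p, 0)] is the initial cell of [conv]. *)
rewrite fq0 /= addn0 addr0 in I0.
have I n : n <= minn (cap p) j.+1 -> conv_inv ((cap p, 0) :: [seq (x, minn (j - x) (cap q)) | x <- iota 0 n])
    (foldl (conv_step (cap q) fp fq j) (Cell (cbad (fp (cap p))) (cval (fp (cap p))) (cap p) 0) (iota 0 n)).
  elim: n => [|n IH] le //.
  rewrite -addn1 iotaD add0n map_cat foldl_cat /= -cat_cons cats1.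
  by apply: conv_inv_step => //; apply: IH; apply: ltnW.
have {I} := I _ (leqnn _); rewrite -/(conv (cap p) (cap q) fp fq j).
set c := conv _ _ _ _ _ => -[/andP[h1 h2] h] /=; split=> //.
(* Every solution meets some listed split: a share [i < cap p] occurs in the loop, and a larger one
   is weakened to [(cap p, 0)]. *)
have cov S : sat M (Par p q) S j -> exists x y,
   [/\ (x, y) \in (cap p, 0) :: [seq (x, minn (j - x) (cap q)) | x <- iota 0 (minn (cap p) j.+1)],
     sat M p S x & sat M q S y].
  move=> /sat_ParE[i ij [s1 s2]]; case: (ltnP i (cap p)) => ip.
    exists i, (minn (j - i) (cap q)); split=> //.
      rewrite inE; apply/orP; right; apply/mapP; exists i => //.
      by rewrite mem_iota; lia.
    by apply: sat_leq s2; apply: geq_minl.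
  by exists (cap p), 0; rewrite mem_head; split=> //; apply: sat_leq s1.
rewrite /isopt; move: h; case: (_ == 0) => [[g1 g2 g3 g4]|g S /cov[x [y [xy s1 s2]]]].
  by split=> // S /cov[x [y [xy s1 s2]]]; apply: g4 xy s1 s2.
exact: g xy s1 s2.
Qed.
End Convolution.

Lemma dp_opt t j : uniq (leaves t) -> j <= K ->
  isopt t j (cbad (dp t j)) (cval (dp t j)) (solset t j).
Proof.
elim: t j => [e|a Ha b Hb|a Ha b Hb] j Ut jK; (have [->|j0] := posnP j;
  first by rewrite dp0 solset0; apply: isopt0).
- by have := isopt_Leaf e j0; rewrite /= (gtn_eqF j0).
- move: Ut; rewrite /= cat_uniq => /and3P[Ua /hasPn nh Ub].
  have d : [disjoint lset a & lset b].
    by rewrite disjoint_sym disjoint_subset; apply/subsetP => e; rewrite !inE => /nh.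
  rewrite (gtn_eqF j0) /=; apply: isopt_Ser => //.
    by apply: isopt_iff (Ha (minn j (cap a)) Ua _) => [S|]; [apply: sat_minn|lia].
  by apply: isopt_iff (Hb (minn j (cap b)) Ub _) => [S|]; [apply: sat_minn|lia].
- move: Ut; rewrite /= cat_uniq => /and3P[Ua /hasPn nh Ub].
  have d : [disjoint lset a & lset b].
    by rewrite disjoint_sym disjoint_subset; apply/subsetP => e; rewrite !inE => /nh.
  have d' : [disjoint lset b & lset a] by rewrite disjoint_sym.
  have ca : forall i, i <= cap a -> isopt a i (cbad (dp a i)) (cval (dp a i)) (solset a i).
    by move=> i ia; apply: Ha => //; apply: leq_trans ia (geq_minl _ _).
  have cb : forall i, i <= cap b -> isopt b i (cbad (dp b i)) (cval (dp b i)) (solset b i).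
    by move=> i ia; apply: Hb => //; apply: leq_trans ia (geq_minl _ _).
  rewrite (gtn_eqF j0) /=; case: leqP => _.
    by case: (conv_opt d ca cb jK (dp0 b)).
  by apply: isopt_ParC; case: (conv_opt d' cb ca jK (dp0 a)).
Qed.

Lemma conv_bounds cp cq fp fq j :
  (cda (conv cp cq fp fq j) <= cp) && (cdb (conv cp cq fp fq j) <= cq).
Proof.
rewrite /conv; set c := Cell _ _ _ _.
have : (cda c <= cp) && (cdb c <= cq) by rewrite leqnn.
have : all (fun x => x <= cp) (iota 0 (minn cp j.+1)).
  by apply/allP => x; rewrite mem_iota; lia.
elim: (iota _ _) c => //= x l IH c /andP[xc /IH h] cc; apply: h; rewrite /conv_step.
by case: ifP => //= _; rewrite xc geq_minr.
Qed.

Lemma dp_bounds t j :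
  (cda (dp t j) <= cap (kids t).1) && (cdb (dp t j) <= cap (kids t).2).
Proof.
case: t => [e|a b|a b] /=; case: ifP => //= _.
  by rewrite !geq_minr.
by case: (cap a <= cap b); apply: conv_bounds.
Qed.

Lemma solset_kids t j : is_node t ->
  solset t j = solset (kids t).1 (cda (dp t j)) :|: solset (kids t).2 (cdb (dp t j)).
Proof. by case: t => //= a b _; case: (cap a <= cap b). Qed.

(* Potential of the tree-knapsack amortization: summed over a tree, the products of
   the capped sizes of siblings telescope against [phi]. *)
Definition phi (x : nat) := if x <= K then x * x else 2 * x * K - K * K.

(** The quadratic and the linear branch of [phi] meet at [K]. While [x + y <= K], the surplus comes
    from the mixed term [2 * x * y]; when both arguments are at least [K], equality holds. *)
Lemma phi_add x y : phi x + phi y + minn K x * minn K y <= phi (x + y).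
Proof. by rewrite /phi; case: (leqP x K); case: (leqP y K); case: (leqP (x + y) K); nia. Qed.

Lemma phi_le x : phi x <= 2 * x * K.
Proof. by rewrite /phi; case: (leqP x K); nia. Qed.

(** Up to a constant factor, a bound on the time spent on a node: [cap t] entries, each with a pass
    over the smaller child. A series node is charged the same although its entries take constant
    time. *)
Definition nodew t :=
  match t with
  | Leaf _ => 0
  | Ser a b | Par a b => cap t * (minn (cap a) (cap b)).+1
  end.

(** Let [A], [B] be the caps of the children, both at least 1, with minimum [l] and maximum [h].
    Then [cap t * (l + 1) <= (A + B) * (l + 1) <= 2 h * 2 l = 4 A B], whence the factor 4; the
    product [A B] is the surplus in [phi_add]. *)
Lemma nodew_phi a b t : (t = Ser a b) \/ (t = Par a b) ->
  nodew t + 4 * phi (2 * leafcount a) + 4 * phi (2 * leafcount b) <= 4 * phi (2 * leafcount t).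
Proof.
move=> tE; have -> : nodew t = cap t * (minn (cap a) (cap b)).+1 by case: tE => ->.
have lt : leafcount t = leafcount a + leafcount b by case: tE => ->.
have ct : cap t <= cap a + cap b by rewrite /cap lt; lia.
have := phi_add (2 * leafcount a) (2 * leafcount b); rewrite -mulnDr -lt.
rewrite -/(cap a) -/(cap b).
have := cap_gt0 a; have := cap_gt0 b; move: ct.
move: (cap a) (cap b) (cap t) (phi _) (phi _) (phi _) => A B C f g h.
by case: (leqP A B); nia.
Qed.

End DynamicProgram.

(** * Networks *)

(* Connectivity in cut form: no r-closed set separates s from t. *)
Definition cconn (r : rel nat) (s t : nat) :=
  forall P : pred nat, P s -> (forall u v, r u v -> P u -> P v) -> P t.

Definition mkp (u v : nat) : nat * nat := (minn u v, maxn u v).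

Lemma mkpC u v : mkp u v = mkp v u.
Proof. by rewrite /mkp minnC maxnC. Qed.

Lemma eq_mkp u v x y : (mkp u v == mkp x y) = (u == x) && (v == y) || (u == y) && (v == x).
Proof. by rewrite /mkp xpair_eqE; apply/idP/idP; lia. Qed.

(* An edge [((u, v), i)] of a network joins u < v and carries the tree of node i. *)
Notation network := (seq (nat * nat * nat)).

Section Network.
Implicit Types (H : network) (h : nat * nat * nat).

Definition hadj H : rel nat := fun u v => mkp u v \in unzip1 H.

Definition contrib (g : nat -> nat) (u : nat) (p : nat * nat) : nat :=
  if p.1 == u then g p.2 else if p.2 == u then g p.1 else 0.

(** For [g] constant 1, the identity and the square, this is the degree, the sum and the sum of
    squares of the neighbours, counted with multiplicity. *)
Definition gsum g u H : nat := \sum_(h <- H) contrib g u h.1.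

Lemma contrib_mkp g u a b : a != b ->
  contrib g u (mkp a b) = if u == a then g b else if u == b then g a else 0.
Proof.
move=> nab; rewrite /contrib /mkp /=.
by case: (ltngtP a b) nab => // lt _; rewrite ?(eq_sym u) //;
  case: eqP => [<-|//]; case: eqP => // E; move: lt; rewrite E ltnn.
Qed.

Lemma perm_hadj H H' : perm_eq H H' -> hadj H =2 hadj H'.
Proof. by move=> pH u v; apply: perm_mem; apply: perm_map. Qed.

Lemma perm_gsum g u H H' : perm_eq H H' -> gsum g u H = gsum g u H'.
Proof. by move=> pH; apply: perm_big. Qed.

Lemma hadj_sgraph H : all (fun h => h.1.1 < h.1.2) H -> sgraph (hadj H).
Proof.
move=> /allP lt; split=> [u v|u]; first by rewrite /hadj mkpC.
by apply/mapP => -[h /lt hl E]; move: hl; rewrite -E /mkp minnn maxnn ltnn.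
Qed.

Lemma contrib1_gt0 v h : h.1.1 < h.1.2 -> contrib (fun=> 1) v h.1 != 0 ->
  exists2 x, h.1 = mkp v x & v != x.
Proof.
case: h => [[a b] i] /= lt; rewrite /contrib /=.
case: (a =P v) => [E|_]; first by exists b; rewrite -?E /mkp; [congr pair; lia|lia].
by case: (b =P v) => [E|//]; exists a; rewrite -?E; rewrite /mkp; [congr pair; lia|lia].
Qed.

Lemma contrib_le1 v p : contrib (fun=> 1) v p <= 1.
Proof. by rewrite /contrib; case: ifP => // _; case: ifP. Qed.

Lemma gsum_pop H v n : all (fun h => h.1.1 < h.1.2) H -> gsum (fun=> 1) v H = n.+1 ->
  exists x a H', [/\ perm_eq H ((mkp v x, a) :: H'), v != x & gsum (fun=> 1) v H' = n].
Proof.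
move=> al gE.
have /hasP[h hH hc] : has (fun h => contrib (fun=> 1) v h.1 != 0) H.
  apply: contraT => /hasPn nh; move: gE; rewrite /gsum big_seq big1 // => h hH.
  by move/nh: hH; rewrite negbK => /eqP.
have [x hx nvx] := contrib1_gt0 (allP al _ hH) hc.
have pH := perm_to_rem hH.
exists x, h.2, (rem h H); split=> //; first by rewrite -hx -surjective_pairing.
move: gE; rewrite (perm_gsum _ _ pH) /gsum big_cons.
by case: (contrib _ _ _) (contrib_le1 v h.1) hc => [|[|]] //= _ _ [].
Qed.

Lemma gsum0_notin H v : gsum (fun=> 1) v H = 0 -> forall z, mkp v z \notin unzip1 H.
Proof.
move=> g0 z; apply/mapP => -[h hH E]; move: g0; rewrite (perm_gsum _ _ (perm_to_rem hH)).
rewrite /gsum big_cons -E /contrib /mkp /=; case: ifP => //; case: ifP => //.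
by case: (leqP v z); rewrite ?eqxx.
Qed.

Lemma gsum_two H v : all (fun h => h.1.1 < h.1.2) H -> gsum (fun=> 1) v H = 2 ->
  uniq (unzip1 H) ->
  exists x y a b H', [/\ perm_eq H [:: (mkp v x, a), (mkp v y, b) & H'],
    [/\ v != x, v != y & x != y] & gsum (fun=> 1) v H' = 0].
Proof.
move=> al g2 U.
have [x [a [H1 [p1 nvx g1]]]] := gsum_pop al g2.
have al1 : all (fun h => h.1.1 < h.1.2) H1.
  by move: al; rewrite (perm_all _ p1) => /andP[].
have [y [b [H2 [p2 nvy g0]]]] := gsum_pop al1 g1.
have p12 : perm_eq H [:: (mkp v x, a), (mkp v y, b) & H2].
  by apply: perm_trans p1 _; rewrite perm_cons.
exists x, y, a, b, H2; split=> //.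
split=> //; move: U; rewrite (perm_uniq (perm_map fst p12)) /= inE negb_or.
by case/andP => /andP[ne _] _; apply: contraNneq ne => ->.
Qed.

Lemma hadj_two H H' v x y a b : perm_eq H [:: (mkp v x, a), (mkp v y, b) & H'] ->
  (forall z, mkp v z \notin unzip1 H') -> v != x -> v != y ->
  forall z, hadj H v z = (z == x) || (z == y).
Proof.
move=> pH nv nvx nvy z; rewrite (perm_hadj pH) /hadj /= !inE (negPf (nv z)) !eq_mkp eqxx.
by rewrite (negPf nvx) (negPf nvy) /= !orbF.
Qed.

(** [H'] may already contain an edge [mkp x y]: a duplicate key does not change the relation, so the
    statement covers the moment before the two edges are merged. *)
Lemma hadj_eliminate H H' v x y a b c : perm_eq H [:: (mkp v x, a), (mkp v y, b) & H'] ->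
  (forall z, mkp v z \notin unzip1 H') -> v != x -> v != y -> x != y ->
  hadj ((mkp x y, c) :: H') =2 eliminate (hadj H) v.
Proof.
move=> pH nv nvx nvy nxy a' b'.
rewrite /eliminate !(hadj_two pH) // (perm_hadj pH) /hadj /= !inE !eq_mkp.
have [->|nav] /= := eqVneq a' v; first by rewrite (negPf (nv _)) (negPf nvx) (negPf nvy).
have [->|nbv] /= := eqVneq b' v.
  by rewrite mkpC (negPf (nv _)) (negPf nvx) (negPf nvy) !andbF.
rewrite !andbF /= orbC; congr (_ || _).
clear -nav nbv nxy; lia.
Qed.

(** Node numbers start at 1, so the default 0 stands for a missing edge, in agreement with untouched
    memory. *)
Fixpoint lk H (p : nat * nat) : nat :=
  if H is h :: H' then if h.1 == p then h.2 else lk H' p else 0.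

Lemma lk_notin H p : p \notin unzip1 H -> lk H p = 0.
Proof. by elim: H => //= h H IH; rewrite inE negb_or eq_sym => /andP[/negPf -> /IH]. Qed.

Lemma lk_in H h : uniq (unzip1 H) -> h \in H -> lk H h.1 = h.2.
Proof.
elim: H => //= h' H IH /andP[nh U]; rewrite inE => /orP[/eqP ->|hH]; first by rewrite eqxx.
rewrite IH //; case: eqP => // E; case/negP: nh; rewrite E; exact: map_f.
Qed.

Lemma perm_lk H H' : uniq (unzip1 H) -> perm_eq H H' -> lk H =1 lk H'.
Proof.
move=> U pH p; have U' : uniq (unzip1 H') by rewrite -(perm_uniq (perm_map fst pH)).
case/boolP: (p \in unzip1 H) => [/mapP[h hH ->]|np].
  by rewrite !lk_in // -(perm_mem pH).
by rewrite !lk_notin // -(perm_mem (perm_map fst pH)).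
Qed.

Lemma lk_gt0 H p : all (fun h => 0 < h.2) H -> (0 < lk H p) = (p \in unzip1 H).
Proof.
elim: H => //= h H IH /andP[h0 /IH E]; rewrite inE eq_sym.
by case: eqP.
Qed.

Section Connectivity.
Variables (E : finType) (A : {set E}).
Implicit Type tr : nat -> tree E.

Definition hrel tr H : rel nat := fun u v =>
  has (fun h => (h.1 == mkp u v) && conn (tr h.2) A) H.

Lemma eq_cconn r r' s t : r =2 r' -> cconn r s t -> cconn r' s t.
Proof. by move=> e C P Ps cl; apply: C => // u v; rewrite e; apply: cl. Qed.

Lemma hrel_cons tr h H u v :
  hrel tr (h :: H) u v = (h.1 == mkp u v) && conn (tr h.2) A || hrel tr H u v.
Proof. by []. Qed.

Lemma perm_hrel tr H H' : perm_eq H H' -> hrel tr H =2 hrel tr H'.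
Proof. by move=> pH u v; apply: perm_has. Qed.

Lemma hrelC tr H u v : hrel tr H u v = hrel tr H v u.
Proof. by rewrite /hrel mkpC. Qed.

(** A closed set [P] of the reduced network extends to [v]: put [v] in when [a] or [b] links it to a
    member of [P]. If both trees connect, the new edge forces [P x = P y], so the extension is
    closed. Conversely, a set closed in the larger network is closed in the reduced one. *)
Lemma hrel_series tr tr' H' v x y a b c s t :
  (forall z, mkp v z \notin unzip1 H') -> v != x -> v != y -> x != y ->
  {in H', forall h, tr' h.2 = tr h.2} -> tr' c = Ser (tr a) (tr b) ->
  v != s -> v != t ->
  cconn (hrel tr [:: (mkp v x, a), (mkp v y, b) & H']) s t <->
  cconn (hrel tr' ((mkp x y, c) :: H')) s t.
Proof.
move=> nv nvx nvy nxy trE cE nvs nvt.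
have hE : hrel tr' H' =2 hrel tr H'.
  by move=> u z; apply: eq_in_has => h /trE ->.
have nH z : hrel tr H' v z = false.
  apply/negP => /hasP[h hH /andP[/eqP E1 _]]; case/negP: (nv z); rewrite -E1; exact: map_f.
have xv : x != v by rewrite eq_sym.
have yv : y != v by rewrite eq_sym.
split=> C P Ps cl.
  pose P' u := if u == v then P x && conn (tr a) A || P y && conn (tr b) A else P u.
  suff : P' t by rewrite /P' eq_sym (negPf nvt).
  apply: C; first by rewrite /P' eq_sym (negPf nvs).
  have xy : conn (tr a) A -> conn (tr b) A -> P x = P y.
    move=> ca cb; apply/idP/idP; apply: cl; rewrite hrel_cons cE /= ca cb.
      by rewrite eqxx.
    by rewrite mkpC eqxx.
  move=> u z; rewrite !hrel_cons /= !eq_mkp /P'.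
  have [->|nuv] := eqVneq u v.
    rewrite nH orbF ?eqxx (negPf xv) (negPf yv) /= !andbF !orbF.
    case/orP=> /andP[/eqP <-]; rewrite ?(negPf xv) ?(negPf yv) => c1 /orP[/andP[h1 h2]|/andP[h1 h2]] //.
      by rewrite xy.
    by rewrite -xy.
  have [->|nzv] := eqVneq z v.
    rewrite hrelC nH orbF ?eqxx ?(eq_sym v u) ?(negPf nuv) (negPf xv) (negPf yv) /=.
    by case/orP=> /andP[/eqP -> ->] ->; rewrite ?orbT.
  rewrite /= -hE => uz.
  by apply: cl; rewrite hrel_cons uz orbT.
apply: C => // u z; rewrite hrel_cons /= hE cE /= => /orP[/and3P[E1 ca cb]|uz]; last first.
  by apply: cl; rewrite !hrel_cons uz !orbT.
have st : P x = P y.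
  have vx : P v = P x.
    by apply/idP/idP; apply: cl; rewrite !hrel_cons /= ca ?eqxx // mkpC eqxx.
  have vy : P v = P y.
    by apply/idP/idP; apply: cl; rewrite !hrel_cons /= cb ?(mkpC y v) eqxx /= orbT.
  by rewrite -vx.
by move: E1; rewrite eq_mkp => /orP[] /andP[/eqP <- /eqP <-]; rewrite st.
Qed.

Lemma hrel_merge tr tr' H' k a b c s t :
  {in H', forall h, tr' h.2 = tr h.2} -> tr' c = Par (tr a) (tr b) ->
  cconn (hrel tr [:: (k, a), (k, b) & H']) s t <-> cconn (hrel tr' ((k, c) :: H')) s t.
Proof.
move=> trE cE.
have hE : hrel tr [:: (k, a), (k, b) & H'] =2 hrel tr' ((k, c) :: H').
  move=> u z; rewrite !hrel_cons /= cE orbA -andb_orr; congr (_ || _).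
  by apply: eq_in_has => h /trE ->.
by split; apply: eq_cconn => // u z; rewrite hE.
Qed.

Lemma hrel_single tr p s t : s != t ->
  cconn (hrel tr [:: (mkp s t, p)]) s t <-> conn (tr p) A.
Proof.
move=> nst; split=> [C|c P Ps]; last first.
  by move=> cl; apply: cl Ps; rewrite /hrel /= eqxx c.
apply: contraT => nc; suff : pred1 s t by rewrite /= eq_sym (negPf nst).
by apply: C => [|u v]; rewrite /= ?eqxx // /hrel /= (negPf nc) andbF.
Qed.

End Connectivity.
End Network.

Lemma updE T (f : nat -> T) x v : upd f x v x = v.
Proof. by rewrite /upd eqxx. Qed.

Lemma upd_neq T (f : nat -> T) x v y : y != x -> upd f x v y = f y.
Proof. by rewrite /upd => /negPf ->. Qed.

(** * Networks under series and parallel reductions, with their potential *)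

Section WeakNetwork.
Variables (m : nat) (spec : {set 'I_m} -> Prop) (K s t n : nat).
Hypothesis K_gt0 : 0 < K.
Implicit Types (H : network) (tr : nat -> tree 'I_m) (L R ty : nat -> nat).

Definition node_ok tr L R ty i :=
  [/\ 0 < L i < i, 0 < R i < i, uniq (leaves (tr i)) &
      tr i = (if ty i == 0 then @Ser _ else @Par _) (tr (L i)) (tr (R i))].

(** Nodes 1 to [m] are leaves, nodes [m + 1] to [N - 1] inner nodes. Keys may repeat, as a series
    reduction can create an edge parallel to an existing one. [wn_pot] keeps the work of all nodes
    created so far below the potential of the trees on the current edges; when a single edge is
    left, it bounds the total by the potential of the root. *)
Record wnet H tr N L R ty : Prop := WNet {
  wn_edge : all (fun h => [&& h.1.1 < h.1.2, h.1.2 < n, 0 < h.2 & h.2 < N]) H;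
  wn_uniq : uniq (flatten [seq leaves (tr h.2) | h <- H]);
  wn_conn : forall A, spec A <-> cconn (hrel A tr H) s t;
  wn_size : m < N;
  wn_leaf : forall e : 'I_m, tr e.+1 = Leaf e;
  wn_node : forall i, m < i < N -> node_ok tr L R ty i;
  wn_pot : \sum_(m.+1 <= i < N) nodew K (tr i) <=
           \sum_(h <- H) 4 * phi K (2 * leafcount (tr h.2)) }.

Lemma perm_wnet H H' tr N L R ty : perm_eq H H' -> wnet H tr N L R ty -> wnet H' tr N L R ty.
Proof.
move=> pH [h1 h2 h3 h4 h5 h6 h7]; split=> //.
- by rewrite -(perm_all _ pH).
- by rewrite -(perm_uniq (perm_flatten (perm_map _ pH))).
- by move=> A; rewrite h3; split; apply: eq_cconn; apply: perm_hrel => //; rewrite perm_sym.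
- by rewrite -(perm_big _ pH).
Qed.

(* Common part of the series and the parallel reduction: two edges a, b are replaced by
   an edge carrying the new node N. *)
Lemma wnet_node H' tr N L R ty ka kb kc a b (z : nat) :
  let T := (if z == 0 then @Ser _ else @Par _) (tr a) (tr b) in
  wnet [:: (ka, a), (kb, b) & H'] tr N L R ty -> (kc.1 < kc.2) && (kc.2 < n) ->
  (forall A tr', {in H', forall h, tr' h.2 = tr h.2} -> tr' N = T ->
     cconn (hrel A tr [:: (ka, a), (kb, b) & H']) s t <->
     cconn (hrel A tr' ((kc, N) :: H')) s t) ->
  wnet ((kc, N) :: H') (upd tr N T) N.+1 (upd L N a) (upd R N b) (upd ty N z).
Proof.
move=> T [h1 h2 h3 h4 h5 h6 h7] kcn hc.
move: h1 => /= /and3P[/and4P[_ _ a0 aN] /and4P[_ _ b0 bN] al].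
have uE i : i < N -> upd tr N T i = tr i by move=> iN; rewrite upd_neq // ltn_eqF.
have tE : {in H', forall h, upd tr N T h.2 = tr h.2}.
  by move=> h /(allP al)/and4P[_ _ _ hN]; apply: uE.
have lE : [seq leaves (upd tr N T h.2) | h <- H'] = [seq leaves (tr h.2) | h <- H'].
  by apply/eq_in_map => h /tE ->.
have lT : leaves T = leaves (tr a) ++ leaves (tr b) by rewrite /T; case: eqP.
have cT : leafcount T = leafcount (tr a) + leafcount (tr b) by rewrite /T; case: eqP.
split.
- rewrite /= (leq_ltn_trans _ h4) // ltnS leqnn !andbT.
  rewrite kcn /=; apply: sub_all al => h /and4P[-> -> -> /= hN]; exact: ltnW.
- by move: h2; rewrite /= updE lE lT catA.
- by move=> A; rewrite h3; apply: hc => //; rewrite updE.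
- exact: ltnW.
- by move=> e; rewrite uE //; have := ltn_ord e; lia.
- move=> i /andP[mi]; rewrite ltnS leq_eqVlt => /orP[/eqP ->|iN].
    rewrite /node_ok !updE !uE // a0 b0 aN bN; split=> //.
    by move: h2; rewrite /= catA -lT cat_uniq => /andP[].
  have [|/andP[l0 li] /andP[r0 ri] ui E] := h6 i; first by rewrite mi.
  have iN' : i != N by rewrite ltn_eqF.
  have lN := ltn_trans li iN; have rN := ltn_trans ri iN.
  by rewrite /node_ok !(upd_neq _ _ iN') !uE // l0 li r0 ri.
- rewrite big_nat_recr //= updE big_cons /= updE.
  have -> : \sum_(m.+1 <= i < N) nodew K (upd tr N T i) = \sum_(m.+1 <= i < N) nodew K (tr i).
    by apply: eq_big_nat => i /andP[_ iN]; rewrite uE.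
  have -> : \sum_(h <- H') 4 * phi K (2 * leafcount (upd tr N T h.2)) =
     \sum_(h <- H') 4 * phi K (2 * leafcount (tr h.2)).
    by apply: eq_big_seq => h /tE ->.
  move: h7; rewrite !big_cons /=.
  have := @nodew_phi _ K K_gt0 (tr a) (tr b) T; rewrite cT.
  have : T = Ser (tr a) (tr b) \/ T = Par (tr a) (tr b) by rewrite /T; case: eqP; auto.
  move=> o /(_ o); set X := \sum_(m.+1 <= i < N) nodew K (tr i); set Y := \sum_(h <- H') 4 * phi K (2 * leafcount (tr h.2)).
  move: X Y (nodew K T) (phi K (2 * (_ + _))) (phi K _) (phi K _) => c1 c2 c3 c4 c5 c6; clear; lia.
Qed.

Lemma wnet_series H H' tr N L R ty v x y a b :
  wnet H tr N L R ty -> perm_eq H [:: (mkp v x, a), (mkp v y, b) & H'] ->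
  (forall z, mkp v z \notin unzip1 H') -> v != x -> v != y -> x != y -> v != s -> v != t ->
  wnet ((mkp x y, N) :: H') (upd tr N (Ser (tr a) (tr b))) N.+1
    (upd L N a) (upd R N b) (upd ty N 0).
Proof.
move=> W pH nv nvx nvy nxy vs vt.
have W' := perm_wnet pH W.
have := wn_edge W' => /= /and3P[/and4P[_ xn _ _] /and4P[_ yn _ _] _].
apply: (wnet_node (z := 0) W') => [|A tr' tE cE].
  by move: xn yn nxy; rewrite /mkp /=; lia.
exact: hrel_series.
Qed.

Lemma wnet_merge H H' tr N L R ty k a b :
  wnet H tr N L R ty -> perm_eq H [:: (k, a), (k, b) & H'] ->
  wnet ((k, N) :: H') (upd tr N (Par (tr a) (tr b))) N.+1
    (upd L N a) (upd R N b) (upd ty N 1).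
Proof.
move=> W pH; have W' := perm_wnet pH W.
have := wn_edge W' => /= /and3P[/and4P[k1 k2 _ _] _ _].
apply: (wnet_node (z := 1) W') => [|A tr' tE cE]; first by rewrite k1.
exact: hrel_merge.
Qed.

End WeakNetwork.

(** * The network of the input graph *)

Section Initial.
Variable G : tgraph.
Hypotheses (Gs : simple_graph G) (Gsp : series_parallel G).

Let key (e : 'I_(ne G)) := mkp (ends e).1 (ends e).2.

Definition net0 : network := [seq (key e, e.+1) | e <- enum 'I_(ne G)].

Lemma ne_gt0 : 0 < ne G.
Proof.
elim: Gsp => [G' [_ E _ _]|G1 G2 G' _ h _ _ [fV [fE [gl _ _]]]|G1 G2 G' _ h _ _ [fV [fE [gl _ _]]]];
first (by rewrite E); have e := fE (inl (Ordinal h)); exact: leq_ltn_trans (ltn_ord e).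
Qed.

(** Edge [e] becomes node [e + 1], since 0 means no edge; [ne_gt0] supplies the default edge for
    numbers out of range. *)
Definition tree0 (i : nat) : tree 'I_(ne G) := Leaf (insubd (Ordinal ne_gt0) i.-1).

Lemma tree0E (e : 'I_(ne G)) : tree0 e.+1 = Leaf e.
Proof. by rewrite /tree0 /= /insubd valK. Qed.

Lemma ends_neq (e : 'I_(ne G)) : (ends e).1 != (ends e).2 :> nat.
Proof.
have [nl _] := Gs; apply/eqP => /val_inj E.
by have := nl e (ends e).1; rewrite {2}E joins_ends.
Qed.

Lemma key_joins e (u v : 'I_(nv G)) : (key e == mkp u v) = joins e u v.
Proof.
rewrite /key eq_mkp /joins; case: (ends e) => a b /=.
by rewrite !xpair_eqE -!val_eqE.
Qed.

Lemma key_inj : injective key.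
Proof.
move=> e f /eqP; rewrite key_joins => je; have [_ h] := Gs.
apply: h je _; exact: joins_ends.
Qed.

Lemma unzip1_net0 : unzip1 net0 = map key (enum 'I_(ne G)).
Proof. by rewrite /unzip1 -map_comp. Qed.

Lemma net0_uniq : uniq (unzip1 net0).
Proof. by rewrite unzip1_net0 map_inj_uniq ?enum_uniq //; apply: key_inj. Qed.

Lemma net0_hadj : hadj net0 =2 img_rel val (gadj (G := G)).
Proof.
move=> a b; rewrite /hadj unzip1_net0; apply/mapP/img_relP.
  move=> [e _ /eqP]; rewrite eq_sym eq_mkp => /orP[] /andP[/eqP <- /eqP <-].
    by exists (ends e).1, (ends e).2; split=> //; apply/existsP; exists e; apply: joins_ends.
  exists (ends e).2, (ends e).1; split=> //; apply/existsP; exists e.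
  by rewrite joinsC joins_ends.
move=> [x [y [<- <-]]] /existsP[e je]; exists e; first by rewrite mem_enum.
by apply/eqP; rewrite eq_sym key_joins.
Qed.

Lemma net0_reduces : exists2 l, (forall v, v \in l -> [/\ v < nv G, v != src G & v != snk G]) &
  size l <= nv G /\ reduces (hadj net0) l (pair_rel (val (src G)) (val (snk G))).
Proof.
have [nst [l lE r]] := sp_reduces Gsp.
exists (map val l) => [v /mapP[u]|]; first by rewrite lE => /andP[us ut] ->; rewrite ltn_ord.
split.
  by rewrite size_map -(card_uniqP (reduces_uniq (sgraph_gadj Gs) r)) -[X in _ <= X]card_ord max_card.
have := @reduces_embed _ _ val val_inj _ _ _ (fun _ _ => false) [::] (pair_rel (val (src G)) (val (snk G))) r.
move=> /(_ (fun _ _ _ => erefl) (fun _ _ _ => erefl)); rewrite cats0 => h.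
apply: eq_reduces (h _); first by move=> a b; rewrite net0_hadj.
by apply: reduces_nil => a b /=; rewrite img_pair_rel.
Qed.

Lemma net0_conn A : has_st_path A <-> cconn (hrel A tree0 net0) (src G) (snk G).
Proof.
have hE (u v : 'I_(nv G)) : hrel A tree0 net0 u v = [exists e in A, joins e u v].
  apply/hasP/existsP => [[h /mapP[e _ ->]]|[e /andP[eA je]]].
    by rewrite [fst _]/= [snd _]/= key_joins tree0E /= => /andP[je eA]; exists e; rewrite eA.
  exists (key e, e.+1); first by apply/mapP; exists e; rewrite ?mem_enum.
  by rewrite [fst _]/= [snd _]/= key_joins je tree0E.
have hlt a b : hrel A tree0 net0 a b -> (a < nv G) && (b < nv G).
  move=> /hasP[h /mapP[e _ ->] /= /andP[]]; rewrite eq_mkp.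
  by case/orP=> /andP[/eqP <- /eqP <-] _; rewrite !ltn_ord.
split=> [/connectP[p pp ->] P Ps cl|C].
  elim: p (src G) pp Ps => //= v p IH u /andP[uv pp] Pu; apply: IH pp _.
  by apply: cl Pu; rewrite hE.
(* The cut form is applied to the set of vertices reachable from the source, transported to
   [nat]. *)
pose P a := [exists u : 'I_(nv G), (val u == a) &&
   connect (fun u v => [exists e in A, joins e u v]) (src G) u].
have : P (snk G).
  apply: C; first by apply/existsP; exists (src G); rewrite eqxx connect0.
  move=> a b ab /existsP[u /andP[/eqP ua su]]; have /andP[_ bn] := hlt _ _ ab.
  apply/existsP; exists (Ordinal bn); rewrite eqxx /=; apply: connect_trans su (connect1 _).
  by rewrite -hE ua.
by case/existsP=> u /andP[/eqP /val_inj ->].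
Qed.

Lemma wnet0 K L R ty : wnet (fun A => has_st_path A) K (src G) (snk G) (nv G)
  net0 tree0 (ne G).+1 L R ty.
Proof.
split=> //.
- apply/allP => h /mapP[e _ ->] /=; rewrite ltnS ltn_ord /mkp /=.
  by have := ends_neq e; have := ltn_ord (ends e).1; have := ltn_ord (ends e).2; lia.
- rewrite /net0 -map_comp (_ : map _ _ = [seq [:: e] | e <- enum 'I_(ne G)]).
    by rewrite flatten_map1 map_id enum_uniq.
  by apply: eq_map => e; rewrite [RHS]/= -/(leaves (Leaf e)) -tree0E.
- exact: net0_conn.
- exact: tree0E.
- by move=> i; lia.
- by rewrite big_geq.
Qed.

End Initial.

(** * Program logic with running times *)

Fixpoint ivw (c : cmd) : seq nat :=
  match c with
  | CISet x _ => [:: x]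
  | CSeq c1 c2 | CIf _ c1 c2 => ivw c1 ++ ivw c2
  | CWhile _ c1 => ivw c1
  | _ => [::]
  end.

Fixpoint iaw (c : cmd) : seq nat :=
  match c with
  | CIPut a _ _ => [:: a]
  | CSeq c1 c2 | CIf _ c1 c2 => iaw c1 ++ iaw c2
  | CWhile _ c1 => iaw c1
  | _ => [::]
  end.

Fixpoint wvw (c : cmd) : seq nat :=
  match c with
  | CWSet x _ => [:: x]
  | CSeq c1 c2 | CIf _ c1 c2 => wvw c1 ++ wvw c2
  | CWhile _ c1 => wvw c1
  | _ => [::]
  end.

Fixpoint waw (c : cmd) : seq nat :=
  match c with
  | CWPut a _ _ => [:: a]
  | CSeq c1 c2 | CIf _ c1 c2 => waw c1 ++ waw c2
  | CWhile _ c1 => waw c1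
  | _ => [::]
  end.

Fixpoint loopfree (c : cmd) : bool :=
  match c with
  | CSeq c1 c2 | CIf _ c1 c2 => loopfree c1 && loopfree c2
  | CWhile _ _ => false
  | _ => true
  end.

(** A conditional is charged for both branches, which makes the bound on a loop-free command
    independent of the state. *)
Fixpoint mcost (c : cmd) : nat :=
  match c with
  | CSkip => 1
  | CISet _ e => (icost e).+1
  | CIPut _ i e => (icost i + icost e).+1
  | CWSet _ e => (wcost e).+1
  | CWPut _ i e => (icost i + wcost e).+1
  | CSeq c1 c2 => mcost c1 + mcost c2
  | CIf b c1 c2 => (tcost b + (mcost c1 + mcost c2)).+1
  | CWhile _ _ => 0
  end.

Section Hoare.
Variable R : realDomainType.
Implicit Types (st : state R) (c : cmd) (b : test).

(** Cells are framed by name and arrays as whole functions, so that carrying a fact about unwritten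
    arrays across a command reduces to a syntactic check that computes to [true]. *)
Record frame c st st' : Prop := Frame {
  fr_ivar : forall x, x \notin ivw c -> ivar st' x = ivar st x;
  fr_iarr : forall a, a \notin iaw c -> iarr st' a = iarr st a;
  fr_wvar : forall x, x \notin wvw c -> wvar st' x = wvar st x;
  fr_warr : forall a, a \notin waw c -> warr st' a = warr st a }.

Lemma frame_trans c1 c2 c st st1 st2 :
  {subset ivw c1 <= ivw c} -> {subset iaw c1 <= iaw c} ->
  {subset wvw c1 <= wvw c} -> {subset waw c1 <= waw c} ->
  {subset ivw c2 <= ivw c} -> {subset iaw c2 <= iaw c} ->
  {subset wvw c2 <= wvw c} -> {subset waw c2 <= waw c} ->
  frame c1 st st1 -> frame c2 st1 st2 -> frame c st st2.
Proof.
move=> s1 s2 s3 s4 t1 t2 t3 t4 [h1 h2 h3 h4] [k1 k2 k3 k4]; split=> x nx.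
- by rewrite k1 ?h1 //; apply: contraNN nx; [apply: s1|apply: t1].
- by rewrite k2 ?h2 //; apply: contraNN nx; [apply: s2|apply: t2].
- by rewrite k3 ?h3 //; apply: contraNN nx; [apply: s3|apply: t3].
- by rewrite k4 ?h4 //; apply: contraNN nx; [apply: s4|apply: t4].
Qed.

Lemma exec_frame c st T st' : exec c st T st' -> frame c st st'.
Proof.
elim=> {c st T st'} //=.
- by move=> st x e; split=> //= y; rewrite inE => ny; rewrite upd_neq.
- by move=> st a i e; split=> //= y; rewrite inE => ny; rewrite upd_neq.
- by move=> st x e; split=> //= y; rewrite inE => ny; rewrite upd_neq.
- by move=> st a i e; split=> //= y; rewrite inE => ny; rewrite upd_neq.
- move=> c1 c2 st T1 st1 T2 st2 _ h1 _ h2.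
  by apply: frame_trans h1 h2 => x /= xi; rewrite mem_cat xi ?orbT.
- move=> b c1 c2 st T st' _ _ [h1 h2 h3 h4].
  by split=> x; rewrite /= mem_cat negb_or => /andP[n1 n2]; auto.
- move=> b c1 c2 st T st' _ _ [h1 h2 h3 h4].
  by split=> x; rewrite /= mem_cat negb_or => /andP[n1 n2]; auto.
- move=> b c st T1 st1 T2 st2 _ _ h1 _ h2.
  by apply: frame_trans h1 h2.
Qed.

Definition runs c st B (Q : state R -> Prop) :=
  exists T st', [/\ exec c st T st', T <= B & Q st'].

Lemma runs_weak c st B B' (Q Q' : state R -> Prop) : runs c st B Q -> B <= B' ->
  (forall st', frame c st st' -> Q st' -> Q' st') -> runs c st B' Q'.
Proof.
move=> [T [st' [e le q]]] le' QQ; exists T, st'; split=> //; first exact: leq_trans le'.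
exact: QQ (exec_frame e) q.
Qed.

Lemma runs_seq c1 c2 st B1 B2 (Q1 Q2 : state R -> Prop) : runs c1 st B1 Q1 ->
  (forall st1, frame c1 st st1 -> Q1 st1 -> runs c2 st1 B2 Q2) ->
  runs (CSeq c1 c2) st (B1 + B2) Q2.
Proof.
move=> [T1 [st1 [e1 l1 q1]]] /(_ _ (exec_frame e1) q1) [T2 [st2 [e2 l2 q2]]].
by exists (T1 + T2), st2; split=> //; [apply: E_Seq e1 e2|apply: leq_add].
Qed.

Lemma runs_if b c1 c2 st B1 B2 (Q : state R -> Prop) :
  (teval st b -> runs c1 st B1 Q) -> (~~ teval st b -> runs c2 st B2 Q) ->
  runs (CIf b c1 c2) st (tcost b + (B1 + B2)).+1 Q.
Proof.
case/boolP: (teval st b) => tb h1 h2.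
  have [T [st' [e l q]]] := h1 isT; exists (tcost b + T).+1, st'; split=> //; last by lia.
  exact: E_IfTrue.
have [T [st' [e l q]]] := h2 isT; exists (tcost b + T).+1, st'; split=> //; last by lia.
exact: E_IfFalse.
Qed.

(* [upd] for names of variables and arrays, convertible to [upd]: kept apart so that
   symbolic execution can compute on names without touching array indices. *)
Definition nupd (T : Type) (f : nat -> T) (x : nat) (v : T) : nat -> T :=
  fun y => if eqn y x then v else f y.

(** A conditional is pushed into each component, so the result is again a [State] and a component
    can be read off without deciding the test. *)
Fixpoint run c st : state R :=
  match c with
  | CSkip => st
  | CISet x e => State (nupd (ivar st) x (ieval st e)) (iarr st) (wvar st) (warr st)
  | CIPut a i e => State (ivar st)
      (nupd (iarr st) a (upd (iarr st a) (ieval st i) (ieval st e))) (wvar st) (warr st)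
  | CWSet x e => State (ivar st) (iarr st) (nupd (wvar st) x (weval st e)) (warr st)
  | CWPut a i e => State (ivar st) (iarr st) (wvar st)
      (nupd (warr st) a (upd (warr st a) (ieval st i) (weval st e)))
  | CSeq c1 c2 => run c2 (run c1 st)
  | CIf b c1 c2 =>
      let st1 := run c1 st in let st2 := run c2 st in
      State (fun x => if teval st b then ivar st1 x else ivar st2 x)
        (fun a => if teval st b then iarr st1 a else iarr st2 a)
        (fun x => if teval st b then wvar st1 x else wvar st2 x)
        (fun a => if teval st b then warr st1 a else warr st2 a)
  | CWhile _ _ => st
  end.

Lemma runs_run c st : loopfree c -> runs c st (mcost c) (eq (run c st)).
Proof.
elim: c st => //= [st|x e st|a i e st|x e st|a i e st|c1 h1 c2 h2 st|b c1 h1 c2 h2 st] lf.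
- by exists 1, st; split=> //; apply: E_Skip.
- by eexists _, _; split; [apply: E_ISet| |].
- by eexists _, _; split; [apply: E_IPut| |].
- by eexists _, _; split; [apply: E_WSet| |].
- by eexists _, _; split; [apply: E_WPut| |].
- case/andP: lf => l1 l2; apply: runs_seq (h1 _ l1) _ => st1 _ <-.
  exact: h2.
- case/andP: lf => l1 l2; apply: runs_if => tb; rewrite ?tb ?(negPf tb).
    by apply: runs_weak (h1 st l1) _ _ => // st' _ <-; case: (run c1 st).
  by apply: runs_weak (h2 st l2) _ _ => // st' _ <-; case: (run c2 st).
Qed.

Lemma runs_straight c st (Q : state R -> Prop) : loopfree c -> Q (run c st) ->
  runs c st (mcost c) Q.
Proof. by move=> lf q; apply: runs_weak (runs_run st lf) _ _ => // st' _ <-. Qed.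

(* [credit] bounds the remaining running time, so it also serves as the variant. *)
Lemma runs_while b c (Inv : nat -> state R -> Prop) st credit :
  (forall cr st, Inv cr st -> tcost b < cr) ->
  (forall cr st, Inv cr st -> teval st b ->
     exists B, B + tcost b < cr /\ runs c st B (Inv (cr - (B + tcost b).+1))) ->
  Inv credit st ->
  runs (CWhile b c) st credit (fun st' => ~~ teval st' b /\ exists cr, Inv cr st').
Proof.
move=> hc hb; elim/ltn_ind: credit st => cr IH st I.
case/boolP: (teval st b) => tb; last first.
  exists (tcost b).+1, st; split; [exact: E_WhileFalse|exact: hc I|].
  by split=> //; exists cr.
have [B [lt [T1 [st1 [e1 l1 I1]]]]] := hb _ _ I tb.
have [|T2 [st2 [e2 l2 q2]]] := IH _ _ st1 I1; first by lia.
exists (tcost b + T1 + T2).+1, st2; split=> //; last by lia.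
exact: E_WhileTrue e1 e2.
Qed.

Lemma runs_for b c (I : nat -> state R -> Prop) (f : nat -> nat) lo hi st :
  (forall i st, lo <= i < hi -> I i st -> teval st b /\ runs c st (f i) (I i.+1)) ->
  (forall st, I hi st -> ~~ teval st b) -> lo <= hi -> I lo st ->
  runs (CWhile b c) st ((\sum_(lo <= i < hi) (f i + tcost b).+1) + (tcost b).+1) (I hi).
Proof.
move=> hb hend lohi Ilo.
pose Inv cr (st' : state R) := exists i, [/\ lo <= i <= hi, I i st' &
  cr = (\sum_(i <= j < hi) (f j + tcost b).+1) + (tcost b).+1].
have Ifin i st' : lo <= i <= hi -> I i st' -> ~~ teval st' b -> i = hi.
  move=> ih Ii; case: (ltnP i hi) => h; last by lia.
  by have [-> _] := hb i st' ltac:(lia) Ii.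
have W := @runs_while b c Inv st _ _ _ (ex_intro _ lo (And3 _ Ilo erefl)).
apply: runs_weak (W _ _ _) _ _ => //; last first.
- move=> st' _ [nb [_ [i [ih Ii _]]]]; by rewrite -(Ifin _ _ ih Ii nb).
- by rewrite leqnn lohi.
- move=> cr st' [i [ih Ii ->]] tb.
  have lti : i < hi.
    case: (ltnP i hi) => // ge; have Ei : i = hi by lia.
    by move: tb; rewrite (negPf (hend _ _)) // -Ei.
  exists (f i); rewrite (big_ltn lti); split; first by lia.
  have [_ r] := hb i st' ltac:(lia) Ii.
  apply: runs_weak r _ _ => // st2 _ I2; exists i.+1; split=> //; lia.
- by move=> cr st' [i [ih Ii ->]]; lia.
Qed.

Lemma runs_for_const b c (I : nat -> state R -> Prop) B lo hi st :
  (forall i st, lo <= i < hi -> I i st -> teval st b /\ runs c st B (I i.+1)) ->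
  (forall st, I hi st -> ~~ teval st b) -> lo <= hi -> I lo st ->
  runs (CWhile b c) st ((hi - lo) * (B + tcost b).+1 + (tcost b).+1) (I hi).
Proof.
move=> h1 h2 h3 h4; have := runs_for (f := fun=> B) h1 h2 h3 h4.
by rewrite sum_nat_const_nat.
Qed.

End Hoare.

(** Only names are computed: [upd] is not unfolded, so array addresses stay symbolic. The [change]
    steps refold the projections of the initial state. *)
Ltac sx st :=
  cbv [run nupd eqn ivar iarr wvar warr ieval weval teval];
  change (match st with State f _ _ _ => f end) with (ivar st);
  change (match st with State _ f _ _ => f end) with (iarr st);
  change (match st with State _ _ f _ => f end) with (wvar st);
  change (match st with State _ _ _ f => f end) with (warr st).

(** * The program *)

Declare Scope ram_scope.
Delimit Scope ram_scope with ram.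
Notation "c1 ;; c2" := (CSeq c1 c2) (at level 60, right associativity) : ram_scope.
Notation "e1 +: e2" := (IAdd e1 e2) (at level 50, left associativity) : ram_scope.
Notation "e1 -: e2" := (ISub e1 e2) (at level 50, left associativity) : ram_scope.
Notation "x ::= e" := (CISet x e) (at level 55) : ram_scope.
Notation "a @@ i ::= e" := (CIPut a i e) (at level 55, i at level 52) : ram_scope.
Notation "a @[ i ]" := (IGet a i) (at level 9, i at level 52) : ram_scope.
Notation "! x" := (IVar x) (at level 9, format "! x") : ram_scope.
Notation "# k" := (INum k) (at level 9, format "# k") : ram_scope.

(** Subtraction is truncated, so this is the minimum. *)
Definition imin e1 e2 := ISub e1 (ISub e1 e2).

Notation v_n := 0. Notation v_m := 1. Notation v_s := 2. Notation v_t := 3. Notation v_k := 4.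
Notation v_i := 5. Notation v_v := 7. Notation v_x := 8. Notation v_y := 9. Notation v_d := 10.
Notation v_N := 11. Notation v_qh := 12. Notation v_qt := 13. Notation v_c := 14.
Notation v_K := 15. Notation v_j := 16. Notation v_a := 17. Notation v_B := 18.
Notation v_p := 19. Notation v_q := 20. Notation v_bp := 21. Notation v_bq := 22.
Notation v_bad := 23. Notation v_da := 24. Notation v_db := 25. Notation v_b := 26.
Notation v_D := 27. Notation v_cp := 28. Notation v_cq := 29.
Notation a_end1 := 0. Notation a_end2 := 1. Notation a_M := 2. Notation a_row := 3.
Notation a_sq := 4. Notation a_rt := 5. Notation a_hf := 6. Notation a_Q := 7.
Notation a_mat := 8. Notation a_deg := 9. Notation a_S1 := 10. Notation a_S2 := 11.
Notation a_L := 12. Notation a_R := 13. Notation a_ty := 14. Notation a_base := 15.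
Notation a_cap := 16. Notation a_bad := 17. Notation a_da := 18. Notation a_db := 19.
Notation a_need := 20. Notation w_w := 0. Notation w_val := 1.

Section Program.
Local Open Scope ram_scope.

(** Multiples of [n] and squares advance by additions only. The loop goes up to [2 * n] because the
    sum of two neighbours gets squared; the sparse writes at [i * i] are affordable since memory
    needs no initialization. [a_Q] receives the initial queue of all vertices. *)
Definition setup_body : cmd :=
  a_rt @@ (a_sq @[!v_i]) ::= !v_i ;;
  a_hf @@ (!v_i +: !v_i) ::= !v_i ;;
  a_Q @@ (!v_i) ::= !v_i ;;
  a_row @@ (!v_i +: #1) ::= a_row @[!v_i] +: !v_n ;;
  a_sq @@ (!v_i +: #1) ::= a_sq @[!v_i] +: !v_i +: !v_i +: #1 ;;
  v_i ::= !v_i +: #1.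

Definition setup_test := TLe !v_i (!v_n +: !v_n).

Definition add_sums : cmd :=
  a_deg @@ (!v_x) ::= a_deg @[!v_x] +: #1 ;;
  a_deg @@ (!v_y) ::= a_deg @[!v_y] +: #1 ;;
  a_S1 @@ (!v_x) ::= a_S1 @[!v_x] +: !v_y ;;
  a_S1 @@ (!v_y) ::= a_S1 @[!v_y] +: !v_x ;;
  a_S2 @@ (!v_x) ::= a_S2 @[!v_x] +: a_sq @[!v_y] ;;
  a_S2 @@ (!v_y) ::= a_S2 @[!v_y] +: a_sq @[!v_x].

Definition put_mat : cmd :=
  a_mat @@ (a_row @[!v_x] +: !v_y) ::= !v_c ;;
  a_mat @@ (a_row @[!v_y] +: !v_x) ::= !v_c.

Definition load_pre : cmd :=
  v_x ::= a_end1 @[!v_i] ;;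
  v_y ::= a_end2 @[!v_i] ;;
  v_i ::= !v_i +: #1 ;;
  v_c ::= !v_i.

Definition load_test := TLe (!v_i +: #1) !v_m.

(** [v_d] is the difference of the two neighbours, so [v_x] receives the larger one. *)
Definition decode : cmd :=
  v_d ::= a_rt @[a_S2 @[!v_v] +: a_S2 @[!v_v] -: a_sq @[a_S1 @[!v_v]]] ;;
  v_x ::= a_hf @[a_S1 @[!v_v] +: !v_d] ;;
  v_y ::= a_S1 @[!v_v] -: !v_x.

Definition new_series : cmd :=
  a_L @@ (!v_N) ::= a_mat @[a_row @[!v_v] +: !v_x] ;;
  a_R @@ (!v_N) ::= a_mat @[a_row @[!v_v] +: !v_y] ;;
  a_ty @@ (!v_N) ::= #0 ;;
  v_c ::= !v_N ;;
  v_N ::= !v_N +: #1.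

Definition cut_mat : cmd :=
  a_mat @@ (a_row @[!v_v] +: !v_x) ::= #0 ;;
  a_mat @@ (a_row @[!v_x] +: !v_v) ::= #0 ;;
  a_mat @@ (a_row @[!v_v] +: !v_y) ::= #0 ;;
  a_mat @@ (a_row @[!v_y] +: !v_v) ::= #0.

Definition cut_sums : cmd :=
  a_deg @@ (!v_v) ::= #0 ;;
  a_deg @@ (!v_x) ::= a_deg @[!v_x] -: #1 ;;
  a_deg @@ (!v_y) ::= a_deg @[!v_y] -: #1 ;;
  a_S1 @@ (!v_v) ::= #0 ;;
  a_S1 @@ (!v_x) ::= a_S1 @[!v_x] -: !v_v ;;
  a_S1 @@ (!v_y) ::= a_S1 @[!v_y] -: !v_v ;;
  a_S2 @@ (!v_v) ::= #0 ;;
  a_S2 @@ (!v_x) ::= a_S2 @[!v_x] -: a_sq @[!v_v] ;;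
  a_S2 @@ (!v_y) ::= a_S2 @[!v_y] -: a_sq @[!v_v].

Definition new_parallel : cmd :=
  a_L @@ (!v_N) ::= a_mat @[a_row @[!v_x] +: !v_y] ;;
  a_R @@ (!v_N) ::= !v_c ;;
  a_ty @@ (!v_N) ::= #1 ;;
  v_c ::= !v_N ;;
  v_N ::= !v_N +: #1.

Definition push : cmd :=
  a_Q @@ (!v_qt) ::= !v_x ;;
  a_Q @@ (!v_qt +: #1) ::= !v_y ;;
  v_qt ::= !v_qt +: #2.

(** If [x] and [y] are already adjacent, their neighbour sums stay the same and only the tree on
    their edge changes, to a new parallel node. *)
Definition join_edge : cmd :=
  CIf (TEq a_mat @[a_row @[!v_x] +: !v_y] #0) add_sums new_parallel.

Definition elim_core : cmd :=
  decode ;; new_series ;; cut_mat ;; cut_sums ;; join_edge ;; put_mat.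

Definition elim_cmd : cmd := elim_core ;; push.

Definition reduce_pop : cmd := v_v ::= a_Q @[!v_qh] ;; v_qh ::= !v_qh +: #1.

(** Queue entries may be stale, repeated or terminals, so the conditions are tested when an entry is
    removed. *)
Definition elim_test : test :=
  TAnd (TEq a_deg @[!v_v] #2) (TAnd (TNot (TEq !v_v !v_s)) (TNot (TEq !v_v !v_t))).

Definition reduce_body : cmd := reduce_pop ;; CIf elim_test elim_cmd CSkip.

Definition reduce_test := TLe (!v_qh +: #1) !v_qt.

(** Entry 0 stays as zero memory, and entry 1 needs only its weight. Entry 2 is written even if
    [K = 1], when the table ends at 1; the block length [D = K + 2] makes room for it. *)
Definition leaf_body : cmd :=
  a_base @@ (!v_i) ::= !v_B ;;
  a_cap @@ (!v_i) ::= imin !v_K #2 ;;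
  CWPut w_val (!v_B +: #1) (WGet w_w (!v_i -: #1)) ;;
  CWPut w_val (!v_B +: #2) (WGet w_w (!v_i -: #1)) ;;
  a_bad @@ (!v_B +: #2) ::= a_M @[!v_i -: #1] ;;
  v_B ::= !v_B +: !v_D ;;
  v_i ::= !v_i +: #1.

Definition leaf_test := TLe !v_i !v_m.

(** The sorted order of the children is stored back, so that tracing matches [a_da] and [a_db] with
    the right child. *)
Definition node_pre : cmd :=
  v_p ::= a_L @[!v_i] ;;
  v_q ::= a_R @[!v_i] ;;
  CIf (TEq a_ty @[!v_i] #0) CSkip
    (CIf (TLe a_cap @[!v_p] a_cap @[!v_q]) CSkip
      (v_p ::= a_R @[!v_i] ;; v_q ::= a_L @[!v_i])) ;;
  a_L @@ (!v_i) ::= !v_p ;;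
  a_R @@ (!v_i) ::= !v_q ;;
  v_cp ::= a_cap @[!v_p] ;;
  v_cq ::= a_cap @[!v_q] ;;
  v_c ::= imin (!v_cp +: !v_cq) !v_K ;;
  a_cap @@ (!v_i) ::= !v_c ;;
  a_base @@ (!v_i) ::= !v_B ;;
  v_bp ::= a_base @[!v_p] ;;
  v_bq ::= a_base @[!v_q] ;;
  v_j ::= #1.

Definition cand_bad := a_bad @[!v_bp +: !v_a] +: a_bad @[!v_bq +: !v_b].
Definition cand_val := WAdd (WGet w_val (!v_bp +: !v_a)) (WGet w_val (!v_bq +: !v_b)).

Definition ser_cell : cmd :=
  v_a ::= imin !v_j !v_cp ;;
  v_b ::= imin !v_j !v_cq ;;
  v_bad ::= cand_bad ;;
  CWSet 0 cand_val ;;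
  v_da ::= !v_a ;;
  v_db ::= !v_b.

Definition par_init : cmd :=
  v_bad ::= a_bad @[!v_bp +: !v_cp] ;;
  CWSet 0 (WGet w_val (!v_bp +: !v_cp)) ;;
  v_da ::= !v_cp ;;
  v_db ::= #0 ;;
  v_a ::= #0.

Definition par_body : cmd :=
  v_b ::= imin (!v_j -: !v_a) !v_cq ;;
  CIf (TAnd (TEq cand_bad #0) (TNot (TAnd (TEq !v_bad #0) (TWLe (WVar 0) cand_val))))
    (v_bad ::= #0 ;; CWSet 0 cand_val ;; v_da ::= !v_a ;; v_db ::= !v_b) CSkip ;;
  v_a ::= !v_a +: #1.

Definition par_test := TAnd (TLe (!v_a +: #1) !v_cp) (TLe !v_a !v_j).

Definition par_cell : cmd := par_init ;; CWhile par_test par_body.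

Definition store : cmd :=
  a_bad @@ (!v_B +: !v_j) ::= !v_bad ;;
  CWPut w_val (!v_B +: !v_j) (WVar 0) ;;
  a_da @@ (!v_B +: !v_j) ::= !v_da ;;
  a_db @@ (!v_B +: !v_j) ::= !v_db ;;
  v_j ::= !v_j +: #1.

Definition cell_body : cmd :=
  CIf (TEq a_ty @[!v_i] #0) ser_cell par_cell ;; store.

Definition cell_test := TLe !v_j !v_c.

Definition node_post : cmd := v_B ::= !v_B +: !v_D ;; v_i ::= !v_i +: #1.

Definition node_body : cmd := node_pre ;; CWhile cell_test cell_body ;; node_post.

Definition node_test := TLe (!v_i +: #1) !v_N.

Definition root_cmd : cmd :=
  v_p ::= a_mat @[a_row @[!v_s] +: !v_t] ;; v_c ::= a_cap @[!v_p].

Definition root_test := TEq a_bad @[a_base @[!v_p] +: !v_c] #0.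

Definition trace_body : cmd :=
  v_i ::= !v_i -: #1 ;;
  v_j ::= a_need @[!v_i] ;;
  CIf (TEq !v_j #0) CSkip
    (a_need @@ (a_L @[!v_i]) ::= a_da @[a_base @[!v_i] +: !v_j] ;;
     a_need @@ (a_R @[!v_i]) ::= a_db @[a_base @[!v_i] +: !v_j]).

Definition trace_test := TLe (!v_m +: #2) !v_i.

Definition out_body : cmd :=
  CIf (TEq a_need @[!v_i +: #1] #0) (a_end1 @@ (!v_i) ::= #0) (a_end1 @@ (!v_i) ::= #1) ;;
  v_i ::= !v_i +: #1.

Definition out_test := TLe (!v_i +: #1) !v_m.

(** Surviving any [k] faults is demand [k + 1]. *)
Definition phase_setup : cmd := v_K ::= !v_k +: #1 ;; CWhile setup_test setup_body.
Definition phase_load : cmd := v_i ::= #0 ;; CWhile load_test (load_pre ;; add_sums ;; put_mat).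
Definition phase_reduce : cmd :=
  (v_N ::= !v_m +: #1 ;; v_qt ::= !v_n) ;; CWhile reduce_test reduce_body.
Definition phase_leaf : cmd :=
  (v_D ::= !v_K +: #2 ;; v_B ::= !v_D ;; v_i ::= #1) ;; CWhile leaf_test leaf_body.
Definition phase_node : cmd := CWhile node_test node_body.
Definition phase_out : cmd :=
  (a_need @@ (!v_p) ::= !v_c ;; v_i ::= !v_N) ;;
  CWhile trace_test trace_body ;; v_i ::= #0 ;; CWhile out_test out_body ;; v_n ::= #1.
Definition phase_root : cmd := root_cmd ;; CIf root_test phase_out (v_n ::= #0).

Definition ftp_program : cmd :=
  phase_setup ;; phase_load ;; phase_reduce ;; phase_leaf ;; phase_node ;; phase_root.

End Program.

(** * Correctness of the phases *)

Section PhaseSetup.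
Variable R : realDomainType.
Implicit Type st : state R.

Definition tabs n st := forall i, i <= n + n ->
  [/\ iarr st a_row i = i * n, iarr st a_sq i = i * i, iarr st a_rt (i * i) = i &
      iarr st a_hf (i + i) = i].

Let setup_inv n i st := [/\ ivar st v_i = i, ivar st v_n = n,
  (forall j, j <= i -> iarr st a_row j = j * n /\ iarr st a_sq j = j * j) &
  (forall j, j < i -> [/\ iarr st a_rt (j * j) = j, iarr st a_hf (j + j) = j & iarr st a_Q j = j])].

Lemma setup_runs st n k : ivar st v_n = n -> ivar st v_k = k -> ivar st v_i = 0 ->
  iarr st a_row 0 = 0 -> iarr st a_sq 0 = 0 ->
  runs phase_setup st (mcost (CISet v_K (IAdd (IVar v_k) (INum 1))) +
     ((n + n).+1 * (mcost setup_body + tcost setup_test).+1 + (tcost setup_test).+1))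
   (fun st' => [/\ ivar st' v_K = k.+1, tabs n st' & forall i, i <= n + n -> iarr st' a_Q i = i]).
Proof.
move=> En Ek Ei Er Es; apply: runs_seq; first exact: runs_run.
move=> st1 _ <-; set st1' := run _ _.
have EK : ivar st1' v_K = k.+1 by rewrite /st1'; sx st; rewrite Ek addn1.
have I0 : setup_inv n 0 st1'.
  by split; rewrite /st1' //; sx st => // j; rewrite leqn0 => /eqP ->; rewrite Er Es.
have := @runs_for_const _ setup_test setup_body (setup_inv n) (mcost setup_body) 0 (n + n).+1 st1'.
rewrite subn0 => h; apply: runs_weak (h _ _ _ I0) _ _ => // {h}.
- move=> i st2 /andP[_ ilt] [Hi Hn Ht Hr]; split.
    by rewrite /setup_test /=; rewrite Hi Hn; lia.
  apply: runs_straight => //; split; cbv delta [setup_body]; sx st2; rewrite ?Hi ?Hn ?addn1 //.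
    move=> j ji; rewrite /upd; have [Ai Bi] := Ht i (leqnn _).
    case: eqP => [->|nj]; first by rewrite Ai Bi; lia.
    by apply: Ht; lia.
  move=> j ji; rewrite /upd; have [Ai Bi] := Ht i (leqnn _); rewrite Bi.
  have [->|nj] := eqVneq j i; first by rewrite !eqxx.
  have [h1 h2 h3] := Hr j ltac:(lia).
  have -> : (j * j == i * i) = false by apply/eqP; nia.
  by have -> : (j + j == i + i) = false by apply/eqP; lia.
- by move=> st2 [Hi Hn _ _]; rewrite /setup_test /= Hi Hn -ltnNge.
- move=> st2 fr [Hi Hn Ht Hr]; split.
  + by rewrite (fr_ivar fr).
  + by move=> i ile; have [h1 h2] := Ht i ltac:(lia); have [h3 h4 h5] := Hr i ltac:(lia).
  + by move=> i ile; have [] := Hr i ltac:(lia).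
Qed.

End PhaseSetup.

(** * Adjacency matrix and neighbour sums in memory *)

Section Memory.
Variable R : realDomainType.
Implicit Types (st : state R) (H : network).

Definition sums st H := forall u,
  [/\ iarr st a_deg u = gsum (fun=> 1) u H, iarr st a_S1 u = gsum id u H &
      iarr st a_S2 u = gsum (fun z => z * z) u H].

Definition mats n st H := forall u v, u < n -> v < n ->
  iarr st a_mat (u * n + v) = lk H (mkp u v).

Lemma gsum_cons g u h H : gsum g u (h :: H) = contrib g u h.1 + gsum g u H.
Proof. by rewrite /gsum big_cons. Qed.

(** The left-hand side is the term produced by symbolic execution of two consecutive writes;
    [x != y] keeps the second read clear of the first write. *)
Lemma upd_gsum_add g f H x y c : (forall u, f u = gsum g u H) -> x != y -> forall u,
  upd (upd f x (f x + g y)) y (upd f x (f x + g y) y + g x) u = gsum g u ((mkp x y, c) :: H).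
Proof.
move=> fE nxy u; rewrite gsum_cons contrib_mkp // /upd (eq_sym y) (negPf nxy) !fE.
have [->|nuy] := eqVneq u y; first by rewrite (eq_sym y) (negPf nxy) addnC.
by have [->|nux] := eqVneq u x; rewrite // addnC.
Qed.

Lemma gsum_eq0 g v H : gsum (fun=> 1) v H = 0 -> gsum g v H = 0.
Proof.
elim: H => [|h H IH]; first by rewrite /gsum !big_nil.
rewrite !gsum_cons => /eqP; rewrite addn_eq0 => /andP[/eqP h0 /eqP/IH ->].
by move: h0; rewrite /contrib; case: ifP => // _; case: ifP.
Qed.

(** The truncated subtraction is exact, because [g v] is a summand of the sums at [x] and at [y]. *)
Lemma upd_gsum_cut g f H H' v x y a b : (forall u, f u = gsum g u H) ->
  perm_eq H [:: (mkp v x, a), (mkp v y, b) & H'] ->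
  gsum (fun=> 1) v H' = 0 -> v != x -> v != y -> x != y -> forall u,
  upd (upd (upd f v 0) x (upd f v 0 x - g v)) y
    (upd (upd f v 0) x (upd f v 0 x - g v) y - g v) u = gsum g u H'.
Proof.
move=> fE pH /gsum_eq0 g0 nvx nvy nxy u.
have E z : f z = contrib g z (mkp v x) + (contrib g z (mkp v y) + gsum g z H').
  by rewrite fE (perm_gsum _ _ pH) !gsum_cons.
have [nyv nxv nyx] : [/\ y != v, x != v & y != x] by split; rewrite eq_sym.
rewrite /upd (negPf nxv) (negPf nyx) (negPf nyv).
have [->|nuy] := eqVneq u y.
  by rewrite E !contrib_mkp // eqxx (negPf nyv) (negPf nyx) add0n addnC addnK.
have [->|nux] := eqVneq u x.
  by rewrite E !contrib_mkp // eqxx (negPf nxv) (negPf nxy) add0n addnC addnK.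
have [->|nuv] := eqVneq u v; first by rewrite g0.
by rewrite E !contrib_mkp // (negPf nux) (negPf nuv) (negPf nuy).
Qed.

Lemma add_sums_runs st H n x y c : tabs n st -> sums st H -> x != y -> x < n -> y < n ->
  ivar st v_x = x -> ivar st v_y = y ->
  runs add_sums st (mcost add_sums) (fun st' => sums st' ((mkp x y, c) :: H)).
Proof.
move=> tb sH nxy xn yn Ex Ey; apply: runs_straight => // u.
cbv delta [add_sums]; sx st; rewrite !Ex !Ey.
have [_ -> _ _] := tb x ltac:(lia); have [_ -> _ _] := tb y ltac:(lia); split.
- by apply: (@upd_gsum_add (fun=> 1)) => // z; case: (sH z).
- by apply: (@upd_gsum_add id) => // z; case: (sH z).
- by apply: (@upd_gsum_add (fun z => z * z)) => // z; case: (sH z).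
Qed.

Lemma idx_inj n u v x y : v < n -> y < n -> (u * n + v == x * n + y) = (u == x) && (v == y).
Proof.
move=> vn yn; apply/eqP/andP => [E|[/eqP -> /eqP -> //]].
have n0 : 0 < n by lia.
have := congr1 (divn^~ n) E; have := congr1 (modn^~ n) E; rewrite !modnMDl !modn_small //.
by rewrite !divnMDl // !divn_small // !addn0 => -> ->.
Qed.

Lemma put_mat_runs st (f : nat -> nat -> nat) n x y c : tabs n st ->
  (forall u v, u < n -> v < n -> iarr st a_mat (u * n + v) = f u v) ->
  x < n -> y < n -> ivar st v_x = x -> ivar st v_y = y -> ivar st v_c = c ->
  runs put_mat st (mcost put_mat) (fun st' => forall u v, u < n -> v < n ->
    iarr st' a_mat (u * n + v) = if mkp u v == mkp x y then c else f u v).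
Proof.
move=> tb mH xn yn Ex Ey Ec; apply: runs_straight => // u v un vn.
cbv delta [put_mat]; sx st; rewrite !Ex !Ey !Ec.
have [-> _ _ _] := tb x ltac:(lia); have [-> _ _ _] := tb y ltac:(lia).
rewrite /upd !idx_inj // mH // eq_mkp.
by case: (u == x) => /=; case: (v == y) => /=; rewrite ?andbF ?if_same //; case: ifP.
Qed.

End Memory.

(** * Loading the input graph *)

Section PhaseLoad.
Variable R : realDomainType.
Implicit Types (st : state R) (H : network).

Lemma tabs_frame c n st st' : frame c st st' ->
  all (fun a => a \notin iaw c) [:: a_row; a_sq; a_rt; a_hf] -> tabs n st -> tabs n st'.
Proof.
move=> [_ fa _ _] /and5P[h1 h2 h3 h4 _] tb i ile; have [t1 t2 t3 t4] := tb i ile.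
by split; rewrite fa.
Qed.

Lemma sums_frame c H st st' : frame c st st' ->
  all (fun a => a \notin iaw c) [:: a_deg; a_S1; a_S2] -> sums st H -> sums st' H.
Proof.
move=> [_ fa _ _] /and4P[h1 h2 h3 _] sm u; have [t1 t2 t3] := sm u.
by split; rewrite fa.
Qed.

Lemma mats_frame c n H st st' : frame c st st' -> a_mat \notin iaw c ->
  mats n st H -> mats n st' H.
Proof. by move=> [_ fa _ _] h mt u v un vn; rewrite fa // mt. Qed.

Variable G : tgraph.
Hypothesis Gs : simple_graph G.
Let n := nv G.
Let m := ne G.

Definition ends_loaded st :=
  forall e : 'I_m, iarr st a_end1 e = (ends e).1 /\ iarr st a_end2 e = (ends e).2.

Lemma load_runs st : ivar st v_m = m -> tabs n st -> ends_loaded st ->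
  (forall i, iarr st a_mat i = 0) -> (forall i, iarr st a_deg i = 0) ->
  (forall i, iarr st a_S1 i = 0) -> (forall i, iarr st a_S2 i = 0) ->
  runs phase_load st (mcost (CISet v_i (INum 0)) +
     (m * (mcost load_pre + (mcost add_sums + mcost put_mat) + tcost load_test).+1 +
       (tcost load_test).+1))
   (fun st' => sums st' (net0 G) /\ mats n st' (net0 G)).
Proof.
move=> Em tb ed z1 z2 z3 z4; apply: runs_seq; first exact: runs_run.
move=> st1 fr1 <-; set st1' := run _ _ in fr1 *.
(* Edges are prepended, so memory represents the reversed prefix; the order is immaterial for the
   sums, and for the matrix because keys are distinct. *)
pose I i st := [/\ ivar st v_i = i, ivar st v_m = m, tabs n st, ends_loaded st &
  let H := rev (take i (net0 G)) in sums st H /\ mats n st H].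
have I0 : I 0 st1'.
  split=> //.
  - rewrite take0 /=; split=> [u|u v un vn]; rewrite /st1'; sx st; last by rewrite z1.
    by rewrite z2 z3 z4 /gsum !big_nil.
have sz : size (net0 G) = m by rewrite size_map size_enum_ord.
have := @runs_for_const _ load_test (CSeq load_pre (CSeq add_sums put_mat)) I
  (mcost load_pre + (mcost add_sums + mcost put_mat)) 0 m st1'.
rewrite subn0 => h; apply: runs_weak (h _ _ _ I0) _ _ => // {h}.
- move=> i st2 /andP[_ im] [Hi Hm tb2 ed2 [sm mt]]; split.
    by rewrite /load_test /= Hi Hm; lia.
  pose e := Ordinal im; have [e1 e2] := ed2 e.
  have nxy : (ends e).1 != (ends e).2 :> nat by apply: ends_neq.
  have Hnext : rev (take i.+1 (net0 G)) =
      (mkp (ends e).1 (ends e).2, i.+1) :: rev (take i (net0 G)).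
    rewrite (take_nth ((0, 0), 0)) ?sz // rev_rcons; congr cons.
    rewrite (nth_map e) ?size_enum_ord //.
    by have -> : nth e (enum 'I_(ne G)) i = e by apply/val_inj; rewrite /= nth_enum_ord.
  apply: runs_seq; first exact: runs_run.
  move=> st3 fr3 E3.
  have [x3 y3 c3 i3] : [/\ ivar st3 v_x = (ends e).1, ivar st3 v_y = (ends e).2,
     ivar st3 v_c = i.+1 & ivar st3 v_i = i.+1].
    by rewrite -E3; cbv delta [load_pre]; sx st2; rewrite Hi -e1 -e2 addn1.
  have tb3 := tabs_frame fr3 isT tb2.
  have sm3 := sums_frame fr3 isT sm.
  have mt3 := mats_frame fr3 isT mt.
  apply: runs_seq; first exact: (add_sums_runs i.+1 tb3 sm3 nxy (ltn_ord _) (ltn_ord _) x3 y3).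
  move=> st4 fr4 sm4.
  have tb4 := tabs_frame fr4 isT tb3.
  have mt4 := mats_frame fr4 isT mt3.
  have x4 : ivar st4 v_x = (ends e).1 by rewrite (fr_ivar fr4).
  have y4 : ivar st4 v_y = (ends e).2 by rewrite (fr_ivar fr4).
  have c4 : ivar st4 v_c = i.+1 by rewrite (fr_ivar fr4).
  apply: runs_weak (put_mat_runs tb4 mt4 (ltn_ord _) (ltn_ord _) x4 y4 c4) _ _ => // st5 fr5 mt5.
  split.
  + by rewrite (fr_ivar fr5) // (fr_ivar fr4).
  + by rewrite (fr_ivar fr5) // (fr_ivar fr4) // (fr_ivar fr3).
  + exact: tabs_frame fr5 _ tb4.
  + move=> e'; have [<- <-] := ed2 e'.
    by rewrite !(fr_iarr fr5) // !(fr_iarr fr4) // !(fr_iarr fr3).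
  + rewrite Hnext; split; first exact: sums_frame fr5 _ sm4.
    by move=> u v un vn; rewrite mt5 //= eq_sym.
- by move=> st2 [Hi Hm _ _ _]; rewrite /load_test /= Hi Hm; lia.
- move=> st2 _ [_ _ _ _]; rewrite take_oversize ?sz // => -[sm mt]; split.
    by move=> u; have := sm u; rewrite !(perm_gsum _ _ (_ : perm_eq (rev _) (net0 G))) // perm_rev.
  move=> u v un vn; rewrite mt //; apply: perm_lk; rewrite ?perm_rev //.
  by rewrite /unzip1 map_rev rev_uniq; apply: net0_uniq.
Qed.
End PhaseLoad.

(** * Degree-two vertices and a single elimination *)

Lemma perm_swap2 (T : eqType) (a b : T) s : perm_eq [:: a, b & s] [:: b, a & s].
Proof. by rewrite -(cat1s a) -[b :: s]cat1s perm_catCA. Qed.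

Lemma gsum_two_gt (H : network) v : all (fun h => h.1.1 < h.1.2) H ->
  gsum (fun=> 1) v H = 2 -> uniq (unzip1 H) ->
  exists x y a b H', [/\ perm_eq H [:: (mkp v x, a), (mkp v y, b) & H'],
    [/\ v != x, v != y & y < x] & gsum (fun=> 1) v H' = 0].
Proof.
move=> al g2 U; have [x [y [a [b [H' [pH [nvx nvy nxy] g0]]]]]] := gsum_two al g2 U.
case: (ltngtP y x) nxy => // yx _; first by exists x, y, a, b, H'.
exists y, x, b, a, H'; split=> //; exact: perm_trans pH (perm_swap2 _ _ _).
Qed.

(** The degree counts network edges, adjacency counts neighbours; distinct keys make them agree.
    Extracting incident edges one at a time excludes degrees 0, 1 and at least 3. *)
Lemma two_nbrs_gsum (H : network) v : all (fun h => h.1.1 < h.1.2) H ->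
  uniq (unzip1 H) -> two_nbrs (hadj H) v -> gsum (fun=> 1) v H = 2.
Proof.
move=> al U [x [y [nxy nb]]].
case g: (gsum _ v H) => [|k].
  by have := gsum0_notin g x; have := nb x; rewrite /hadj eqxx => ->.
have [x1 [a1 [H1 [p1 n1 g1]]]] := gsum_pop al g.
have al1 : all (fun h => h.1.1 < h.1.2) H1 by move: al; rewrite (perm_all _ p1) => /andP[].
have U1 := U; rewrite (perm_uniq (perm_map fst p1)) /= in U1.
case: k g g1 => [|k] g g1.
  have E z : hadj H v z -> z = x1.
    rewrite (perm_hadj p1) /hadj /= inE (negPf (gsum0_notin g1 z)) orbF eq_mkp eqxx /=.
    by rewrite (negPf n1) orbF => /eqP.
  have := E x; have := E y; rewrite !nb !eqxx orbT => /(_ isT) Ey /(_ isT) Ex.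
  by move: nxy; rewrite Ex Ey eqxx.
have [x2 [a2 [H2 [p2 n2 g2]]]] := gsum_pop al1 g1.
case: k g g1 g2 => [|k] // g g1 g2.
have al2 : all (fun h => h.1.1 < h.1.2) H2 by move: al1; rewrite (perm_all _ p2) => /andP[].
have [x3 [a3 [H3 [p3 n3 g3]]]] := gsum_pop al2 g2.
have m2 : unzip1 H1 =i mkp v x2 :: unzip1 H2 by move=> z; rewrite (perm_mem (perm_map fst p2)).
have m3 : unzip1 H2 =i mkp v x3 :: unzip1 H3 by move=> z; rewrite (perm_mem (perm_map fst p3)).
have m1 : unzip1 H =i mkp v x1 :: unzip1 H1 by move=> z; rewrite (perm_mem (perm_map fst p1)).
move: U1 => /andP[]; rewrite m2 inE m3 inE !negb_or (perm_uniq (perm_map fst p2)) /= m3 inE negb_or.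
move=> /and3P[d12 d13 _] /andP[/andP[d23 _] _].
have h1 : hadj H v x1 by rewrite /hadj m1 mem_head.
have h2 : hadj H v x2 by rewrite /hadj m1 inE m2 mem_head orbT.
have h3 : hadj H v x3 by rewrite /hadj m1 inE m2 inE m3 mem_head !orbT.
have ne a b : mkp v a != mkp v b -> a != b by apply: contraNneq => ->.
move: h1 h2 h3 (ne _ _ d12) (ne _ _ d13) (ne _ _ d23); rewrite !nb; lia.
Qed.

Section PhaseReduce.
Variable R : realDomainType.
Implicit Types (st : state R) (H : network).
Variables (m K n s t : nat) (spec : {set 'I_m} -> Prop).
Hypothesis K_gt0 : 0 < K.

Definition consts st :=
  [/\ ivar st v_n = n, ivar st v_m = m, ivar st v_s = s, ivar st v_t = t & ivar st v_K = K].

Lemma consts_frame c st st' : frame c st st' ->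
  all (fun x => x \notin ivw c) [:: v_n; v_m; v_s; v_t; v_K] -> consts st -> consts st'.
Proof. by move=> [fi _ _ _] /and5P[h1 h2 h3 h4 /andP[h5 _]] [*]; split; rewrite fi. Qed.

Definition wnet_st st H tr N :=
  wnet spec K s t n H tr N (iarr st a_L) (iarr st a_R) (iarr st a_ty).

Lemma wnet_frame c st st' H tr N : frame c st st' ->
  all (fun a => a \notin iaw c) [:: a_L; a_R; a_ty] ->
  wnet_st st H tr N -> wnet_st st' H tr N.
Proof. by move=> [_ fa _ _] /and4P[h1 h2 h3 _]; rewrite /wnet_st !fa. Qed.

Lemma wnet_sorted H tr N L Rr ty : wnet spec K s t n H tr N L Rr ty ->
  all (fun h => h.1.1 < h.1.2) H.
Proof. by move=> /wn_edge; apply: sub_all => h /and4P[]. Qed.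

Definition netst st H tr N :=
  [/\ wnet_st st H tr N, uniq (unzip1 H), sums st H & mats n st H].

Lemma decode_runs st v x y : ivar st v_v = v -> tabs n st -> y < x -> x < n ->
  iarr st a_S1 v = x + y -> iarr st a_S2 v = x * x + y * y ->
  runs decode st (mcost decode) (fun st' => ivar st' v_x = x /\ ivar st' v_y = y).
Proof.
move=> Ev tb yx xn e1 e2; apply: runs_straight => //.
cbv delta [decode]; sx st; rewrite !Ev e1 e2.
have [_ -> _ _] := tb (x + y) ltac:(lia).
have -> : x * x + y * y + (x * x + y * y) - (x + y) * (x + y) = (x - y) * (x - y).
  have [k ->] : exists k, x = y + k by (exists (x - y); lia).
  rewrite addKn; set z := (y + k + y) * _.
  have -> : (y + k) * (y + k) + y * y + ((y + k) * (y + k) + y * y) = k * k + z by rewrite /z; nia.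
  by rewrite addnK.
have [_ _ -> _] := tb (x - y) ltac:(lia).
have -> : x + y + (x - y) = x + x by lia.
have [_ _ _ ->] := tb x ltac:(lia).
by split=> //; lia.
Qed.

(** At most two nodes are created, a series node and possibly a parallel one. Degrees change only at
    [v], [x] and [y], which is why the queue needs no entries other than [x] and [y]. *)
Definition elim_post H v x y st st' :=
  exists H2 tr2 N2, [/\ netst st' H2 tr2 N2, ivar st' v_N = N2, N2 <= ivar st v_N + 2,
    hadj H2 =2 eliminate (hadj H) v &
    forall u, u != v -> u != x -> u != y -> gsum (fun=> 1) u H2 = gsum (fun=> 1) u H].

Lemma elim_runs st H tr N v : tabs n st -> netst st H tr N -> ivar st v_N = N ->
  ivar st v_v = v -> iarr st a_deg v = 2 -> v < n -> v != s -> v != t ->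
  exists x y, [/\ x < n, y < n, two_nbrs (hadj H) v &
    runs elim_core st (mcost elim_core)
      (fun st' => [/\ ivar st' v_x = x, ivar st' v_y = y & elim_post H v x y st st'])].
Proof.
move=> tb [W U sm mt] EN Ev dv vn vs vt.
have srt := wnet_sorted W.
have g2 : gsum (fun=> 1) v H = 2 by have [<- _ _] := sm v.
have [x [y [a [b [H' [pH [nvx nvy yx] g0]]]]]] := gsum_two_gt srt g2 U.
have nv := gsum0_notin g0.
have nxy : x != y by rewrite gtn_eqF.
have := wn_edge (perm_wnet pH W) => /= /and3P[/and4P[_ xn a0 aN] /and4P[_ yn b0 bN] alH'].
have {}xn : x < n by move: xn; rewrite /mkp /=; lia.
have {}yn : y < n by move: yn; rewrite /mkp /=; lia.
exists x, y; split=> //; first by exists x, y; split=> // z; rewrite (hadj_two pH).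
have eS g : gsum g v H = g x + g y.
  by rewrite (perm_gsum _ _ pH) !gsum_cons (gsum_eq0 _ g0) !contrib_mkp // eqxx addn0.
have [_ S1v S2v] := sm v; rewrite eS in S1v; rewrite eS in S2v.
apply: runs_seq; first exact: (decode_runs Ev tb yx xn S1v S2v).
move=> st1 fr1 [x1 y1].
have v1 : ivar st1 v_v = v by rewrite (fr_ivar fr1).
have N1 : ivar st1 v_N = N by rewrite (fr_ivar fr1).
have tb1 := tabs_frame fr1 isT tb.
have W1 := wnet_frame fr1 isT W.
have sm1 := sums_frame fr1 isT sm.
have mt1 := mats_frame fr1 isT mt.
have pa : lk H (mkp v x) = a.
  by apply: (@lk_in H (mkp v x, a)) => //; rewrite (perm_mem pH) mem_head.
have pb : lk H (mkp v y) = b.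
  by apply: (@lk_in H (mkp v y, b)) => //; rewrite (perm_mem pH) inE mem_head orbT.
apply: runs_seq; first exact: runs_run.
move=> st2 fr2 E2.
pose tr2 := upd tr N (Ser (tr a) (tr b)).
have [c2 N2 W2] : [/\ ivar st2 v_c = N, ivar st2 v_N = N.+1 &
    wnet_st st2 ((mkp x y, N) :: H') tr2 N.+1].
  rewrite /wnet_st -E2; cbv delta [new_series]; sx st1; rewrite !N1 addn1; split=> //.
  rewrite v1 x1 y1; have [-> _ _ _] := tb1 v ltac:(lia); rewrite !mt1 // pa pb.
  exact: wnet_series W1 pH nv nvx nvy nxy vs vt.
have v2 : ivar st2 v_v = v by rewrite (fr_ivar fr2).
have x2 : ivar st2 v_x = x by rewrite (fr_ivar fr2).
have y2 : ivar st2 v_y = y by rewrite (fr_ivar fr2).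
have tb2 := tabs_frame fr2 isT tb1.
have sm2 := sums_frame fr2 isT sm1.
have mt2 := mats_frame fr2 isT mt1.
have U' : uniq (unzip1 H') by move: U; rewrite (perm_uniq (perm_map fst pH)) /= => /and3P[].
apply: runs_seq; first exact: runs_run.
move=> st3 fr3 E3.
have mt3 : mats n st3 H'.
  move=> p q pn qn; rewrite -E3; cbv delta [cut_mat]; sx st2; rewrite v2 x2 y2.
  have [-> _ _ _] := tb2 v ltac:(lia); have [-> _ _ _] := tb2 x ltac:(lia).
  have [-> _ _ _] := tb2 y ltac:(lia).
  rewrite /upd !idx_inj // mt2 // (perm_lk U pH) /= !eq_mkp.
  have lk0 z : lk H' (mkp v z) = 0 by apply: lk_notin.
  have [E|E] := boolP ((p == v) || (q == v)).
    have -> : lk H' (mkp p q) = 0 by case/orP: E => /eqP ->; rewrite ?lk0 // mkpC lk0.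
    case: ifP => // n1; case: ifP => // n2; case: ifP => // n3; case: ifP => // n4.
    case: ifP => [n5|n5]; first by exfalso; move: E n1 n2 n3 n4 n5; clear; lia.
    by case: ifP => // n6; exfalso; move: E n1 n2 n3 n4 n5 n6; clear; lia.
  move: E; rewrite negb_or => /andP[/negPf pv /negPf qv].
  by rewrite pv qv (eq_sym v p) (eq_sym v q) pv qv /= !andbF.
have [v3 x3 y3] : [/\ ivar st3 v_v = v, ivar st3 v_x = x & ivar st3 v_y = y].
  by rewrite !(fr_ivar fr3).
have [c3 N3] : ivar st3 v_c = N /\ ivar st3 v_N = N.+1 by rewrite !(fr_ivar fr3).
have tb3 := tabs_frame fr3 isT tb2.
have sm3 := sums_frame fr3 isT sm2.
have W3 := wnet_frame fr3 isT W2.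
apply: runs_seq; first exact: runs_run.
move=> st4 fr4 E4.
have sm4 : sums st4 H'.
  move=> u; rewrite -E4; cbv delta [cut_sums]; sx st3; rewrite v3 x3 y3.
  have [_ -> _ _] := tb3 v ltac:(lia); split.
  - by apply: (@upd_gsum_cut (fun=> 1) _ H _ _ _ _ a b) => // z; case: (sm3 z).
  - by apply: (@upd_gsum_cut id _ H _ _ _ _ a b) => // z; case: (sm3 z).
  - by apply: (@upd_gsum_cut (fun z => z * z) _ H _ _ _ _ a b) => // z; case: (sm3 z).
have [x4 y4 c4 N4] : [/\ ivar st4 v_x = x, ivar st4 v_y = y, ivar st4 v_c = N & ivar st4 v_N = N.+1].
  by rewrite !(fr_ivar fr4).
have tb4 := tabs_frame fr4 isT tb3.
have mt4 := mats_frame fr4 isT mt3.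
have W4 := wnet_frame fr4 isT W3.
have gH u : u != v -> u != x -> u != y -> gsum (fun=> 1) u H = gsum (fun=> 1) u H'.
  move=> /negPf uv /negPf ux /negPf uy; rewrite (perm_gsum _ _ pH) !gsum_cons.
  by rewrite !contrib_mkp // uv ux uy.
(* The situation between [join_edge] and [put_mat]: the network already has its edge with node [c],
   while the matrix still describes [H']; they can differ only at the key [mkp x y]. *)
pose mid st5 := exists H2 tr2 N2 c, [/\ wnet_st st5 ((mkp x y, c) :: H2) tr2 N2 /\
    uniq (unzip1 ((mkp x y, c) :: H2)), sums st5 ((mkp x y, c) :: H2),
    (forall p, p != mkp x y -> lk H' p = lk H2 p),
    [/\ ivar st5 v_c = c, ivar st5 v_N = N2, N2 <= N + 2 &
    hadj ((mkp x y, c) :: H2) =2 eliminate (hadj H) v] &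
    forall u, u != x -> u != y -> gsum (fun=> 1) u H2 = gsum (fun=> 1) u H'].
have [rxE _ _ _] := tb4 x ltac:(lia).
have he c := hadj_eliminate c pH nv nvx nvy nxy.
have al1 : all (fun h => 0 < h.2) H' by apply: sub_all alH' => h /and4P[].
apply: (@runs_seq _ _ _ _ _ _ mid).
  apply: runs_if; rewrite /= x4 y4 rxE mt4 // => lk0.
    have nk : mkp x y \notin unzip1 H'.
      by rewrite -(lk_gt0 _ al1) (eqP lk0).
    apply: runs_weak (add_sums_runs N tb4 sm4 nxy xn yn x4 y4) _ _ => // st5 fr5 sm5.
    exists H', tr2, N.+1, N; split=> //.
    - by split; [apply: wnet_frame fr5 _ W4|rewrite /= nk].
    - by rewrite !(fr_ivar fr5) //; split=> //; lia.
  have ik : mkp x y \in unzip1 H' by rewrite -(lk_gt0 _ al1) lt0n.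
  have /mapP[[k3 a3] h3 /= k3E] := ik.
  have p3 := perm_to_rem h3; set H'' := rem _ H' in p3.
  rewrite -k3E in p3.
  have la3 : lk H' (mkp x y) = a3.
    by apply: (@lk_in H' (mkp x y, a3)) => //; rewrite k3E.
  have U3 := U'; rewrite (perm_uniq (perm_map fst p3)) /= in U3.
  apply: runs_weak (runs_run _ _) _ _ => // st5 fr5 E5.
  exists H'', (upd tr2 N.+1 (Par (tr2 a3) (tr2 N))), N.+2, N.+1; split.
  - split=> //; rewrite /wnet_st -E5; cbv delta [new_parallel]; sx st4.
    rewrite !N4 !x4 !y4 rxE mt4 // la3 c4.
    apply: wnet_merge W4 _ => //.
    apply: perm_trans (perm_swap2 _ _ _); by rewrite perm_cons.
  - move=> u; have [s1 s2 s3] := sums_frame fr5 isT sm4 u.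
    by rewrite s1 s2 s3 !(perm_gsum _ _ p3) !gsum_cons.
  - by move=> p pk; rewrite (perm_lk U' p3) /= eq_sym (negPf pk).
  - rewrite -E5; cbv delta [new_parallel]; sx st4; rewrite N4 addn1; split=> //; first by lia.
    move=> p q; rewrite -(he N) /hadj /= !inE (perm_mem (perm_map fst p3)) /= inE.
    by case: (_ == _).
  - move=> u /negPf ux /negPf uy; rewrite (perm_gsum _ _ p3) gsum_cons contrib_mkp //.
    by rewrite ux uy.
move=> st5 fr5 [H2 [tr5 [N5 [c [[W5 U5] sm5 lk5 [c5 N5E N5le ha5] g5]]]]].
have [x5 y5] : ivar st5 v_x = x /\ ivar st5 v_y = y by rewrite !(fr_ivar fr5).
have tb5 := tabs_frame fr5 isT tb4.
have mt5 := mats_frame fr5 isT mt4.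
apply: runs_weak (put_mat_runs tb5 mt5 xn yn x5 y5 c5) _ _ => // st6 fr6 mt6.
rewrite !(fr_ivar fr6) //; split=> //.
exists ((mkp x y, c) :: H2), tr5, N5; split=> //.
- split=> //.
  + exact: wnet_frame fr6 _ W5.
  + exact: sums_frame fr6 _ sm5.
  + move=> p q pn qn; rewrite mt6 //= eq_sym; case: eqP => // /eqP nk.
    by apply: lk5; rewrite eq_sym.
- by rewrite (fr_ivar fr6).
- by rewrite EN.
- move=> u uv ux uy; rewrite gsum_cons contrib_mkp // (negPf ux) (negPf uy) g5 //.
  by rewrite gH.
Qed.
End PhaseReduce.

Lemma net_single (H : network) s t : all (fun h => h.1.1 < h.1.2) H -> uniq (unzip1 H) ->
  hadj H =2 pair_rel s t -> exists r, H = [:: (mkp s t, r)].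
Proof.
move=> /allP al U ha.
have key h : h \in H -> h.1 = mkp s t.
  move=> hH; have lt := al _ hH.
  have E : h.1 = mkp h.1.1 h.1.2 by case: h hH lt => [[p q] i] /= _ lt; rewrite /mkp; congr pair; lia.
  have := ha h.1.1 h.1.2; rewrite /hadj -E map_f // => /esym.
  rewrite /pair_rel => /orP[] /andP[/eqP e1 /eqP e2]; rewrite E e1 e2 //; exact: mkpC.
case: H U ha key {al} => [|h [|h' H]] U ha key.
- by have := ha s t; rewrite /pair_rel !eqxx /hadj.
- by exists h.2; rewrite -(key h) ?mem_head // -surjective_pairing.
- by move: U; rewrite /= (key h) ?mem_head // (key h') ?inE ?eqxx ?orbT.
Qed.

(** * The elimination queue and its running time *)

Section ReduceLoop.
Variable R : realDomainType.
Implicit Types (st : state R) (H : network).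
Variables (m K n s t : nat) (spec : {set 'I_m} -> Prop).
Hypotheses (K_gt0 : 0 < K) (nst : s != t).

Definition in_queue st v := exists2 i, ivar st v_qh <= i < ivar st v_qt & iarr st a_Q i = v.

Let cost := (mcost reduce_body + tcost reduce_test).+1.

(** Every vertex of [l] that has degree two waits in the queue. In the credit, each vertex of [l]
    holds three rounds, enough for the two entries pushed at its elimination; with [n] initial
    entries this gives [4 * n] rounds. Likewise [N + 2 * size l] bounds the number of nodes. *)
Definition reduce_inv cr st := exists H tr N l,
  [/\ tabs n st /\ consts m K n s t st, netst K n s t spec st H tr N,
      ivar st v_N = N /\ N + 2 * size l <= m.+1 + 2 * n,
      reduces (hadj H) l (pair_rel s t) /\ (forall v, v \in l -> [/\ v < n, v != s & v != t]) &
  [/\ (forall i, ivar st v_qh <= i < ivar st v_qt -> iarr st a_Q i < n),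
      (forall v, v \in l -> gsum (fun=> 1) v H = 2 -> in_queue st v) &
      (ivar st v_qt - ivar st v_qh + 3 * size l) * cost + (tcost reduce_test).+1 <= cr]].

Lemma reduce_step cr st : reduce_inv cr st -> teval st reduce_test ->
  exists B, B + tcost reduce_test < cr /\
    runs reduce_body st B (reduce_inv (cr - (B + tcost reduce_test).+1)).
Proof.
move=> [H [tr [N [l [[tb cs] nt [EN Nle] [red lP] [Qn Qin crle]]]]]] tst.
have {}tst : ivar st v_qh < ivar st v_qt by move: tst; rewrite /= addn1.
set qh := ivar st v_qh in Qn tst crle; set qt := ivar st v_qt in Qn tst crle.
exists (mcost reduce_body); split.
  move: crle; rewrite (_ : qt - qh + _ = (qt - qh.+1 + 3 * size l).+1); last by lia.
  by rewrite mulSn; move: (_ * cost); rewrite /cost => p; lia.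
pose v := iarr st a_Q qh.
have vn : v < n by apply: Qn; rewrite leqnn.
apply: runs_seq; first exact: runs_run.
move=> st1 fr1 E1.
have [v1 qh1] : ivar st1 v_v = v /\ ivar st1 v_qh = qh.+1.
  by rewrite -E1; cbv delta [reduce_pop]; sx st; rewrite addn1.
have qt1 : ivar st1 v_qt = qt by rewrite (fr_ivar fr1).
have cs1 := consts_frame fr1 isT cs.
have tb1 := tabs_frame fr1 isT tb.
have nt1 : netst K n s t spec st1 H tr N.
  case: nt => h1 h2 h3 h4; split=> //.
  - exact: wnet_frame fr1 _ h1.
  - exact: sums_frame fr1 _ h3.
  - exact: mats_frame fr1 _ h4.
have N1 : ivar st1 v_N = N by rewrite (fr_ivar fr1).
have Q1 : iarr st1 a_Q = iarr st a_Q by rewrite (fr_iarr fr1).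
have [Wn Un sm1 _] := nt1.
have sg := hadj_sgraph (wnet_sorted Wn).
have degE : iarr st1 a_deg v = gsum (fun=> 1) v H by have [] := sm1 v.
have tE : teval st1 elim_test = [&& gsum (fun=> 1) v H == 2, v != s & v != t].
  have [_ _ sE' tE' _] := cs1; by rewrite /elim_test /= v1 degE sE' tE'.
apply: runs_if; rewrite tE; last first.
  move=> tF; apply: runs_straight => //.
  change (run CSkip st1) with st1.
  exists H, tr, N, l; split=> //; rewrite qh1 qt1 Q1; split.
  - by move=> i ih; apply: Qn; lia.
  - move=> u ul u2; have [i ih iu] := Qin u ul u2; rewrite /in_queue qh1 qt1 Q1.
    (* The removed vertex failed the test, so it is not one of those required to be in the queue. *)
    exists i => //; suff : i != qh by lia.
    apply: contraNneq tF => iq; have [_ us ut] := lP u ul.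
    by rewrite /v -iq iu u2 us ut.
  - move: crle; rewrite (_ : qt - qh + _ = (qt - qh.+1 + 3 * size l).+1); last by lia.
    by rewrite mulSn; move: (_ * cost); rewrite /cost => p; lia.
case/and3P=> /eqP g2 vs vt.
have [x [y [xn yn tn rn]]] := elim_runs K_gt0 tb1 nt1 N1 v1 (etrans degE g2) vn vs vt.
have [x0 [y0 [_ nb]]] := tn.
(* A non-terminal vertex with an edge is in the list, so local confluence allows it to be eliminated
   now. *)
have vl : v \in l.
  have := reduces_mem (u := v) (a := x0) sg red; rewrite nb eqxx => /(_ isT).
  by rewrite (negPf vs) (negPf vt).
have [l' pl red'] := reduces_any sg red vl tn.
apply: runs_seq; first exact: rn.
move=> st2 fr2 [x2 y2 [H2 [tr2 [N2 [nt2 EN2 N2le ha2 g2u]]]]].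
have [qh2 qt2] : ivar st2 v_qh = qh.+1 /\ ivar st2 v_qt = qt by rewrite !(fr_ivar fr2).
have Q2 : iarr st2 a_Q = iarr st a_Q by rewrite (fr_iarr fr2).
apply: runs_weak (runs_run _ _) _ _ => // st3 fr3 E3.
have [qh3 qt3] : ivar st3 v_qh = qh.+1 /\ ivar st3 v_qt = qt.+2.
  by rewrite (fr_ivar fr3) // qh2 -E3; cbv delta [push]; sx st2; rewrite qt2 addn2.
have Q3 : iarr st3 a_Q = upd (upd (iarr st a_Q) qt x) qt.+1 y.
  by rewrite -E3; cbv delta [push]; sx st2; rewrite qt2 x2 y2 Q2 addn1.
have szl : size l = (size l').+1 by rewrite (perm_size pl).
exists H2, tr2, N2, l'; split.
- by split; [exact: tabs_frame fr3 _ (tabs_frame fr2 _ tb1)|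
    exact: consts_frame fr3 _ (consts_frame fr2 _ cs1)].
- case: nt2 => h1 h2 h3 h4; split=> //.
  + exact: wnet_frame fr3 _ h1.
  + exact: sums_frame fr3 _ h3.
  + exact: mats_frame fr3 _ h4.
- by rewrite (fr_ivar fr3); split=> //; move: N2le Nle; rewrite N1 szl; lia.
- split; first by apply: eq_reduces red' => a b; rewrite ha2.
  by move=> u ul; apply: lP; rewrite (perm_mem pl) inE ul orbT.
- rewrite /in_queue qh3 qt3 Q3; split.
  + move=> i ih; rewrite /upd; case: eqP => // n1; case: eqP => // n2; apply: Qn; lia.
  + move=> u ul u2.
    have ulo : u \in l by rewrite (perm_mem pl) inE ul orbT.
    have uv : u != v.
      have := reduces_uniq sg red; rewrite (perm_uniq pl) /= => /andP[nv _].
      by apply: contraNneq nv => <-.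
    have [->|ux] := eqVneq u x.
      by exists qt; [lia|rewrite /upd eqxx ltn_eqF].
    have [->|uy] := eqVneq u y; first by exists qt.+1; [lia|rewrite /upd eqxx].
    have [|i ih iu] := Qin u ulo; first by rewrite -g2u.
    exists i; last by rewrite /upd !ltn_eqF //; move: ih; rewrite -/qt; lia.
    have : i != qh by apply: contraNneq uv => iq; rewrite -iu iq.
    by move: ih; rewrite -/qh -/qt; lia.
  + move: crle; rewrite szl (_ : qt - qh + _ = (qt.+2 - qh.+1 + 3 * size l').+2); last by lia.
    by rewrite !mulSn; move: (_ * cost); rewrite /cost => p; lia.
Qed.

Lemma reduce_runs st H tr l : tabs n st -> consts m K n s t st ->
  ivar st v_qh = 0 -> (forall i, i < n -> iarr st a_Q i = i) ->
  netst K n s t spec st H tr m.+1 -> size l <= n ->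
  reduces (hadj H) l (pair_rel s t) -> (forall v, v \in l -> [/\ v < n, v != s & v != t]) ->
  s < n -> t < n ->
  runs phase_reduce st (mcost (CSeq (CISet v_N (IAdd (IVar v_m) (INum 1))) (CISet v_qt (IVar v_n)))
     + (4 * n * cost + (tcost reduce_test).+1))
   (fun st' => exists tr N r, [/\ wnet_st K n s t spec st' [:: (mkp s t, r)] tr N,
      ivar st' v_N = N, N <= m.+1 + 2 * n & iarr st' a_mat (s * n + t) = r]).
Proof.
move=> tb cs q0 Q0 nt sl red lP sn tn'.
apply: runs_seq; first exact: runs_run.
move=> st1 fr1 E1; have [En Em _ _ _] := cs.
have [N1 qt1] : ivar st1 v_N = m.+1 /\ ivar st1 v_qt = n.
  by rewrite -E1; sx st; rewrite En Em addn1.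
have qh1 : ivar st1 v_qh = 0 by rewrite (fr_ivar fr1).
have Q1 : iarr st1 a_Q = iarr st a_Q by rewrite (fr_iarr fr1).
have I0 : reduce_inv (4 * n * cost + (tcost reduce_test).+1) st1.
  exists H, tr, m.+1, l; split=> //.
  - by split; [exact: tabs_frame fr1 _ tb|exact: consts_frame fr1 _ cs].
  - case: nt => h1 h2 h3 h4; split=> //.
    + exact: wnet_frame fr1 _ h1.
    + exact: sums_frame fr1 _ h3.
    + exact: mats_frame fr1 _ h4.
  - by split=> //; lia.
  - rewrite /in_queue qh1 qt1 Q1; split.
    + by move=> i /andP[_ ilt]; rewrite Q0.
    + by move=> v /lP[vn _ _] _; exists v; rewrite ?Q0.
    + by rewrite leq_add2r leq_mul2r; apply/orP; right; lia.
apply: runs_weak (@runs_while _ _ _ reduce_inv st1 _ _ reduce_step I0) _ _ => //.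
  by move=> cr st2 [? [? [? [? [_ _ _ _ [_ _ h]]]]]]; apply: leq_trans h; apply: leq_addl.
move=> st2 fr2 [nte [cr [H2 [tr2 [N2 [l2 [_ [W U sm mt] [EN2 N2le] [red2 lP2] [_ Qin _]]]]]]]].
(* The head of a nonempty [l2] would have degree two, and the invariant would put it in the queue,
   which is empty. *)
have l0 : l2 = [::].
  case: l2 red2 lP2 Qin {N2le} => // v l2 red2 lP2 Qin; exfalso.
  have tv : two_nbrs (hadj H2) v by inversion red2.
  have g2 := two_nbrs_gsum (wnet_sorted W) U tv.
  have [i] := Qin v (mem_head _ _) g2.
  by move: nte; rewrite /= addn1; lia.
have ha : hadj H2 =2 pair_rel s t by move: red2; rewrite l0 => r2; inversion r2.
have [r HE] := net_single (wnet_sorted W) U ha.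
exists tr2, N2, r; rewrite -HE; split=> //; first by move: N2le; rewrite l0 /=; lia.
by rewrite mt // HE /= eqxx.
Qed.
End ReduceLoop.

(** * Filling the tables of the dynamic program *)

Section Cells.
Variable R : realDomainType.
Implicit Types (st : state R) (fp fq : nat -> cell R).

Definition at_base st base c f := forall a, a <= c ->
  iarr st a_bad (base + a) = cbad (f a) /\ warr st w_val (base + a) = cval (f a) :> R.

Definition best st (c : cell R) :=
  [/\ ivar st v_bad = cbad c, wvar st 0 = cval c, ivar st v_da = cda c & ivar st v_db = cdb c].

Definition child_vars st bp bq cp cq j :=
  [/\ ivar st v_bp = bp, ivar st v_bq = bq, ivar st v_cp = cp, ivar st v_cq = cq & ivar st v_j = j].

Lemma child_vars_frame c st st' bp bq cp cq j : frame c st st' ->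
  all (fun x => x \notin ivw c) [:: v_bp; v_bq; v_cp; v_cq; v_j] ->
  child_vars st bp bq cp cq j -> child_vars st' bp bq cp cq j.
Proof. by move=> [fi _ _ _] /and5P[h1 h2 h3 h4 /andP[h5 _]] [*]; split; rewrite fi. Qed.

Lemma at_base_frame c st st' base cp f : frame c st st' ->
  (a_bad \notin iaw c) && (w_val \notin waw c) -> at_base st base cp f -> at_base st' base cp f.
Proof. by move=> [_ fi _ fw] /andP[h1 h2] ab a ac; rewrite fi // fw //; apply: ab. Qed.

Variables (bp bq cp cq j : nat) (fp fq : nat -> cell R).

Lemma ser_cell_runs st : child_vars st bp bq cp cq j -> at_base st bp cp fp ->
  at_base st bq cq fq ->
  runs ser_cell st (mcost ser_cell) (fun st' => let x := minn j cp in let y := minn j cq in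
    best st' (Cell (cbad (fp x) + cbad (fq y)) (cval (fp x) + cval (fq y))%R x y)).
Proof.
move=> [h1 h2 h3 h4 h5] ap aq; apply: runs_straight => //=.
rewrite /best; cbv delta [ser_cell cand_bad cand_val imin]; sx st.
rewrite h1 h2 h3 h4 h5 -!minnE.
have [-> ->] := ap (minn j cp) (geq_minr _ _).
by have [-> ->] := aq (minn j cq) (geq_minr _ _).
Qed.

Definition par_cost := mcost par_init +
  (cp * (mcost par_body + tcost par_test).+1 + (tcost par_test).+1).

Lemma par_cell_runs st : child_vars st bp bq cp cq j -> at_base st bp cp fp ->
  at_base st bq cq fq ->
  runs par_cell st par_cost (fun st' => best st' (conv cp cq fp fq j)).
Proof.
move=> cv ap aq; apply: runs_seq; first exact: runs_run.
move=> st1 fr1 E1.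
have cv1 := child_vars_frame fr1 isT cv.
have ap1 := at_base_frame fr1 isT ap.
have aq1 := at_base_frame fr1 isT aq.
pose c0 := Cell (cbad (fp cp)) (cval (fp cp)) cp 0.
pose I i st := [/\ child_vars st bp bq cp cq j, at_base st bp cp fp, at_base st bq cq fq,
  ivar st v_a = i & best st (foldl (conv_step cq fp fq j) c0 (iota 0 i))].
have I0 : I 0 st1.
  split=> //; first by rewrite -E1.
  have [h1 h2 h3 h4 h5] := cv; rewrite -E1 /best; cbv delta [par_init]; sx st.
  by rewrite h1 h3 /=; have [-> ->] := ap cp (leqnn _).
have := @runs_for_const _ par_test par_body I (mcost par_body) 0 (minn cp j.+1) st1.
rewrite subn0 => h; apply: runs_weak (h _ _ _ I0) _ _ => // {h}.
- move=> i st2 /andP[_ ilt] [cv2 ap2 aq2 ai [b1 b2 b3 b4]].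
  have [h1 h2 h3 h4 h5] := cv2; split.
    by rewrite /par_test /= ai h3 h5; lia.
  apply: runs_weak (runs_run _ _) _ _ => // st3 fr3 E3.
  split.
  + exact: child_vars_frame fr3 _ cv2.
  + exact: at_base_frame fr3 _ ap2.
  + exact: at_base_frame fr3 _ aq2.
  + rewrite -E3; cbv delta [par_body cand_bad cand_val imin]; sx st2.
    by rewrite ai if_same addn1.
  + rewrite -addn1 iotaD add0n foldl_cat /=; set c := foldl _ _ _ in b1 b2 b3 b4 *.
    rewrite -E3 /best; cbv delta [par_body cand_bad cand_val imin]; sx st2.
    rewrite ai h1 h2 h4 h5 -!minnE b1 b2 b3 b4 /conv_step.
    have [-> ->] := ap2 i ltac:(lia).
    have [-> ->] := aq2 (minn (j - i) cq) (geq_minr _ _).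
    by case: ifP.
- by move=> st2 [[h1 h2 h3 h4 h5] _ _ ai _]; rewrite /par_test /= ai h3 h5; lia.
- by rewrite leq_add2r leq_mul2r geq_minl orbT.
- by move=> st2 _ [].
Qed.

End Cells.

Section PhaseTables.
Variable R : realDomainType.
Implicit Types (st : state R).
Variables (m K : nat) (w : 'I_m -> R) (M : {set 'I_m}) (tr : nat -> tree 'I_m) (N : nat).
Hypotheses (K_gt0 : 0 < K) (tr_leaf : forall e : 'I_m, tr e.+1 = Leaf e).
Let D := K.+2.
Notation tcap i := (cap K (tr i)).
Notation tdp i := (dp w M K (tr i)).

Definition celltab st i j :=
  [/\ iarr st a_bad (i * D + j) = cbad (tdp i j), warr st w_val (i * D + j) = cval (tdp i j),
      iarr st a_da (i * D + j) = cda (tdp i j) & iarr st a_db (i * D + j) = cdb (tdp i j)].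

Definition nodetab st i := [/\ iarr st a_base i = i * D, iarr st a_cap i = tcap i &
  forall j, j <= tcap i -> celltab st i j].

(** Untouched memory beyond the current block makes the entry for demand 0 of a new block equal to
    [cell0] without a write. *)
Definition fresh st B := forall x, B <= x -> [/\ iarr st a_bad x = 0, warr st w_val x = 0%R,
  iarr st a_da x = 0 & iarr st a_db x = 0].

Definition inputs st := forall e : 'I_m,
  warr st w_w e = w e /\ iarr st a_M e = (e \in M : nat).

Lemma tcap_lt i : tcap i < D.
Proof. by rewrite /D /cap; lia. Qed.

Lemma idx_lt i i' j : i' < i -> j < D -> i' * D + j < i * D.
Proof.
move=> ii jD; apply: leq_trans (_ : i'.+1 * D <= _); last by rewrite leq_mul2r ii orbT.
by rewrite mulSn addnC ltn_add2r.
Qed.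

(* The tables of the nodes below i occupy the cells below [i * D]. *)
Lemma nodetab_below st st' i i' : i' < i ->
  (forall x, x < i * D -> [/\ iarr st' a_bad x = iarr st a_bad x,
     warr st' w_val x = warr st w_val x, iarr st' a_da x = iarr st a_da x &
     iarr st' a_db x = iarr st a_db x]) ->
  iarr st' a_base i' = iarr st a_base i' -> iarr st' a_cap i' = iarr st a_cap i' ->
  nodetab st i' -> nodetab st' i'.
Proof.
move=> ii eqx eb ec [n1 n2 n3]; split; rewrite ?eb ?ec // => j jc.
have [h1 h2 h3 h4] := eqx (i' * D + j) (idx_lt ii (leq_ltn_trans jc (tcap_lt i'))).
by have [*] := n3 j jc; split; rewrite ?h1 ?h2 ?h3 ?h4.
Qed.

Let leaf_inv i st := [/\ [/\ ivar st v_i = i, ivar st v_B = i * D, ivar st v_D = D,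
   ivar st v_K = K & ivar st v_m = m], inputs st, fresh st (i * D) &
   forall i', 0 < i' < i -> nodetab st i'].

Lemma leaf_runs st : ivar st v_K = K -> ivar st v_m = m -> inputs st -> fresh st 0 ->
  runs phase_leaf st (mcost (CSeq (CISet v_D (IAdd (IVar v_K) (INum 2)))
      (CSeq (CISet v_B (IVar v_D)) (CISet v_i (INum 1)))) +
      (m * (mcost leaf_body + tcost leaf_test).+1 + (tcost leaf_test).+1))
   (leaf_inv m.+1).
Proof.
move=> EK Em inp fs; apply: runs_seq; first exact: runs_run.
move=> st1 fr1 E1.
have I0 : leaf_inv 1 st1.
  split.
  - by rewrite -E1; sx st; rewrite EK Em addn2 mul1n.
  - by move=> e; rewrite (fr_warr fr1) // (fr_iarr fr1).
  - by move=> x _; have := fs x (leq0n _); rewrite -E1.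
  - by move=> i'; lia.
have := @runs_for_const _ leaf_test leaf_body leaf_inv (mcost leaf_body) 1 m.+1 st1.
rewrite subn1 /= => h; apply: h I0 => // [i st2 /andP[i0 im] [[Ei EB ED EK2 Em2] inp2 fs2 nt2]|st2 [[Ei _ _ _ Em2] _ _ _]]; last first.
  by rewrite /leaf_test /= Ei Em2; lia.
split; first by rewrite /leaf_test /= Ei Em2; lia.
have i1m : i.-1 < m by lia.
pose e := Ordinal i1m; have [we Me] := inp2 e.
have trE : tr i = Leaf e by rewrite -(tr_leaf e) /=; congr tr; lia.
apply: runs_weak (runs_run _ _) _ _ => // st3 fr3 E3.
have [c3 b3] : iarr st3 a_cap = upd (iarr st2 a_cap) i (minn K 2) /\
    iarr st3 a_base = upd (iarr st2 a_base) i (i * D).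
  by rewrite -E3; cbv delta [leaf_body imin]; sx st2; rewrite -minnE Ei EB EK2.
have v3 : warr st3 w_val = upd (upd (warr st2 w_val) (i * D + 1) (w e)) (i * D + 2) (w e).
  by rewrite -E3; cbv delta [leaf_body imin]; sx st2; rewrite Ei EB subn1 we.
have d3 : iarr st3 a_bad = upd (iarr st2 a_bad) (i * D + 2) (e \in M).
  by rewrite -E3; cbv delta [leaf_body imin]; sx st2; rewrite Ei EB subn1 Me.
have [a3 a3'] : iarr st3 a_da = iarr st2 a_da /\ iarr st3 a_db = iarr st2 a_db.
  by rewrite !(fr_iarr fr3).
split.
- rewrite -E3; cbv delta [leaf_body imin]; sx st2; rewrite Ei EB ED addn1 mulSn addnC EK2 Em2.
  by split.
- by move=> e'; rewrite (fr_warr fr3) // (fr_iarr fr3).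
- move=> x xge; have xD : i * D + D <= x by move: xge; rewrite mulSn addnC.
  have [h1 h2 h3 h4] := fs2 x ltac:(lia).
  by rewrite v3 d3 a3 a3' !upd_neq //; move: xD; rewrite /D; lia.
- move=> i' /andP[i0' ii]; have [->|ni] := eqVneq i' i; last first.
    have {}ii : i' < i by lia.
    apply: (nodetab_below ii) (nt2 i' _) => [x xlt| | |]; rewrite ?c3 ?b3 ?upd_neq //; last by rewrite i0'.
    by rewrite v3 d3 a3 a3' !upd_neq //; lia.
  rewrite /nodetab c3 b3 !updE trE; split=> // j; rewrite /cap /= => jc.
  have [h1 h2 h3 h4] := fs2 (i * D + j) ltac:(lia).
  rewrite /celltab v3 d3 a3 a3' trE h3 h4.
  have : (j == 0) || (j == 1) || (j == 2) by lia.
  case/orP => [/orP[]|] /eqP jE; rewrite jE /= in h1 h2 *.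
  + by rewrite !upd_neq ?eqn_add2l.
  + by split=> //; rewrite upd_neq ?updE ?eqn_add2l.
  + by rewrite !updE.
Qed.

Definition kids_ok st i := [/\ 0 < iarr st a_L i < i, 0 < iarr st a_R i < i,
  tr (iarr st a_L i) = (kids K (tr i)).1 & tr (iarr st a_R i) = (kids K (tr i)).2].

(** Processed inner nodes satisfy [kids_ok], later ones still [node_ok], because [node_pre] sorts
    the children of a node only when the node is reached. *)
Definition node_inv i st := [/\ [/\ ivar st v_i = i, ivar st v_B = i * D, ivar st v_D = D,
   ivar st v_K = K & ivar st v_N = N], fresh st (i * D),
   (forall i', 0 < i' < i -> nodetab st i'),
   (forall i', m < i' < i -> kids_ok st i') &
   (forall i', i <= i' < N -> node_ok tr (iarr st a_L) (iarr st a_R) (iarr st a_ty) i')].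

Let kp i := (kids K (tr i)).1.
Let kq i := (kids K (tr i)).2.

Lemma node_pre_runs i st : node_inv i st -> m < i < N ->
  runs node_pre st (mcost node_pre) (fun st' =>
    let p := iarr st' a_L i in let q := iarr st' a_R i in
    [/\ kids_ok st' i, child_vars st' (p * D) (q * D) (cap K (kp i)) (cap K (kq i)) 1,
      ivar st' v_c = tcap i,
      [/\ iarr st' a_base = upd (iarr st a_base) i (i * D) &
          iarr st' a_cap = upd (iarr st a_cap) i (tcap i)] &
      forall i', i' != i -> iarr st' a_L i' = iarr st a_L i' /\ iarr st' a_R i' = iarr st a_R i']).
Proof.
move=> [[Ei EB ED EK EN] fs nt ko no] im.
have [l1 r1 _ trE] := no i ltac:(lia).
set l := iarr st a_L i in l1 trE; set r := iarr st a_R i in r1 trE.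
have [bl cl _] := nt l l1; have [br cr _] := nt r r1.
pose sw := (iarr st a_ty i != 0) && ~~ (tcap l <= tcap r).
have kE : kids K (tr i) = if sw then (tr r, tr l) else (tr l, tr r).
  by rewrite trE /sw; case: eqP => //= _; case: leqP.
apply: runs_weak (runs_run _ _) _ _ => // st1 fr1 E1.
pose p := if sw then r else l; pose q := if sw then l else r.
have [pE qE] : iarr st1 a_L = upd (iarr st a_L) i p /\ iarr st1 a_R = upd (iarr st a_R) i q.
  rewrite -E1; cbv delta [node_pre imin]; sx st; rewrite Ei -/l -/r cl cr /p /q /sw.
  by case: (_ == 0); case: (_ <= _).
have kp' : kp i = tr p by rewrite /kp kE /p; case: (sw).
have kq' : kq i = tr q by rewrite /kq kE /q; case: (sw).
have pl : 0 < p < i by rewrite /p; case: (sw).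
have ql : 0 < q < i by rewrite /q; case: (sw).
have cpE : iarr st a_cap p = tcap p by rewrite /p; case: (sw).
have cqE : iarr st a_cap q = tcap q by rewrite /q; case: (sw).
have bpE : iarr st a_base p = p * D by rewrite /p; case: (sw).
have bqE : iarr st a_base q = q * D by rewrite /q; case: (sw).
have capE : minn (tcap p + tcap q) K = tcap i.
  have lc : leafcount (tr i) = leafcount (tr p) + leafcount (tr q).
    rewrite trE /p /q; case: (sw); case: ifP => /= _; lia.
  by rewrite /cap lc; move: (leafcount _) (leafcount _) => a b; clear; lia.
have [np nq] : (p == i) = false /\ (q == i) = false by lia.
have ifE (T : Type) (f : nat -> T) : (if iarr st a_ty i == 0 then f l else
    if tcap l <= tcap r then f l else f r) = f p.
  by rewrite /p /sw; case: (_ == 0) => //=; case: (_ <= _).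
have ifE' (T : Type) (f : nat -> T) : (if iarr st a_ty i == 0 then f r else
    if tcap l <= tcap r then f r else f l) = f q.
  by rewrite /q /sw; case: (_ == 0) => //=; case: (_ <= _).
rewrite pE qE !updE; split.
- by rewrite /kids_ok pE qE !updE pl ql kE /p /q; case: (sw).
- rewrite kp' kq' /child_vars -E1; cbv delta [node_pre imin]; sx st.
  rewrite !Ei -/l -/r !cl !cr !if_same (ifE _ id) (ifE' _ id) cpE cqE.
  by rewrite /upd np nq bpE bqE.
- rewrite -E1; cbv delta [node_pre imin]; sx st.
  by rewrite !Ei -/l -/r !cl !cr !if_same (ifE _ id) (ifE' _ id) cpE cqE EK -minnE.
- rewrite -E1; cbv delta [node_pre imin]; sx st.
  rewrite !Ei -/l -/r !cl !cr !if_same (ifE _ id) (ifE' _ id) cpE cqE EK -minnE capE EB.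
  by [].
- by move=> i' ni; rewrite !upd_neq.
Qed.

Lemma dp_kids t j : 0 < j -> is_node t ->
  let cp := cap K (kids K t).1 in let cq := cap K (kids K t).2 in
  let fp := dp w M K (kids K t).1 in let fq := dp w M K (kids K t).2 in
  dp w M K t j = if is_par t then conv cp cq fp fq j else
    Cell (cbad (fp (minn j cp)) + cbad (fq (minn j cq)))
      (cval (fp (minn j cp)) + cval (fq (minn j cq)))%R (minn j cp) (minn j cq).
Proof. by case: j => // j _; case: t => //= a b _; case: (cap K a <= cap K b). Qed.

Definition cell_cost i := (tcost (TEq (IGet a_ty (IVar v_i)) (INum 0)) +
  (mcost ser_cell + par_cost (minn (cap K (kp i)) (cap K (kq i))))).+1 + mcost store.

Definition node_cost i := mcost node_pre +
  ((tcap i * (cell_cost i + tcost cell_test).+1 + (tcost cell_test).+1) + mcost node_post).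

Lemma node_runs i st : node_inv i st -> m < i < N ->
  runs node_body st (node_cost i) (node_inv i.+1).
Proof.
move=> inv im; have [[Ei EB ED EK EN] fs nt ko no] := inv.
apply: runs_seq; first exact: node_pre_runs inv im.
move=> st1 fr1; set p := iarr st1 a_L i; set q := iarr st1 a_R i => -[ko1 cv1 c1 [b1 cap1] LR1].
have [pl ql pE qE] := ko1; rewrite -/p in pl pE; rewrite -/q in ql qE.
rewrite -/(kp i) in pE; rewrite -/(kq i) in qE.
have [_ _ _ trE] := no i ltac:(lia).
have nleaf : is_node (tr i) by rewrite trE; case: eqP.
(* The children have lower blocks, so leaving everything below [i * D] unchanged keeps their tables
   valid while block [i] is written. *)
pose CI j (st' : state R) := [/\ child_vars st' (p * D) (q * D) (cap K (kp i)) (cap K (kq i)) j,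
  [/\ ivar st' v_c = tcap i, ivar st' v_B = i * D, ivar st' v_i = i &
      iarr st' a_ty i = iarr st a_ty i],
  (forall x, x < i * D -> [/\ iarr st' a_bad x = iarr st a_bad x,
     warr st' w_val x = warr st w_val x, iarr st' a_da x = iarr st a_da x &
     iarr st' a_db x = iarr st a_db x]),
  fresh st' (i * D + j) & forall j', j' < j -> celltab st' i j'].
have arr1 : [/\ iarr st1 a_bad = iarr st a_bad, warr st1 w_val = warr st w_val,
    iarr st1 a_da = iarr st a_da & iarr st1 a_db = iarr st a_db].
  by rewrite !(fr_iarr fr1) // (fr_warr fr1).
have CI0 : CI 1 st1.
  have [a1 a2 a3 a4] := arr1; split=> //.
  - by rewrite c1 (fr_iarr fr1) // (@fr_ivar _ _ _ _ fr1 v_B) // (@fr_ivar _ _ _ _ fr1 v_i).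
  - by move=> x _; rewrite a1 a2 a3 a4.
  - by move=> x xge; rewrite a1 a2 a3 a4; apply: fs; lia.
  - move=> j'; rewrite ltnS leqn0 => /eqP ->; rewrite /celltab dp0 a1 a2 a3 a4 addn0.
    exact: fs.
have := @runs_for_const _ cell_test cell_body CI (cell_cost i) 1 (tcap i).+1 st1.
rewrite subn1 [_.+1.-1]/= => h; apply: (@runs_seq _ _ _ _ _ _ (CI (tcap i).+1)).
  apply: h CI0 => // [j st2 /andP[j0 jc] [cv2 [c2 B2 i2 ty2] lo2 fs2 ct2]|]; last first.
    by move=> st2 [[_ _ _ _ Ej] [Ec _ _ _] _ _ _]; rewrite /cell_test /= Ej Ec -ltnNge.
  have [_ _ _ _ Ej] := cv2.
  split; first by rewrite /cell_test /= Ej c2 -ltnS.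
  have ab p' c : 0 < p' < i -> tr p' = c -> at_base st2 (p' * D) (cap K c) (dp w M K c).
    move=> /[dup] p'i /nt [_ _ n3] <- a ac.
    have [h1 h2 _ _] := lo2 (p' * D + a) ltac:(apply: idx_lt; have := tcap_lt p'; lia).
    by rewrite h1 h2; have [] := n3 a ac.
  have abp := ab p (kp i) pl pE; have abq := ab q (kq i) ql qE.
  apply: (@runs_seq _ _ _ _ _ _ (fun st' => best st' (tdp i j))).
    rewrite (dp_kids j0 nleaf); apply: runs_if; rewrite /= i2 ty2 => tyE.
      have -> : is_par (tr i) = false by rewrite trE tyE.
      exact: ser_cell_runs cv2 abp abq.
    have -> : is_par (tr i) by rewrite trE (negPf tyE).
    have -> : minn (cap K (kp i)) (cap K (kq i)) = cap K (kp i).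
      apply/minn_idPl; rewrite /kp /kq trE (negPf tyE) /=.
      by case: (leqP (tcap _) (tcap _)) => //= /ltnW.
    exact: par_cell_runs cv2 abp abq.
  move=> st3 fr3 [d1 d2 d3 d4].
  have cv3 : child_vars st3 (p * D) (q * D) (cap K (kp i)) (cap K (kq i)) j.
    exact: child_vars_frame fr3 _ cv2.
  have [_ _ _ _ Ej3] := cv3.
  have [[c3 B3 i3] ty3] : [/\ ivar st3 v_c = tcap i, ivar st3 v_B = i * D & ivar st3 v_i = i] /\
      iarr st3 a_ty i = iarr st a_ty i by rewrite !(fr_ivar fr3) // (fr_iarr fr3).
  have arr3 : [/\ iarr st3 a_bad = iarr st2 a_bad, warr st3 w_val = warr st2 w_val,
      iarr st3 a_da = iarr st2 a_da & iarr st3 a_db = iarr st2 a_db].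
    by rewrite !(fr_iarr fr3) // (fr_warr fr3).
  have [e1 e2 e3 e4] := arr3.
  apply: runs_weak (runs_run _ _) _ _ => // st4 fr4 E4.
  set z := i * D + j.
  have [g1 g2 g3 g4] : [/\ iarr st4 a_bad = upd (iarr st2 a_bad) z (cbad (tdp i j)),
      warr st4 w_val = upd (warr st2 w_val) z (cval (tdp i j)),
      iarr st4 a_da = upd (iarr st2 a_da) z (cda (tdp i j)) &
      iarr st4 a_db = upd (iarr st2 a_db) z (cdb (tdp i j))].
    by rewrite -E4; cbv delta [store]; sx st3; rewrite B3 Ej3 d1 d2 d3 d4 e1 e2 e3 e4.
  split.
  - have [f1 f2 f3 f4 _] := cv3; rewrite -E4 /child_vars; cbv delta [store]; sx st3.
    by rewrite f1 f2 f3 f4 Ej3 addn1.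
  - by rewrite !(fr_ivar fr4) // (fr_iarr fr4).
  - move=> x xlt; have [h1 h2 h3 h4] := lo2 x xlt.
    by rewrite g1 g2 g3 g4 !upd_neq ?h1 ?h2 ?h3 ?h4 // /z; lia.
  - move=> x xge; have [h1 h2 h3 h4] := fs2 x ltac:(lia).
    by rewrite g1 g2 g3 g4 !upd_neq // /z; lia.
  - move=> j'; rewrite ltnS leq_eqVlt => /orP[/eqP ->|jj].
      by rewrite /celltab -/z g1 g2 g3 g4 !updE.
    have [h1 h2 h3 h4] := ct2 j' jj.
    have nz : i * D + j' != z by rewrite /z eqn_add2l ltn_eqF.
    by rewrite /celltab g1 g2 g3 g4 !(upd_neq _ _ nz).
move=> st2 fr2 [_ [c2 B2 i2 _] lo2 fs2 ct2].
have [fv2 fa2] : (forall x, x \in [:: v_D; v_K; v_N] -> ivar st2 x = ivar st x) /\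
    (forall a, a \in [:: a_ty] -> iarr st2 a = iarr st a).
  split=> x; rewrite !inE; first by case/or3P=> /eqP ->; rewrite (fr_ivar fr2) // (fr_ivar fr1).
  by move/eqP ->; rewrite (fr_iarr fr2) // (fr_iarr fr1).
have [L2 R2 b2 cap2] : [/\ iarr st2 a_L = iarr st1 a_L, iarr st2 a_R = iarr st1 a_R,
    iarr st2 a_base = upd (iarr st a_base) i (i * D) &
    iarr st2 a_cap = upd (iarr st a_cap) i (tcap i)].
  by rewrite !(fr_iarr fr2).
apply: runs_weak (runs_run _ _) _ _ => // st3 fr3 E3.
have A3 : iarr st3 = iarr st2 by rewrite -E3.
have V3 : warr st3 = warr st2 by rewrite -E3.
split.
- rewrite -E3; cbv delta [node_post]; sx st2.
  by rewrite B2 i2 !fv2 // ED EK EN addn1 mulSn addnC.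
- move=> x xge; have xD : i * D + D <= x by move: xge; rewrite mulSn addnC.
  by rewrite A3 V3; apply: fs2; have := tcap_lt i; lia.
- move=> i' /andP[i0' ii]; rewrite /nodetab /celltab A3 V3 -/(celltab st2).
  have [->|ni] := eqVneq i' i.
    by split; [rewrite b2 updE|rewrite cap2 updE|move=> j jc; apply: ct2].
  have {}ii : i' < i by lia.
  apply: (nodetab_below (st := st) (st' := st2) ii) => //.
  - by rewrite b2 upd_neq.
  - by rewrite cap2 upd_neq.
  - by apply: nt; rewrite i0'.
- move=> i' ii; rewrite /kids_ok A3 L2 R2.
  have [->|ni] := eqVneq i' i; first exact: ko1.
  by have [-> ->] := LR1 i' ni; apply: ko; lia.
- move=> i' ii; have ni : i' != i by lia.
  have [] := no i' ltac:(lia); rewrite /node_ok A3 L2 R2 fa2 //.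
  by have [-> ->] := LR1 i' ni.
Qed.

End PhaseTables.

(** * Tracing the optimal solution back to the leaves *)

Lemma lset_kids (E : finType) K (t : tree E) : is_node t ->
  lset t = lset (kids K t).1 :|: lset (kids K t).2.
Proof.
case: t => //= a b _; first by rewrite lset_Ser.
by rewrite lset_Par; case: ifP => //= _; rewrite setUC.
Qed.

Lemma disjoint_kids (E : finType) K (t : tree E) : is_node t -> uniq (leaves t) ->
  [disjoint lset (kids K t).1 & lset (kids K t).2].
Proof.
have dis (a b : tree E) : uniq (leaves a ++ leaves b) -> [disjoint lset a & lset b].
  rewrite cat_uniq => /and3P[_ /hasPn nh _].
  by rewrite disjoint_sym disjoint_subset; apply/subsetP => e; rewrite !inE => /nh.
by case: t => //= a b _ /dis d //; case: ifP => //= _; rewrite disjoint_sym.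
Qed.

Lemma lset_neq0 (E : finType) (t : tree E) : exists e, e \in lset t.
Proof.
by elim: t => [e|a [e ea] b _|a [e ea] b _]; exists e;
  rewrite ?lset_Ser ?lset_Par inE ?ea //= mem_head.
Qed.

Section PhaseTrace.
Variable R : realDomainType.
Implicit Types (st : state R).
Variables (m K : nat) (w : 'I_m -> R) (M : {set 'I_m}) (tr : nat -> tree 'I_m) (N : nat).
Hypotheses (K_gt0 : 0 < K) (tr_leaf : forall e : 'I_m, tr e.+1 = Leaf e).
Hypothesis tr_node : forall i, m < i < N -> is_node (tr i) /\ uniq (leaves (tr i)).
Let D := K.+2.
Notation tcap i := (cap K (tr i)).
Notation tdp i := (dp w M K (tr i)).
Notation sol i j := (solset w M K (tr i) j).

Definition tables st := (forall i, 0 < i < N -> nodetab K w M tr st i) /\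
  (forall i, m < i < N -> kids_ok K tr st i).

Lemma tables_frame c st st' : frame c st st' -> w_val \notin waw c ->
  all (fun a => a \notin iaw c) [:: a_base; a_cap; a_bad; a_da; a_db; a_L; a_R] ->
  tables st -> tables st'.
Proof.
move=> [_ fi _ fw] hw /allP ha [h1 h2].
have E a : a \in [:: a_base; a_cap; a_bad; a_da; a_db; a_L; a_R] -> iarr st' a = iarr st a.
  by move=> /ha; apply: fi.
split=> i ii; last by have := h2 i ii; rewrite /kids_ok !E.
have [k1 k2 k3] := h1 i ii; split; rewrite ?E // => j jc.
by have := k3 j jc; rewrite /celltab !E // fw.
Qed.

(** Demand 0 means no request, as its [solset] is empty. Disjointness of the leaf sets of requested
    nodes stands in for the tree structure: it ensures that nothing is pending at the children of a
    requested node when their demands are overwritten. *)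
Definition needs st i (A : {set 'I_m}) :=
  [/\ (forall l, 0 < l < i -> iarr st a_need l <= tcap l),
      (forall e, e \in A <-> exists2 l, 0 < l < i & e \in sol l (iarr st a_need l)) &
      (forall l l', 0 < l < i -> 0 < l' < i -> l != l' -> iarr st a_need l != 0 ->
         iarr st a_need l' != 0 -> [disjoint lset (tr l) & lset (tr l')])].

Lemma needs_skip st i A : needs st i.+1 A -> iarr st a_need i = 0 -> needs st i A.
Proof.
move=> [h1 h2 h3] i0; split=> [l li|e|l l' li li'].
- by apply: h1; lia.
- rewrite h2; split=> -[l li el]; exists l => //; last by lia.
  have [lE|] := eqVneq l i; last by lia.
  by move: el; rewrite lE i0 solset0 inE.
- by apply: h3; lia.
Qed.

Lemma needs_step st st' i A : needs st i.+1 A -> m < i < N -> kids_ok K tr st i ->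
  iarr st a_need i != 0 ->
  iarr st' a_need = upd (upd (iarr st a_need) (iarr st a_L i) (cda (tdp i (iarr st a_need i))))
     (iarr st a_R i) (cdb (tdp i (iarr st a_need i))) ->
  needs st' i A.
Proof.
move=> [h1 h2 h3] im [pl ql pE qE] nz E.
set p := iarr st a_L i in pl pE E; set q := iarr st a_R i in ql qE E.
set j := iarr st a_need i in nz E.
have [nd ut] := tr_node im.
have ls := lset_kids K nd; rewrite -pE -qE in ls.
have ds := disjoint_kids K nd ut; rewrite -pE -qE in ds.
have npq : p != q.
  apply/eqP => pq; have [e ep] := lset_neq0 (tr p).
  by move: ds; rewrite -pq disjoint_subset => /subsetP/(_ e ep); rewrite inE /= ep.
have dis l : 0 < l < i -> iarr st a_need l != 0 -> [disjoint lset (tr l) & lset (tr i)].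
  by move=> li ln; apply: h3 => //; [lia|lia|apply/eqP; lia].
have sp : lset (tr p) \subset lset (tr i) by rewrite ls subsetUl.
have sq : lset (tr q) \subset lset (tr i) by rewrite ls subsetUr.
(* A pending node inside [tr i] would share a leaf with the pending node [i], against
   disjointness. *)
have zero l : 0 < l < i -> lset (tr l) \subset lset (tr i) -> iarr st a_need l = 0.
  move=> li sl; apply/eqP; apply: contraT => /(dis l li) d.
  have [e el] := lset_neq0 (tr l).
  by move: d; rewrite disjoint_subset => /subsetP/(_ e el); rewrite inE /= (subsetP sl).
have pz := zero p pl sp; have qz := zero q ql sq.
have bnd := dp_bounds w M K_gt0 (tr i) j; rewrite -pE -qE in bnd.
have np' : iarr st' a_need p = cda (tdp i j) by rewrite E upd_neq ?updE.
have nq' : iarr st' a_need q = cdb (tdp i j) by rewrite E updE.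
have no' l : l != p -> l != q -> iarr st' a_need l = iarr st a_need l.
  by move=> lp lq; rewrite E !upd_neq.
split.
- move=> l li; have [->|lp] := eqVneq l p; first by rewrite np'; case/andP: bnd.
  have [->|lq] := eqVneq l q; first by rewrite nq'; case/andP: bnd.
  by rewrite no' //; apply: h1; lia.
- have solE : sol i j = sol p (cda (tdp i j)) :|: sol q (cdb (tdp i j)).
    by rewrite solset_kids // pE qE.
  move=> e; rewrite h2; split=> -[l li el].
    have [lE|nl] := eqVneq l i.
      move: el; rewrite lE -/j solE inE => /orP[] el; [exists p|exists q] => //.
        by rewrite np'.
      by rewrite nq'.
    exists l; first by lia.
    have [lp|lp] := eqVneq l p; first by move: el; rewrite lp pz solset0 inE.
    have [lq|lq] := eqVneq l q; first by move: el; rewrite lq qz solset0 inE.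
    by rewrite no'.
  have [lp|lp] := eqVneq l p.
    by exists i; [lia|move: el; rewrite lp np' -/j solE inE => ->].
  have [lq|lq] := eqVneq l q.
    by exists i; [lia|move: el; rewrite lq nq' -/j solE inE => ->; rewrite orbT].
  by exists l; [lia|rewrite -no'].
- have dpq l l' : 0 < l' < i -> (l == p) || (l == q) -> l' != p -> l' != q ->
      iarr st' a_need l' != 0 -> [disjoint lset (tr l) & lset (tr l')].
    move=> li' lpq lp' lq'; rewrite no' // => /(dis l' li') d.
    rewrite disjoint_sym; apply: disjointWr d.
    by case/orP: lpq => /eqP ->.
  move=> l l' li li' nll n1 n2.
  have [o1|o1] := boolP ((l == p) || (l == q)); have [o2|o2] := boolP ((l' == p) || (l' == q)).
  + case/orP: o1 nll => /eqP ->; case/orP: o2 => /eqP ->; rewrite ?eqxx //.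
    by rewrite disjoint_sym.
  + by move: o2; rewrite negb_or => /andP[a b]; apply: dpq.
  + by rewrite disjoint_sym; move: o1; rewrite negb_or => /andP[a b]; apply: dpq.
  + move: o1 o2; rewrite !negb_or => /andP[a1 b1] /andP[a2 b2].
    by move: n1 n2; rewrite !no' // => n1 n2; apply: h3 => //; lia.
Qed.

Lemma trace_runs st A : m < N -> tables st -> ivar st v_m = m -> ivar st v_i = N -> needs st N A ->
  runs (CWhile trace_test trace_body) st
    ((N - m.+1) * (mcost trace_body + tcost trace_test).+1 + (tcost trace_test).+1)
    (fun st' => needs st' m.+1 A).
Proof.
move=> mN tabs0 Em Ei nd0.
pose I k st' := [/\ tables st', ivar st' v_m = m, ivar st' v_i = N - k & needs st' (N - k) A].
have I0 : I 0 st by rewrite /I subn0.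
have := @runs_for_const _ trace_test trace_body I (mcost trace_body) 0 (N - m.+1) st.
rewrite subn0 => h; apply: runs_weak (h _ _ _ I0) _ _ => // {h}.
- move=> k st1 /andP[_ km] [tb1 Em1 Ei1 nd1]; split.
    by rewrite /trace_test /= Em1 Ei1; lia.
  set i := N - k.+1; have iE : N - k = i.+1 by rewrite /i; lia.
  have im : m < i < N by rewrite /i; lia.
  rewrite iE in Ei1 nd1.
  have [nt ko] := tb1; have [bi ci ti] := nt i ltac:(lia); have ki := ko i im.
  have [h1 _ _] := nd1.
  have [_ _ da db] := ti _ (h1 i ltac:(lia)).
  apply: runs_weak (runs_run _ _) _ _ => // st2 fr2 E2.
  have nE : iarr st2 a_need = if iarr st1 a_need i == 0 then iarr st1 a_need else
     upd (upd (iarr st1 a_need) (iarr st1 a_L i) (cda (tdp i (iarr st1 a_need i))))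
     (iarr st1 a_R i) (cdb (tdp i (iarr st1 a_need i))).
    rewrite -E2; cbv delta [trace_body]; sx st1; rewrite Ei1 subn1 [i.+1.-1]/= bi.
    by rewrite da db.
  split.
  + exact: tables_frame fr2 _ _ tb1.
  + by rewrite (fr_ivar fr2).
  + by rewrite -E2; cbv delta [trace_body]; sx st1; rewrite Ei1 subn1 if_same.
  + rewrite -/i; move: nE; case: eqP => [z|/eqP nz] nE; last exact: needs_step nd1 im ki nz nE.
    have := needs_skip nd1 z; rewrite /needs nE; exact.
- by move=> st1 [_ Em1 Ei1 _]; rewrite /trace_test /= Em1 Ei1; lia.
- by move=> st1 _ [_ _ _]; rewrite (_ : N - (N - m.+1) = m.+1) //; lia.
Qed.

Lemma out_runs st A : ivar st v_m = m -> ivar st v_i = 0 -> needs st m.+1 A ->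
  runs (CWhile out_test out_body) st
    (m * (mcost out_body + tcost out_test).+1 + (tcost out_test).+1)
    (fun st' => A = [set e : 'I_m | iarr st' a_end1 e == 1]).
Proof.
move=> Em Ei nd.
pose I k st' := [/\ ivar st' v_m = m, ivar st' v_i = k, iarr st' a_need = iarr st a_need &
  forall e, e < k -> iarr st' a_end1 e = (iarr st a_need e.+1 != 0)].
have I0 : I 0 st by split.
have := @runs_for_const _ out_test out_body I (mcost out_body) 0 m st.
rewrite subn0 => h; apply: runs_weak (h _ _ _ I0) _ _ => // {h}.
- move=> k st1 /andP[_ km] [Em1 Ei1 n1 o1]; split.
    by rewrite /out_test /= Em1 Ei1; lia.
  apply: runs_weak (runs_run _ _) _ _ => // st2 fr2 E2.
  split.
  + by rewrite (fr_ivar fr2).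
  + by rewrite -E2; cbv delta [out_body]; sx st1; rewrite Ei1 if_same addn1.
  + by rewrite (fr_iarr fr2).
  + move=> e ek; rewrite -E2; cbv delta [out_body]; sx st1; rewrite Ei1 n1 addn1.
    have [->|ne] := eqVneq e k; first by case: (_ == 0); rewrite updE.
    by rewrite -o1; [case: (_ == 0); rewrite upd_neq|lia].
- by move=> st1 [Em1 Ei1 _ _]; rewrite /out_test /= Em1 Ei1; lia.
- move=> st1 _ [_ _ _ o1]; have [_ h2 _] := nd.
  apply/setP => e; rewrite inE o1 //; apply/idP/idP.
    case/h2 => l /andP[l0 lm] el.
    have l1 : l.-1 < m by lia.
    have lE : l = (Ordinal l1).+1 by rewrite /=; lia.
    move: el; rewrite lE tr_leaf /=; case: ifP => [|lz]; first by rewrite inE.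
    by rewrite inE => /eqP ->; rewrite /= lz.
  rewrite eqb1 => nz; apply/h2; exists e.+1; first by rewrite /= ltnS ltn_ord.
  by rewrite tr_leaf /= (negPf nz) inE.
Qed.

End PhaseTrace.

Lemma node_ok_is_node m (tr : nat -> tree 'I_m) L Rr ty i :
  node_ok tr L Rr ty i -> is_node (tr i) /\ uniq (leaves (tr i)).
Proof. by move=> [_ _ u E]; split=> //; rewrite E; case: (_ == 0). Qed.

Section NodePhase.
Variable R : realDomainType.
Variables (m K : nat) (w : 'I_m -> R) (M : {set 'I_m}) (tr : nat -> tree 'I_m) (N : nat).
Hypotheses (K_gt0 : 0 < K) (tr_leaf : forall e : 'I_m, tr e.+1 = Leaf e).
Hypothesis tr_node : forall i, m < i < N -> is_node (tr i) /\ uniq (leaves (tr i)).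

Lemma node_phase_runs (st : state R) : m < N -> node_inv K w M tr N m.+1 st ->
  runs phase_node st
    ((\sum_(m.+1 <= i < N) (node_cost K tr i + tcost node_test).+1) + (tcost node_test).+1)
    (node_inv K w M tr N N).
Proof.
move=> mN I0; apply: (runs_for (I := node_inv K w M tr N)) I0 => //.
- move=> i st1 im inv; split; last by apply: node_runs.
  by have [[Ei _ _ _ EN] _ _ _ _] := inv; rewrite /node_test /= Ei EN; lia.
- by move=> st1 [[Ei _ _ _ EN] _ _ _ _]; rewrite /node_test /= Ei EN; lia.
Qed.

Definition node_const := mcost node_pre + (tcost (TEq (IGet a_ty (IVar v_i)) (INum 0)) +
  mcost ser_cell + mcost par_init + (mcost par_body + tcost par_test).+1 + (tcost par_test).+1 +
  mcost store + tcost cell_test + 2) + (tcost cell_test).+1 + mcost node_post + (tcost node_test).+1.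

Lemma node_cost_le i : is_node (tr i) ->
  (node_cost K tr i + tcost node_test).+1 <= node_const * (nodew K (tr i)).+1.
Proof.
move=> nd.
have nE : nodew K (tr i) = cap K (tr i) *
    (minn (cap K (kids K (tr i)).1) (cap K (kids K (tr i)).2)).+1.
  by case: (tr i) nd => //= a b _; case: ifP => //= _; rewrite minnC.
rewrite nE /node_cost /cell_cost /par_cost /node_const.
move: (minn _ _) (cap K (tr i)) (mcost _) (mcost _) (mcost _) (mcost _) (mcost _) (mcost _).
move: (tcost _) (tcost _) (tcost _) (tcost _) => t1 t2 t3 t4 mn c m1 m2 m3 m4 m5 m6.
nia.
Qed.

End NodePhase.

Section RootPhase.
Variable R : realDomainType.
Variables (m K : nat) (w : 'I_m -> R) (M : {set 'I_m}) (tr : nat -> tree 'I_m) (N : nat).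
Hypotheses (K_gt0 : 0 < K) (tr_leaf : forall e : 'I_m, tr e.+1 = Leaf e).
Hypothesis tr_node : forall i, m < i < N -> is_node (tr i) /\ uniq (leaves (tr i)).

Definition out_cost := mcost (CSeq (CIPut a_need (IVar v_p) (IVar v_c)) (CISet v_i (IVar v_N))) +
  ((N - m.+1) * (mcost trace_body + tcost trace_test).+1 + (tcost trace_test).+1 +
   (mcost (CISet v_i (INum 0)) + (m * (mcost out_body + tcost out_test).+1 + (tcost out_test).+1 +
     mcost (CISet v_n (INum 1))))).

Definition root_cost := mcost root_cmd +
  (tcost root_test + (out_cost + mcost (CISet v_n (INum 0)))).+1.

Lemma root_runs (st : state R) n s t r : m < N -> tables K w M tr N st ->
  consts m K n s t st -> tabs n st -> s < n -> ivar st v_N = N ->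
  iarr st a_mat (s * n + t) = r -> 0 < r < N -> (forall i, iarr st a_need i = 0) ->
  let c := cap K (tr r) in
  runs phase_root st root_cost (fun st' =>
    if cbad (dp w M K (tr r) c) == 0 then
      ivar st' 0 = 1 /\ solset w M K (tr r) c = [set e : 'I_m | iarr st' 0 e == 1]
    else ivar st' 0 = 0).
Proof.
move=> mN tb [En Em Es Et EK] tabn sn EN rE rN nz0 c.
apply: runs_seq; first exact: runs_run.
have [nt _] := tb; have [br cr tr_r] := nt r rN.
move=> st1 fr1 E1.
have [p1 c1] : ivar st1 v_p = r /\ ivar st1 v_c = c.
  rewrite -E1; cbv delta [root_cmd]; sx st; rewrite Es Et.
  by have [-> _ _ _] := tabn s ltac:(lia); rewrite rE cr.
have tb1 := tables_frame fr1 isT isT tb.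
have tE : teval st1 root_test = (cbad (dp w M K (tr r) c) == 0).
  have [nt1 _] := tb1; have [br1 _ tr1] := nt1 r rN.
  by rewrite /root_test /= p1 c1 br1; have [-> _ _ _] := tr1 c (leqnn _).
apply: runs_if; rewrite tE; last by move=> /negPf ->; apply: runs_straight.
move=> ok; rewrite ok; apply: runs_seq; first exact: runs_run.
move=> st2 fr2 E2.
have n1 : forall i, iarr st1 a_need i = 0 by move=> i; rewrite (fr_iarr fr1).
have [nd2 i2] : iarr st2 a_need = upd (iarr st1 a_need) r c /\ ivar st2 v_i = N.
  by rewrite -E2; sx st1; rewrite p1 c1 (fr_ivar fr1).
have m2 : ivar st2 v_m = m by rewrite (fr_ivar fr2) // (fr_ivar fr1).
have tb2 := tables_frame fr2 isT isT tb1.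
have nds : needs K w M tr st2 N (solset w M K (tr r) c).
  split; rewrite nd2.
  - by move=> l ln; rewrite /upd; case: (l =P r) => [->|_]; rewrite ?n1.
  - move=> e; split=> [el|[l ln]]; first by exists r; rewrite ?updE.
    by rewrite /upd; case: (l =P r) => [->//|_]; rewrite n1 solset0 inE.
  - move=> l l' _ _ nll; rewrite /upd; case: (l =P r) => [lr|_]; last by rewrite n1.
    by move: nll; rewrite lr eq_sym => /negPf ->; rewrite n1.
apply: runs_seq; first exact: (trace_runs K_gt0 tr_node mN tb2 m2 i2 nds).
move=> st3 fr3 nds3; apply: runs_seq; first exact: runs_run.
move=> st4 fr4 E4.
have i4 : ivar st4 v_i = 0 by rewrite -E4.
have m4 : ivar st4 v_m = m by rewrite (fr_ivar fr4) // (fr_ivar fr3).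
have nds4 : needs K w M tr st4 m.+1 (solset w M K (tr r) c).
  by have := nds3; rewrite /needs (fr_iarr fr4).
apply: runs_seq; first exact: (out_runs K_gt0 tr_leaf m4 i4 nds4).
by move=> st5 fr5 ->; apply: runs_straight.
Qed.

End RootPhase.

(** * Constants and assembly of the phases *)

Definition setup_const := mcost (CISet v_K (IAdd (IVar v_k) (INum 1))) +
  3 * (mcost setup_body + tcost setup_test).+1 + (tcost setup_test).+1.
(** The factor 6 comes from [m <= 4 * n + 2 <= 6 * n]. *)
Definition load_const := mcost (CISet v_i (INum 0)) +
  6 * (mcost load_pre + (mcost add_sums + mcost put_mat) + tcost load_test).+1 + (tcost load_test).+1.
Definition reduce_const :=
  mcost (CSeq (CISet v_N (IAdd (IVar v_m) (INum 1))) (CISet v_qt (IVar v_n))) +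
  4 * (mcost reduce_body + tcost reduce_test).+1 + (tcost reduce_test).+1.
Definition leaf_const := mcost (CSeq (CISet v_D (IAdd (IVar v_K) (INum 2)))
      (CSeq (CISet v_B (IVar v_D)) (CISet v_i (INum 1)))) +
  6 * (mcost leaf_body + tcost leaf_test).+1 + (tcost leaf_test).+1.
(** 194 is 192 + 2. At most [2 * n] inner nodes exist. The root, with [q <= m] leaves, has potential
    [4 * phi (2 * q) <= 16 * q * K], and [m * K <= 12 * n * maxn k 1] by [m <= 6 * n] and
    [k + 1 <= 2 * maxn k 1]. *)
Definition nodes_const := 194 * node_const + (tcost node_test).+1.
Definition root_const := mcost root_cmd + tcost root_test +
  mcost (CSeq (CIPut a_need (IVar v_p) (IVar v_c)) (CISet v_i (IVar v_N))) +
  2 * (mcost trace_body + tcost trace_test).+1 + (tcost trace_test).+1 +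
  mcost (CISet v_i (INum 0)) + 6 * (mcost out_body + tcost out_test).+1 + (tcost out_test).+1 +
  mcost (CISet v_n (INum 1)) + mcost (CISet v_n (INum 0)) + 1.

Lemma leq_affine c0 c1 c2 a b X : 0 < X -> a <= b * X ->
  c0 + (a * c1 + c2) <= (c0 + b * c1 + c2) * X.
Proof. nia. Qed.

Lemma load_ord (T : Type) m (z : T) (f : 'I_m -> T) (e : 'I_m) : load z f e = f e.
Proof. by rewrite /load valK. Qed.

Section Main.
Variables (R : realDomainType) (G : tgraph) (w : 'I_(ne G) -> R) (M : {set 'I_(ne G)}) (k : nat).
Hypotheses (Gs : simple_graph G) (Gsp : series_parallel G) (w_ge0 : forall e, (0 <= w e)%R).
Let n := nv G.
Let m := ne G.
Let K := k.+1.
Let X := n * maxn k 1.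

Lemma output_correct (t : tree 'I_m) (st : state R) : uniq (leaves t) ->
  (forall A, has_st_path A <-> conn t A) -> let c := cap K t in
  (if cbad (dp w M K t c) == 0 then
     ivar st 0 = 1 /\ solset w M K t c = [set e : 'I_m | iarr st 0 e == 1]
   else ivar st 0 = 0) -> ftp_correct_output w M k st.
Proof.
move=> ut ct c.
(* Feasibility is demand [K = k + 1], which by saturation is equivalent to the last table entry. *)
have feas S : ftp_feasible M k S <-> sat M t S c.
  have -> : sat M t S c <-> sat M t S K.
    split; first exact: sat_cap.
    by apply: sat_leq; apply: geq_minl.
  by split=> H F FM Fk; apply/ct; apply: H.
have := dp_opt M w_ge0 (isT : 0 < K) ut (geq_minl K _ : c <= K); rewrite /isopt.
case: eqP => _ h; last by move=> E; right; split=> // S /feas; apply: h.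
case: h => sub st_ vE lb [E1 AE]; left; split=> //.
rewrite /output_set -AE; split=> [|S' /feas S'sat]; first exact/feas.
apply: le_trans (_ : _ <= wt w (S' :&: lset t))%R _; last by apply: wt_sub; rewrite ?subsetIl.
by rewrite -/(wt w (solset w M K t c)) -vE; apply: lb.
Qed.

Lemma program_runs : runs ftp_program (ftp_input w M k)
  (setup_const * X + (load_const * X + (reduce_const * X + (leaf_const * X +
    (nodes_const * X + root_const * X))))) (ftp_correct_output w M k).
Proof.
have [nst _] := sp_reduces Gsp.
have nstv : val (src G) != val (snk G) by [].
have n1 : 0 < n by rewrite (leq_ltn_trans _ (ltn_ord (src G))).
have X1 : n <= X by rewrite /X leq_pmulr; lia.
have X0 : 0 < X by lia.
have m6 : m <= 6 * X by have := sp_edges Gs Gsp; rewrite -/m -/n; lia.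
have mK : m * K <= 12 * X.
  have : m <= 6 * n by have := sp_edges Gs Gsp; rewrite -/m -/n; lia.
  by rewrite /X /K; case: (leqP k 1); nia.
set st0 := ftp_input w M k.
have z0 a i : 3 <= a -> iarr st0 a i = 0 by case: a => [|[|[|a]]].
apply: runs_seq.
  apply: runs_weak (setup_runs (st := st0) (n := n) (k := k) _ _ _ _ _) _ (fun _ _ q => q) => //.
  by apply: leq_affine => //; lia.
move=> st1 fr1 [K1 tb1 Q1].
have cs1 : consts m K n (src G) (snk G) st1 by split; rewrite // (fr_ivar fr1).
have z1 a i : a \notin [:: a_row; a_sq; a_rt; a_hf; a_Q] -> 3 <= a -> iarr st1 a i = 0.
  move=> na a3; rewrite (fr_iarr fr1) ?z0 //; apply: contraNN na.
  by rewrite !inE => /or4P[->|->|->|/orP[->|->]]; rewrite ?orbT.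
have ed1 : ends_loaded G st1.
  by move=> e; rewrite !(fr_iarr fr1) //= !load_ord.
apply: runs_seq.
  have [_ Em _ _ _] := cs1.
  apply: runs_weak (load_runs Gs Em tb1 ed1 _ _ _ _) _ (fun _ _ q => q);
    try by move=> i; apply: z1.
  exact: leq_affine.
move=> st2 fr2 [sm2 mt2].
have tb2 := tabs_frame fr2 isT tb1.
have cs2 := consts_frame fr2 isT cs1.
have [l lP [sl red]] := net0_reduces Gs Gsp.
have nt2 : netst K n (src G) (snk G) (fun A => has_st_path A) st2 (net0 G) (tree0 Gsp) m.+1.
  by split=> //; [apply: wnet0|apply: net0_uniq].
apply: runs_seq.
  apply: runs_weak (reduce_runs (isT : 0 < K) nstv tb2 cs2 _ _ nt2 sl red lP _ _) _ (fun _ _ q => q) => //.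
  - by rewrite (fr_ivar fr2) // (fr_ivar fr1).
  - by move=> i ilt; rewrite (fr_iarr fr2) // Q1 //; lia.
  - exact: ltn_ord.
  - exact: ltn_ord.
  - by apply: leq_affine => //; lia.
move=> st3 fr3 [tr [N [r [W EN Nle rE]]]].
have [We Wu Wc Wm Wl Wn Wp] := W.
have r0N : 0 < r < N by move: We => /= /andP[/and4P[_ _ -> ->]].
have ur : uniq (leaves (tr r)) by move: Wu; rewrite /= cats0.
have tb3 := tabs_frame fr3 isT tb2.
have cs3 := consts_frame fr3 isT cs2.
have [_ Em3 _ _ EK3] := cs3.
(* Arrays from number 15 on belong to the tables and the tracing, so the phases up to the reduction
   leave them at zero. *)
have z3 a i : 15 <= a -> iarr st3 a i = 0.
  move=> a15; rewrite (fr_iarr fr3) ?(fr_iarr fr2) ?z1 //.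
  - by rewrite !inE; lia.
  - by lia.
  - by rewrite /= !inE; lia.
  - by rewrite /= !inE; lia.
have inp3 : inputs w M st3.
  move=> e; rewrite (fr_warr fr3) // (fr_warr fr2) // (fr_warr fr1) //.
  by rewrite (fr_iarr fr3) // (fr_iarr fr2) // (fr_iarr fr1) //= !load_ord.
have fs3 : fresh st3 0.
  move=> x _; rewrite !z3 //; split=> //.
  by rewrite (fr_warr fr3) // (fr_warr fr2) // (fr_warr fr1).
apply: runs_seq.
  apply: runs_weak (leaf_runs (isT : 0 < K) Wl EK3 Em3 inp3 fs3) _ (fun _ _ q => q).
  exact: leq_affine.
move=> st4 fr4 [[i4 B4 D4 K4 m4] _ fs4 nt4].
have trn i : m < i < N -> is_node (tr i) /\ uniq (leaves (tr i)).
  by move=> /Wn; apply: node_ok_is_node.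
have I4 : node_inv K w M tr N m.+1 st4.
  split=> //.
  - by split=> //; rewrite (fr_ivar fr4).
  - by move=> i'; lia.
  - by move=> i' ii; have := Wn i' ii; rewrite !(fr_iarr fr4).
have lcm : leafcount (tr r) <= m.
  by rewrite -size_leaves -(card_uniqP ur) -[X in _ <= X]card_ord max_card.
apply: runs_seq.
  apply: runs_weak (node_phase_runs (isT : 0 < K) Wm I4) _ (fun _ _ q => q).
  have le1 : \sum_(m.+1 <= i < N) (node_cost K tr i + tcost node_test).+1 <=
      node_const * (\sum_(m.+1 <= i < N) nodew K (tr i) + (N - m.+1)).
    apply: leq_trans (_ : \sum_(m.+1 <= i < N) node_const * (nodew K (tr i)).+1 <= _).
      rewrite big_nat_cond [X in _ <= X]big_nat_cond; apply: leq_sum => i /andP[im _].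
      by apply: node_cost_le; case: (trn i im).
    rewrite -big_distrr leq_mul2l; apply/orP; right => /=.
    rewrite (eq_bigr (fun i => nodew K (tr i) + 1)); last by move=> i _; rewrite addn1.
    by rewrite big_split /= sum_nat_const_nat muln1.
  have le2 : \sum_(m.+1 <= i < N) nodew K (tr i) <= 192 * X.
    apply: leq_trans Wp _; rewrite big_seq1 /=.
    by have := phi_le (isT : 0 < K) (2 * leafcount (tr r)); nia.
  have le3 : N - m.+1 <= 2 * X by lia.
  have le4 := leq_trans le1 (leq_mul (leqnn node_const) (leq_add le2 le3)).
  rewrite /nodes_const mulnDl; apply: leq_add; last by rewrite leq_pmulr.
  by apply: leq_trans le4 _; rewrite -mulnDl mulnCA mulnA.
move=> st5 fr5 [[i5 _ _ K5 N5] _ nt5 ko5 _].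
have tb5 := tabs_frame fr5 isT (tabs_frame fr4 isT tb3).
have cs5 := consts_frame fr5 isT (consts_frame fr4 isT cs3).
have ct : forall A, has_st_path A <-> conn (tr r) A.
  by move=> A; rewrite Wc; apply: hrel_single.
apply: runs_weak (root_runs (isT : 0 < K) Wl trn Wm (conj nt5 ko5) cs5 tb5 _ N5 _ r0N _) _ _ => //.
- by rewrite (fr_iarr fr5) // (fr_iarr fr4).
- by move=> i; rewrite (fr_iarr fr5) // (fr_iarr fr4) // z3.
- have le3 : N - m.+1 <= 2 * X by lia.
  rewrite /root_cost /out_cost /root_const.
  move: (N - m.+1) le3 m6 => d le3 m6.
  move: (mcost root_cmd) (tcost root_test) (mcost trace_body) (tcost trace_test) (mcost out_body).
  move: (tcost out_test) (mcost (CSeq _ _)) (mcost (CISet v_n (INum 1))).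
  move: (mcost (CISet v_n (INum 0))) (mcost (CISet v_i (INum 0))) => c1 c2 c3 c4 c5 c6 c7 c8 c9 c10.
  nia.
- by move=> st6 _; apply: output_correct.
Qed.

End Main.

Theorem theorem9 :
  exists (P : cmd) (C : nat),
  forall (R : realDomainType) (G : tgraph) (w : 'I_(ne G) -> R)
         (M : {set 'I_(ne G)}) (k : nat),
    simple_graph G -> series_parallel G -> (forall e, (0 <= w e)%R) ->
    exists (T : nat) (st : state R),
      [/\ exec P (ftp_input w M k) T st,
          T <= C * (nv G * maxn k 1) &
          ftp_correct_output w M k st].
Proof.
exists ftp_program, (setup_const + (load_const + (reduce_const + (leaf_const +
  (nodes_const + root_const))))) => R G w M k Gs Gsp w_ge0.
have := program_runs M k Gs Gsp w_ge0; rewrite -!mulnDl.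
by case=> T [st [e le q]]; exists T, st.
Qed.
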